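(* The spectrum $\sigma(L_{W_1W_2})$ of any selfadjoint extension $L_{W_1W_2}=L_{W_1}\oplus L_{W_2}$ of the minimal operator $L_0$ in $L^2$ (where $W_1,W_2$ are unitary operators in $H$) coincides with $\mathbb{R}$.
   Context: Let $H$ be a separable Hilbert space with $\dim H>0$, let $-\infty<a_1<a_2<b_2<a_3<+\infty$, and put $I_1=(-\infty,a_1)$, $I_2=(a_2,b_2)$, $I_3=(a_3,+\infty)$. For $k=1,2,3$ let $A_k:D(A_k)\subset H\to H$ be a linear selfadjoint operator. $L^2(H,I)$ denotes the Hilbert space of square-integrable $H$-valued functions on the interval $I$, and $L^2=L^2(H,I_1)\oplus L^2(H,I_2)\oplus L^2(H,I_3)$. $H_{k,+}$ is $D(A_k)$ with inner product $(f,g)_{k,+}=(A_kf,A_kg)_H+(f,g)_H$; $H_{k,-}$ is the corresponding negative space, i.e. the completion of $H$ in the norm $\|f\|_{k,-}=\sup\{|(f,g)_H|/\|g\|_{k,+}: 0\ne g\in H_{k,+}\}$. $\tilde A_k:H\to H_{k,-}$ is the adjoint of the continuous operator $A_k:H_{k,+}\to H$; it is a continuous extension of $A_k$. Operators: the maximal operator $L_k$ acts by $L_ku=iu'+\tilde A_ku$ on the domain of all $u\in L^2(H,I_k)$ for which $iu'+\tilde A_ku$ (derivative in the sense of $H_{k,-}$-valued distributions) belongs to $L^2(H,I_k)$. Each such $u$ has a representative which is continuous into $H$ up to the finite endpoints of $I_k$, so boundary values at finite endpoints are elements of $H$. The minimal operator $L_{k0}$ is the closure in $L^2(H,I_k)$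 of the restriction of $L_k$ to finite sums $\sum_j\varphi_jh_j$ with $\varphi_j\in C_0^\infty(I_k)$, $h_j\in D(A_k)$. Put $L_0=L_{10}\oplus L_{20}\oplus L_{30}$ and $L=L_1\oplus L_2\oplus L_3$. For unitary operators $W_1,W_2:H\to H$, $L_{W_1W_2}$ is the selfadjoint extension of $L_0$ obtained by restricting $L$ to those $u=(u_1,u_2,u_3)\in D(L)$ with $u_3(a_3)=W_1u_1(a_1)$ and $u_2(b_2)=W_2u_2(a_2)$. It is the direct sum of $L_{W_1}$, the restriction of $L_1\oplus0\oplus L_3$ in $L^2(H,I_1)\oplus0\oplus L^2(H,I_3)$ by the condition $u_3(a_3)=W_1u_1(a_1)$, and $L_{W_2}$, the restriction of $0\oplus L_2\oplus0$ in $0\oplus L^2(H,I_2)\oplus0$ by the condition $u_2(b_2)=W_2u_2(a_2)$. *)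

(* Defs.v *)
From HB Require Import structures.
From mathcomp Require Import all_boot all_order all_algebra.
From mathcomp Require Import generic_quotient ring_quotient sesquilinear.
From mathcomp Require Import complex.
From mathcomp Require Import all_classical all_reals all_analysis.
From mathcomp Require Import measurable_realfun.
From mathcomp Require Import ring lra.

Set Implicit Arguments.
Unset Strict Implicit.
Unset Printing Implicit Defensive.

Import Order.TTheory GRing.Theory Num.Theory Num.Def.
Import numFieldNormedType.Exports.

Local Open Scope classical_set_scope.
Local Open Scope ring_scope.
Local Open Scope complex_scope.

(* Inner products are linear in the first and conjugate-linear in the second
   argument. Norms of a normedModType over R[i] take values in R[i]; rnorm and
   dot_norm below are their R-valued versions. *)
Record hilbertSpace (R : realType) := HilbertSpace {
  hcarrier :> completeNormedModType R[i];
  hdot : {dot hcarrier for Num.conj};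
  hdotE : forall x, hdot x x = `|x| ^+ 2
}.

Section real_norm.
Context {R : realType} {V : normedModType R[i]}.
Implicit Types x y : V.

Definition rnorm x : R := complex.Re `|x|.

Lemma rnormE x : (rnorm x)%:C = `|x|.
Proof. by rewrite /rnorm RRe_real// normr_real. Qed.

Lemma rnorm_ge0 x : 0 <= rnorm x.
Proof. by rewrite -ler0c rnormE. Qed.

Lemma rnormD x y : rnorm (x + y) <= rnorm x + rnorm y.
Proof. by rewrite -lecR rmorphD/= !rnormE ler_normD. Qed.

Lemma rnormZ (a : R[i]) x : rnorm (a *: x) = complex.Re `|a| * rnorm x.
Proof.
apply: complexI; rewrite rmorphM/= (rnormE (_ *: _)) (rnormE x) normrZ.
by congr (_ * _); rewrite RRe_real// normr_real.
Qed.

Lemma rnormN x : rnorm (- x) = rnorm x.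
Proof. by rewrite /rnorm normrN. Qed.

Lemma rnorm_dist x y : `|rnorm x - rnorm y| <= rnorm (x - y).
Proof.
have lenorm a b : rnorm a <= rnorm (a - b) + rnorm b.
  by rewrite (le_trans _ (rnormD _ _))// subrK.
rewrite ler_norml lerBlDr lenorm andbT lerNl opprB lerBlDr.
by rewrite -(rnormN (x - y)) opprB lenorm.
Qed.

Lemma rnorm_eq0 x : (rnorm x == 0) = (x == 0).
Proof. by rewrite -(inj_eq (@complexI R)) rnormE normr_eq0. Qed.

Lemma cvg_rnorm (u : nat -> V) x : u @ \oo --> x ->
  (fun n => rnorm (u n)) @ \oo --> rnorm x.
Proof.
move=> ux; apply/cvgrPdist_lt => e e0.
have /cvgrPdist_lt/(_ e%:C) := ux.
rewrite ltcR => /(_ e0); apply: filterS => n.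
by rewrite -rnormE ltcR; apply: le_lt_trans; exact: rnorm_dist.
Qed.

End real_norm.

(* Bochner measurability on D: u is on D the pointwise limit of measurable
   functions with finitely many values. *)
Section bochner_measurability.
Context {R : realType} {V : normedModType R[i]}.
Implicit Types (D : set R) (s u v : R -> V).

Definition simple_fun s :=
  finite_set (range s) /\ forall y, measurable (s @^-1` [set y]).

Definition bochner_measurable D u :=
  exists2 s : nat -> R -> V, forall n, simple_fun (s n) &
    forall t, D t -> s ^~ t @ \oo --> u t.

Lemma simple_fun_comp2 (W : Type) s (F : V -> W) (B : set W) : simple_fun s ->
  measurable ((F \o s) @^-1` B).
Proof.
move=> [fs ms]; rewrite (_ : _ @^-1` _ =
  \bigcup_(y in range s `&` F @^-1` B) s @^-1` [set y]).
  by apply: fin_bigcup_measurable => //; exact: finite_setIl.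
apply/seteqP; split=> [t/= Bt|t [y [_ By] /= sy]]; last by rewrite /= sy.
by exists (s t) => //; split=> //; exists t.
Qed.

Lemma simple_funZ (a : R[i]) s : simple_fun s -> simple_fun (a *: s).
Proof.
move=> ss; split; last first.
  by move=> y; exact: (@simple_fun_comp2 _ _ ( *:%R a)).
rewrite (_ : range _ = ( *:%R a) @` range s); last by rewrite image_comp.
by apply: finite_image; case: ss.
Qed.

Lemma simple_funD s1 s2 : simple_fun s1 -> simple_fun s2 ->
  simple_fun (s1 + s2).
Proof.
move=> [f1 m1] [f2 m2]; split.
  apply: (@sub_finite_set _ _
    ((fun z => z.1 + z.2) @` (range s1 `*` range s2))).
    move=> _ [t _ <-]; exists (s1 t, s2 t) => //=.
    by split; exists t.
  by apply: finite_image; exact: finite_setX.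
move=> y; rewrite (_ : _ @^-1` _ = \bigcup_(z in range s1)
    (s1 @^-1` [set z] `&` s2 @^-1` [set y - z])).
  by apply: fin_bigcup_measurable => // z _; exact: measurableI.
apply/seteqP; split=> [t/= <-|t [z _ [/= h1 h2]]].
  exists (s1 t) => /=; first by exists t.
  by split=> //=; rewrite addrfctE [s1 t + _]addrC addrK.
by rewrite /= addrfctE h1 h2 addrC subrK.
Qed.

Lemma bochner_measurable0 D : bochner_measurable D 0.
Proof.
exists (fun=> 0) => [_|t _]; last exact: cvg_cst.
split; first by apply: (@sub_finite_set _ _ [set 0]) => // _ [t _ <-].
move=> y; have [<-|y0] := eqVneq 0 y.
  by rewrite (_ : _ @^-1` _ = setT)//; apply/seteqP; split.
rewrite (_ : _ @^-1` _ = set0)//; apply/seteqP; split=> // t /= h.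
by move: y0; rewrite -h eqxx.
Qed.

Lemma bochner_measurableD D u v : bochner_measurable D u ->
  bochner_measurable D v -> bochner_measurable D (u + v).
Proof.
move=> [s ss su] [r sr rv]; exists (fun n => s n + r n).
  by move=> n; exact: simple_funD.
by move=> t Dt; apply: cvgD; [exact: su|exact: rv].
Qed.

Lemma bochner_measurableZ D a u : bochner_measurable D u ->
  bochner_measurable D (a *: u).
Proof.
move=> [s ss su]; exists (fun n => a *: s n).
  by move=> n; exact: simple_funZ.
by move=> t Dt; apply: cvgZr; exact: su.
Qed.

Lemma measurable_rnorm D u : bochner_measurable D u ->
  measurable_fun D (fun t => rnorm (u t)).
Proof.
move=> [s ss su]; pose h n t := rnorm (s n t).
apply: (@measurable_fun_cvg _ _ _ D h) => [m|t Dt].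
  move=> mD Y mY; apply: measurableI => //.
  exact: (@simple_fun_comp2 _ (s m) rnorm).
exact/cvg_rnorm/su.
Qed.

End bochner_measurability.

#[global] Instance lebesgue_ae_filter (R : realType) :
  Filter (almost_everywhere (@lebesgue_measure R)).
Proof. exact: ae_filter_ringOfSetsType. Qed.

Section L2.
Context {R : realType} (H : hilbertSpace R) (I : interval R).
Local Notation D := [set` I].
Local Notation mu := (@lebesgue_measure R).
Implicit Types u v w : R -> H.

Definition sq_integrable : {pred R -> H} := fun u =>
  `[< bochner_measurable D u /\
      mu.-integrable D (fun t => (rnorm (u t) ^+ 2)%:E) >].

Lemma sq_integrableP u : reflect (bochner_measurable D u /\
  mu.-integrable D (fun t => (rnorm (u t) ^+ 2)%:E)) (u \in sq_integrable).
Proof. exact: asboolP. Qed.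

Lemma measurable_sq_rnorm u : bochner_measurable D u ->
  measurable_fun D (fun t => (rnorm (u t) ^+ 2)%:E).
Proof.
move=> mu_; apply/measurable_EFinP.
by apply: measurable_funX; exact: measurable_rnorm.
Qed.

Lemma sq_integrable_submod_closed : submod_closed sq_integrable.
Proof.
have mD : @measurable _ (measurableTypeR R) D by exact: measurable_itv.
split.
  apply/sq_integrableP; split; first exact: bochner_measurable0.
  rewrite (_ : (fun t => _) = cst 0%E); first exact: integrable0.
  by apply/funext => t; rewrite /rnorm normr0/= expr0n.
move=> a u v /sq_integrableP[mu_ iu] /sq_integrableP[mv iv].
have mw : bochner_measurable D (a *: u + v).
  by apply: bochner_measurableD => //; exact: bochner_measurableZ.
apply/sq_integrableP; split=> //.
pose k := complex.Re `|a|.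
have h := integrableD mD (integrableZl mD (2 * k ^+ 2) iu)
  (integrableZl mD 2 iv).
apply: (le_integrable mD) h => //; first exact: measurable_sq_rnorm.
move=> t Dt /=; rewrite lee_fin ger0_norm ?exprn_ge0 ?rnorm_ge0//.
apply: le_trans (ler_norm _).
have : rnorm ((a *: u + v) t) <= k * rnorm (u t) + rnorm (v t).
  by rewrite -rnormZ; exact: rnormD.
move=> le_w; apply: (@le_trans _ _ ((k * rnorm (u t) + rnorm (v t)) ^+ 2)).
  by apply: lerXn2r; rewrite ?nnegrE ?(le_trans _ le_w) ?rnorm_ge0.
have := sqr_ge0 (k * rnorm (u t) - rnorm (v t)).
rewrite -subr_ge0; set x := rnorm _; set y := rnorm _; nra.
Qed.

HB.instance Definition _ :=
  GRing.isSubmodClosed.Build _ _ sq_integrable sq_integrable_submod_closed.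

Record preL2 := PreL2 { preL2_fun :> R -> H; _ : preL2_fun \in sq_integrable }.

HB.instance Definition _ := [isSub for preL2_fun].
HB.instance Definition _ := [Choice of preL2 by <:].
HB.instance Definition _ := [SubChoice_isSubLmodule of preL2 by <:].

Definition null_fun : {pred preL2} :=
  fun f => `[< \forall t \ae mu, D t -> f t = 0 >].

Implicit Types (f g : preL2) (a b : R[i]).

Lemma null_funP f :
  reflect (\forall t \ae mu, D t -> f t = 0) (f \in null_fun).
Proof. exact: asboolP. Qed.

Lemma null_fun_submod_closed : submod_closed null_fun.
Proof.
split; first by apply/null_funP; exact: aeW.
move=> a f g /null_funP u0 /null_funP v0; apply/null_funP.
move: u0 v0; apply: filterS2 => t ut vt Dt.
by rewrite [LHS](_ : _ = a *: f t + g t)// ut// vt// scaler0 addr0.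
Qed.

HB.instance Definition _ :=
  GRing.isSubmodClosed.Build _ _ null_fun null_fun_submod_closed.

(* L^2(H, I): square-integrable functions modulo functions null a.e. on I.
   Elements of preL2 are functions on R whose values outside I are
   irrelevant. *)
Definition L2 : Type := Quotient.quot null_fun.

HB.instance Definition _ := GRing.Zmodule.on L2.
HB.instance Definition _ := EqQuotient.on L2.

Definition L2_fun (x : L2) : preL2 := repr x.
Definition L2_class (f : preL2) : L2 := \pi_L2%qT f.

Lemma L2_class_eq f g :
  L2_class f = L2_class g <-> \forall t \ae mu, D t -> f t = g t.
Proof.
split=> [/eqP|uv].
  rewrite -Quotient.idealrBE => /null_funP; apply: filterS => t + Dt.
  by move=> /(_ Dt) /eqP; rewrite subr_eq0 => /eqP.
apply/eqP; rewrite -Quotient.idealrBE; apply/null_funP.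
apply: filterS uv => t uv Dt.
by rewrite [LHS](_ : _ = f t - g t)// uv// subrr.
Qed.

Lemma L2_funK x : L2_class (L2_fun x) = x.
Proof. exact: reprK. Qed.

Lemma L2_classK f : \forall t \ae mu, D t -> L2_fun (L2_class f) t = f t.
Proof. by apply/L2_class_eq; rewrite L2_funK. Qed.

Lemma L2_classD f g : L2_class (f + g) = L2_class f + L2_class g.
Proof. by rewrite /L2_class !piE. Qed.

Definition L2_scale (a : R[i]) (x : L2) : L2 := L2_class (a *: L2_fun x).

Lemma L2_classZ a f : L2_class (a *: f) = L2_scale a (L2_class f).
Proof.
apply/L2_class_eq; have := L2_classK f; apply: filterS => t h Dt.
by rewrite [LHS](_ : _ = a *: f t)// -h.
Qed.

Fact L2_scaleA a b x : L2_scale a (L2_scale b x) = L2_scale (a * b) x.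
Proof. by rewrite -(L2_funK x) -!L2_classZ scalerA. Qed.

Fact L2_scale1 : left_id 1 L2_scale.
Proof. by move=> x; rewrite -(L2_funK x) -L2_classZ scale1r. Qed.

Fact L2_scaleDr : right_distributive L2_scale +%R.
Proof.
move=> a x y; rewrite -(L2_funK x) -(L2_funK y) -L2_classD -!L2_classZ.
by rewrite scalerDr L2_classD.
Qed.

Fact L2_scaleDl x : {morph L2_scale^~ x : a b / a + b}.
Proof.
by move=> a b; rewrite -(L2_funK x) -!L2_classZ scalerDl L2_classD.
Qed.

HB.instance Definition _ := GRing.Zmodule_isLmodule.Build R[i] L2
  L2_scaleA L2_scale1 L2_scaleDr L2_scaleDl.

Lemma L2_funP a x y : \forall t \ae mu, D t ->
  L2_fun (a *: x + y) t = a *: L2_fun x t + L2_fun y t.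
Proof.
have -> : a *: x + y = L2_class (a *: L2_fun x + L2_fun y).
  by rewrite L2_classD L2_classZ !L2_funK.
exact: L2_classK.
Qed.

End L2.

Section cintegral.
Context {R : realType}.
Local Notation mu := (@lebesgue_measure R).
Implicit Types (D : set R) (F G : R -> R[i]).

Definition cintegral D F : R[i] :=
  (\int[mu]_(t in D) complex.Re (F t)) +i* (\int[mu]_(t in D) complex.Im (F t)).

Definition cintegrable D F :=
  mu.-integrable D (EFin \o (fun t => complex.Re (F t))) /\
  mu.-integrable D (EFin \o (fun t => complex.Im (F t))).

Lemma ReM (a b : R[i]) : complex.Re (a * b) =
  complex.Re a * complex.Re b - complex.Im a * complex.Im b.
Proof. by case: a b => [? ?] [? ?]. Qed.

Lemma ImM (a b : R[i]) : complex.Im (a * b) =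
  complex.Re a * complex.Im b + complex.Im a * complex.Re b.
Proof. by case: a b => [? ?] [? ?]. Qed.

Lemma ReD (a b : R[i]) : complex.Re (a + b) = complex.Re a + complex.Re b.
Proof. by case: a b => [? ?] [? ?]. Qed.

Lemma ImD (a b : R[i]) : complex.Im (a + b) = complex.Im a + complex.Im b.
Proof. by case: a b => [? ?] [? ?]. Qed.

Lemma eq_cintegral D F G : @measurable _ (measurableTypeR R) D ->
  cintegrable D F -> cintegrable D G ->
  (\forall t \ae mu, D t -> F t = G t) -> cintegral D F = cintegral D G.
Proof.
move=> mD [rF iF] [rG iG] FG; rewrite /cintegral /Rintegral.
congr (fine _ +i* fine _); apply: ae_eq_integral => //;
  try by [exact: measurable_int rF | exact: measurable_int rG |
          exact: measurable_int iF | exact: measurable_int iG].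
- by apply: filterS FG => t FG Dt /=; rewrite FG.
- by apply: filterS FG => t FG Dt /=; rewrite FG.
Qed.

Lemma integrable_lin D (a b : R) (f g : R -> R) :
  @measurable _ (measurableTypeR R) D -> mu.-integrable D (EFin \o f) ->
  mu.-integrable D (EFin \o g) ->
  mu.-integrable D (EFin \o (fun t => a * f t + b * g t)).
Proof.
by move=> mD fi gi; exact: (integrableD mD (integrableZl mD a fi)
  (integrableZl mD b gi)).
Qed.

Lemma Rintegral_lin D (a b : R) (f g : R -> R) :
  @measurable _ (measurableTypeR R) D -> mu.-integrable D (EFin \o f) ->
  mu.-integrable D (EFin \o g) ->
  \int[mu]_(t in D) (a * f t + b * g t) =
  a * \int[mu]_(t in D) f t + b * \int[mu]_(t in D) g t.
Proof.
move=> mD fi gi.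
have fi' : mu.-integrable D (EFin \o (fun t => a * f t)).
  exact: (integrableZl mD a fi).
have gi' : mu.-integrable D (EFin \o (fun t => b * g t)).
  exact: (integrableZl mD b gi).
by rewrite (RintegralD mD fi' gi') !(RintegralZl _ mD).
Qed.

Lemma cintegralP D F G a : @measurable _ (measurableTypeR R) D ->
  cintegrable D F -> cintegrable D G ->
  cintegral D (fun t => a * F t + G t) = a * cintegral D F + cintegral D G.
Proof.
move=> mD [rF iF] [rG iG]; case: a => a b; rewrite /cintegral.
apply/eqP; rewrite eq_complex !(ReD, ImD, ReM, ImM)/=; apply/andP; split.
- rewrite -[X in _ + X]mul1r -mulNr -(Rintegral_lin _ _ mD rF iF).
  rewrite -[X in X + _]mul1r -Rintegral_lin//; last exact: integrable_lin.
  by apply/eqP/eq_Rintegral => t _; rewrite ReD ReM/= !mul1r mulNr.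
- rewrite -[X in _ + X]mul1r -(Rintegral_lin _ _ mD iF rF).
  rewrite -[X in X + _]mul1r -Rintegral_lin//; last exact: integrable_lin.
  by apply/eqP/eq_Rintegral => t _; rewrite ImD ImM/= !mul1r.
Qed.

Lemma cintegral_conj D F : @measurable _ (measurableTypeR R) D ->
  cintegrable D F ->
  cintegral D (fun t => conjc (F t)) = conjc (cintegral D F).
Proof.
move=> mD [rF iF]; rewrite /cintegral/=; congr (_ +i* _).
  by apply: eq_Rintegral => t _; case: (F t).
rewrite -mulN1r -(RintegralZl _ mD)//.
by apply: eq_Rintegral => t _; rewrite mulN1r; case: (F t).
Qed.

End cintegral.

Section L2_dot.
Context {R : realType} (H : hilbertSpace R) (I : interval R).
Local Notation D := [set` I].
Local Notation mu := (@lebesgue_measure R).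

Let mD : @measurable _ (measurableTypeR R) D.
Proof. exact: measurable_itv. Qed.

Definition L2_dot (x y : L2 H I) : R[i] :=
  cintegral D (fun t => hdot H (L2_fun x t) (L2_fun y t)).

Lemma hdotC (x y : H) : hdot H x y = conjc (hdot H y x).
Proof. by rewrite (hermC (hdot H))/= expr0 mul1r. Qed.

Lemma hdotDl (x y z : H) : hdot H (x + y) z = hdot H x z + hdot H y z.
Proof. exact: linearDl. Qed.

Lemma hdotZl a (x y : H) : hdot H (a *: x) y = a * hdot H x y.
Proof. exact: linearZl_LR. Qed.

Lemma hdotDr (x y z : H) : hdot H z (x + y) = hdot H z x + hdot H z y.
Proof. exact: linearDr. Qed.

Lemma hdotZr a (x y : H) : hdot H x (a *: y) = conjc a * hdot H x y.
Proof. exact: linearZr_LR. Qed.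

Lemma hdot_rnorm (x : H) : complex.Re (hdot H x x) = rnorm x ^+ 2.
Proof. by rewrite hdotE -rnormE -rmorphXn. Qed.

Lemma Re_polarization (x y : H) : complex.Re (hdot H x y) =
  4^-1 * rnorm (x + y) ^+ 2 + (- 4^-1) * rnorm (x + (-1) *: y) ^+ 2.
Proof.
rewrite -!hdot_rnorm !(hdotDl, hdotDr, hdotZl, hdotZr).
rewrite (hdotC y x); case: (hdot H x y) => a b.
case: (hdot H x x) => c d; case: (hdot H y y) => e f.
rewrite !(ReD, ReM, ImM, ImD)/=; lra.
Qed.

Lemma Im_polarization (x y : H) :
  complex.Im (hdot H x y) = complex.Re (hdot H x ('i *: y)).
Proof.
rewrite hdotZr; case: (hdot H x y) => a b /=.
by rewrite mul0r sub0r mulN1r opprK.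
Qed.

Lemma cintegrable_hdot (f g : preL2 H I) :
  cintegrable D (fun t => hdot H (f t) (g t)).
Proof.
have main (h : preL2 H I) :
    mu.-integrable D (EFin \o (fun t => complex.Re (hdot H (f t) (h t)))).
  have /sq_integrableP[_ i1] := valP (f + h).
  have /sq_integrableP[_ i2] := valP (f + (-1) *: h).
  have := integrable_lin 4^-1 (- 4^-1) mD i1 i2.
  by apply: eq_integrable => // t _ /=; rewrite Re_polarization.
split; first exact: main.
have := main ('i *: g); apply: eq_integrable => // t _ /=.
by rewrite Im_polarization.
Qed.

Lemma L2_dot_class (f g : preL2 H I) : L2_dot (L2_class f) (L2_class g) =
  cintegral D (fun t => hdot H (f t) (g t)).
Proof.
apply: eq_cintegral => //; [exact: cintegrable_hdot..|].
have := L2_classK f; have := L2_classK g; apply: filterS2 => t gE fE Dt.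
by rewrite gE// fE.
Qed.

Lemma L2_dotC x y : L2_dot x y = conjc (L2_dot y x).
Proof.
rewrite -cintegral_conj//; last exact: cintegrable_hdot.
by congr cintegral; apply/funext => t; rewrite hdotC.
Qed.

Lemma L2_dotPl a x y z : L2_dot (a *: x + y) z = a * L2_dot x z + L2_dot y z.
Proof.
rewrite -cintegralP//; [|exact: cintegrable_hdot..].
pose f := a *: L2_fun x + L2_fun y.
have -> : (fun t => a * hdot H (L2_fun x t) (L2_fun z t) +
    hdot H (L2_fun y t) (L2_fun z t)) = (fun t => hdot H (f t) (L2_fun z t)).
  by apply/funext => t; rewrite -hdotZl -hdotDl.
apply: eq_cintegral => //; [exact: cintegrable_hdot..|].
by have := L2_funP a x y; apply: filterS => t xyE Dt; rewrite xyE.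
Qed.

Lemma L2_dotE x :
  L2_dot x x = (\int[mu]_(t in D) (rnorm (L2_fun x t) ^+ 2))%:C.
Proof.
congr (_ +i* _); first by apply: eq_Rintegral => t _; rewrite hdot_rnorm.
under eq_Rintegral do rewrite hdotE -rnormE -rmorphXn/=.
by rewrite /Rintegral integral0.
Qed.

Lemma L2_dot_gt0 x : x != 0 -> 0 < L2_dot x x.
Proof.
move=> x0; rewrite L2_dotE ltcR lt_neqAle Rintegral_ge0 ?andbT; last first.
  by move=> t _; exact: sqr_ge0.
apply: contra x0 => /eqP x0; apply/eqP; rewrite -[x]L2_funK.
have -> : 0 = L2_class (0 : preL2 H I) by rewrite /L2_class piE.
apply/L2_class_eq.
have /sq_integrableP[_ ix] := valP (L2_fun x).
have : (\int[mu]_(t in D) `|(rnorm (L2_fun x t) ^+ 2)%:E| = 0)%E.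
  under eq_integral do rewrite gee0_abs ?lee_fin ?sqr_ge0//.
  rewrite -[LHS]fineK; last exact: integrable_fin_num.
  by congr (_%:E); exact: esym.
move=> /(ae_eq_integral_abs mu mD (measurable_int mu ix)).
apply: filterS => t xt0 Dt; move: (xt0 Dt) => [] /eqP.
by rewrite sqrf_eq0 rnorm_eq0 => /eqP.
Qed.

Fact L2_dot_bilinear : bilinear_for
  (GRing.Scale.Law.clone _ _ ( *%R ) _)
  (GRing.Scale.Law.clone _ _ (Num.conj \; *%R ) _) L2_dot.
Proof.
split=> [z|z] a x y /=; first exact: L2_dotPl.
rewrite L2_dotC L2_dotPl (L2_dotC z x) (L2_dotC z y).
by rewrite [LHS]rmorphD rmorphM.
Qed.

HB.instance Definition _ := bilinear_isBilinear.Build R[i] _ _ _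
  (GRing.Scale.Law.clone _ _ ( *%R ) _)
  (GRing.Scale.Law.clone _ _ (Num.conj \; *%R ) _) L2_dot L2_dot_bilinear.

Fact L2_dot_hermitian x y : L2_dot x y = (-1) ^+ false * Num.conj (L2_dot y x).
Proof. by rewrite expr0 mul1r; exact: L2_dotC. Qed.

HB.instance Definition _ := @isHermitianSesquilinear.Build R[i] _ _ _ _
  L2_dot_hermitian.

HB.instance Definition _ := @isDotProduct.Build R[i] _ _ L2_dot_gt0.

End L2_dot.

Section direct_sum.
Context {R : realType} {E F : lmodType R[i]}.
Variable dE : {dot E for (@Num.conj R[i])}.
Variable dF : {dot F for (@Num.conj R[i])}.

Definition prod_dot (x y : E * F) : R[i] := dE x.1 y.1 + dF x.2 y.2.

Fact prod_dot_bilinear : bilinear_for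
  (GRing.Scale.Law.clone _ _ ( *%R ) _)
  (GRing.Scale.Law.clone _ _ (Num.conj \; *%R ) _) prod_dot.
Proof.
split=> [z|z] a x y; rewrite /prod_dot /=.
  by rewrite !linearPl/= mulrDr addrACA.
by rewrite !linearPr/= mulrDr addrACA.
Qed.

HB.instance Definition _ := bilinear_isBilinear.Build R[i] _ _ _
  (GRing.Scale.Law.clone _ _ ( *%R ) _)
  (GRing.Scale.Law.clone _ _ (Num.conj \; *%R ) _) prod_dot prod_dot_bilinear.

Fact prod_dot_hermitian x y :
  prod_dot x y = (-1) ^+ false * Num.conj (prod_dot y x).
Proof.
rewrite /prod_dot (hermC dE) (hermC dF) /= expr0 !mul1r.
by rewrite [RHS]rmorphD.
Qed.

HB.instance Definition _ := @isHermitianSesquilinear.Build R[i] _ _ _ _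
  prod_dot_hermitian.

Fact prod_dot_gt0 x : x != 0 -> 0 < prod_dot x x.
Proof.
case: x => x y; rewrite /prod_dot/= => xy0.
have [x0|x0] := eqVneq x 0.
  rewrite x0 linear0l add0r neq0_dnorm_gt0//.
  by apply: contra_neq xy0 => ->; rewrite x0.
by rewrite ltr_wpDr ?dnorm_ge0// neq0_dnorm_gt0.
Qed.

HB.instance Definition _ := @isDotProduct.Build R[i] _ _ prod_dot_gt0.

End direct_sum.

(* A partially defined operator; app is meaningful on dom only. *)
Record operator (C : pzRingType) (E : lmodType C) :=
  Operator { dom : set E; app :> E -> E }.

Section operators.
Context {R : realType}.

Definition linear_operator (E : lmodType R[i]) (T : operator E) :=
  dom T 0 /\ forall a u v, dom T u -> dom T v ->
    dom T (a *: u + v) /\ T (a *: u + v) = a *: T u + T v.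

Definition direct_sum (E F : lmodType R[i]) (S : operator E) (T : operator F) :
    operator (E * F)%type :=
  Operator [set u | dom S u.1 /\ dom T u.2] (fun u => (S u.1, T u.2)).

Definition restriction (E : lmodType R[i]) (T : operator E) (P : set E) :=
  Operator (dom T `&` P) T.

Section spectrum.
Context {E : lmodType R[i]} (d : {dot E for (@Num.conj R[i])}).
Variable T : operator E.

Definition dot_norm (u : E) : R := Num.sqrt (complex.Re (d u u)).

(* l is in the resolvent set when T - l is a bijection from dom T onto the whole
   space with bounded inverse. *)
Definition resolvent_set : set R[i] := [set l |
  set_bij (dom T) setT (fun u => T u - l *: u) /\
  exists c : R, forall u, dom T u ->
    dot_norm u <= c * dot_norm (T u - l *: u)].

Definition spectrum : set R[i] := ~` resolvent_set.

End spectrum.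

(* A is densely defined and equal to its adjoint, domains included. *)
Definition selfadjoint (H : hilbertSpace R) (A : operator H) :=
  dense (dom A) /\ forall v w,
    (forall u, dom A u -> hdot H (A u) v = hdot H u w) <-> dom A v /\ A v = w.

Record selfadjoint_operator (H : hilbertSpace R) := SelfadjointOperator {
  sa_op :> operator H;
  sa_linear : linear_operator sa_op;
  sa_selfadjoint : selfadjoint sa_op
}.

Definition unitary (H : hilbertSpace R) (W : {linear H -> H}) :=
  (forall x y, hdot H (W x) (W y) = hdot H x y) /\
  (forall y, exists x, W x = y).

Definition separable (T : topologicalType) :=
  exists2 S : set T, countable S & dense S.

End operators.

Section rigging.
Context {R : realType} {H : hilbertSpace R} (A : selfadjoint_operator H).
Implicit Types f g : H.

Lemma hdot_CauchySchwarz f g : `|hdot H f g| <= `|f| * `|g|.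
Proof.
have [->|g0] := eqVneq g 0; first by rewrite linear0r !normr0 mulr0.
set p := hdot H f g; pose q := hdot H g g.
have q0 : 0 < q by exact: neq0_dnorm_gt0.
have qJ : conjc q = q by rewrite /q -hdotC.
suff : `|p| ^+ 2 / q <= hdot H f f.
  rewrite ler_pdivrMr// /q !hdotE -exprMn.
  by rewrite ler_sqr// nnegrE ?mulr_ge0.
have := dnorm_ge0 (hdot H) (f + (- (p / q)) *: g).
rewrite !(hdotDl, hdotDr, hdotZl, hdotZr) (hdotC g f) -/p -/q.
rewrite rmorphN/= rmorphM/= fmorphV/= qJ.
rewrite (_ : _ + _ = hdot H f f - `|p| ^+ 2 / q) ?subr_ge0// sqr_normc.
by field; rewrite gt_eqF.
Qed.

(* plus_dot is the inner product of H_+ = D(A). The completion H_- of H in the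
   norm |f|_- = neg_norm (hdot H f) is realized as the closure of
   { (f, .)_H | f in H } among the functionals on H_+ (only their values on
   dom A matter): l : neg_space pairs with g in H_+ by l g, which extends
   (f, g)_H by continuity. *)
Definition plus_dot f g : R[i] := hdot H (A f) (A g) + hdot H f g.
Definition plus_norm g : R := Num.sqrt (complex.Re (plus_dot g g)).

Definition neg_norm (l : H -> R[i]) : \bar R := ereal_sup
  [set (complex.Re `|l g| / plus_norm g)%:E | g in dom A `\ 0].

Record neg_space := NegSpace {
  pairing :> H -> R[i];
  pairing_closure : forall e : R, 0 < e ->
    exists f, (neg_norm (fun g => pairing g - hdot H f g)%R < e%:E)%E
}.

Fact embed_subproof f e : 0 < e ->
  exists f', (neg_norm (fun g => hdot H f g - hdot H f' g)%R < e%:E)%E.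
Proof.
move=> e0; exists f; apply: (@le_lt_trans _ _ 0%E); last by rewrite lte_fin.
by apply: ge_ereal_sup => _ [g _ <-]; rewrite subrr normr0 mul0r.
Qed.

Definition embed f : neg_space := NegSpace (embed_subproof f).

Lemma hdotAC f g : dom A f -> dom A g -> hdot H f (A g) = hdot H (A f) g.
Proof.
move=> Af Ag; have [_ /(_ g (A g))[_ /(_ (conj Ag erefl))/(_ f Af)->]] :=
  sa_selfadjoint A.
by [].
Qed.

Lemma plus_norm_ge f : complex.Re `|A f| <= plus_norm f.
Proof.
rewrite [leLHS](_ : _ = Num.sqrt (rnorm (A f) ^+ 2)).
  by rewrite ler_wsqrtr// /plus_dot ReD !hdot_rnorm lerDl sqr_ge0.
by rewrite sqrtr_sqr ger0_norm ?rnorm_ge0.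
Qed.

Fact tilde_subproof f e : 0 < e ->
  exists f', (neg_norm (fun g => hdot H f (A g) - hdot H f' g)%R < e%:E)%E.
Proof.
move=> e0; have [dA _] := sa_selfadjoint A.
have e2 : 0 < (e / 2)%:C by rewrite ltcR divr_gt0.
have [|f' [ff' Af']] := dA (ball f (e / 2)%:C) _ (ball_open f _).
  by exists f; exact: ballxx.
exists (A f'); apply: (@le_lt_trans _ _ (e / 2)%:E); last first.
  by rewrite lte_fin ltr_pdivrMr// ltr_pMr// ltr1n.
apply: ge_ereal_sup => _ [g [Ag /eqP g0] <-]; rewrite lee_fin.
have pg0 : 0 < plus_norm g.
  by rewrite sqrtr_gt0 ReD !hdot_rnorm ltr_wpDl ?sqr_ge0// exprn_gt0// lt0r
    rnorm_eq0 g0 rnorm_ge0.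
rewrite ler_pdivrMr// -hdotAC// -lecR RRe_real ?normr_real//.
have -> : hdot H f (A g) - hdot H f' (A g) = hdot H (f - f') (A g).
  by rewrite -scaleN1r hdotDl hdotZl mulN1r.
rewrite (le_trans (hdot_CauchySchwarz _ _))// rmorphM/=.
apply: ler_pM => //; first by move: ff'; rewrite -ball_normE/= => /ltW.
by rewrite -[leLHS]rnormE lecR plus_norm_ge.
Qed.

(* The extension of A to an operator H -> H_-, defined as the adjoint of the
   bounded operator A : H_+ -> H, i.e. <tilde f, g> = (f, A g)_H. *)
Definition tilde f : neg_space := NegSpace (tilde_subproof f).

Lemma tildeE f g : dom A f -> dom A g -> tilde f g = embed (A f) g.
Proof. by move=> Af Ag /=; exact: hdotAC. Qed.

End rigging.

Section maximal_operator.
Context {R : realType} {H : hilbertSpace R} (A : selfadjoint_operator H).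
Variable I : interval R.
Local Notation D := [set` I].
Local Notation mu := (@lebesgue_measure R).

Definition test_function (phi : R -> R) :=
  (forall n t, derivable (derive1n n phi) t 1) /\
  exists K, [/\ compact K, K `<=` D & forall t, ~ K t -> phi t = 0].

(* H_- -valued distributions on I are given by the functionals on H_+ that they
   assign to the (real-valued) test functions; embedding and pairing are linear
   in the H_- argument, so scalars act by multiplication. *)
Definition distribution := (R -> R) -> H -> R[i].

Definition regular (v : R -> neg_space A) : distribution :=
  fun phi g => cintegral D (fun t => (phi t)%:C * v t g).

Definition dist_derive (T : distribution) : distribution :=
  fun phi g => - T (derive1 phi) g.

(* i u' + tilde A u = f in the sense of H_- -valued distributions on I. *)
Definition maximal_graph (u f : L2 H I) :=
  forall phi g, test_function phi -> dom A g ->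
  'i * dist_derive (regular (fun t => embed A (L2_fun u t))) phi g +
    regular (fun t => tilde A (L2_fun u t)) phi g =
  regular (fun t => embed A (L2_fun f t)) phi g.

Definition maximal_operator : operator (L2 H I) :=
  Operator [set u | exists f, maximal_graph u f]
           (fun u => xget 0 [set f | maximal_graph u f]).

(* The representative of u continuous up to the finite endpoints of I takes the
   value h at a. *)
Definition boundary_value (u : L2 H I) (a : R) (h : H) :=
  exists v : R -> H, [/\ \forall t \ae mu, D t -> v t = L2_fun u t,
    {within closure D, continuous v} & v a = h].

End maximal_operator.

Section coupled.
Context {R : realType} {H : hilbertSpace R}.
Variables (a1 a2 b2 a3 : R) (A1 A2 A3 : selfadjoint_operator H).
Variables W1 W2 : H -> H.

Definition L2sum : lmodType R[i] :=
  (L2 H `]-oo, a1[ * L2 H `]a2, b2[ * L2 H `]a3, +oo[)%type.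

Definition L2sum_dot : {dot L2sum for (@Num.conj R[i])} :=
  prod_dot (prod_dot (@L2_dot R H `]-oo, a1[) (@L2_dot R H `]a2, b2[))
           (@L2_dot R H `]a3, +oo[).

Definition L_max : operator L2sum :=
  direct_sum (direct_sum (maximal_operator A1 `]-oo, a1[)
                         (maximal_operator A2 `]a2, b2[))
             (maximal_operator A3 `]a3, +oo[).

Definition L_W1W2 : operator L2sum := restriction L_max
  [set u : L2sum | let: (u1, u2, u3) := u in
    (exists2 h, boundary_value u1 a1 h & boundary_value u3 a3 (W1 h)) /\
    (exists2 h, boundary_value u2 a2 h & boundary_value u2 b2 (W2 h))].

End coupled.

(* Main.v *)
From Pilot Require Import Defs.
From HB Require Import structures.
From mathcomp Require Import all_boot all_order all_algebra complex.
From mathcomp Require Import all_classical all_reals all_analysis.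
From mathcomp Require Import measurable_realfun ring lra.

Set Implicit Arguments.
Unset Strict Implicit.
Unset Printing Implicit Defensive.

Import Order.TTheory GRing.Theory Num.Theory.
Import numFieldNormedType.Exports.
Import Pilot.Defs.

Local Open Scope classical_set_scope.
Local Open Scope ring_scope.
Local Open Scope complex_scope.

(* Write lambda = x + i k, B_j = A_j - x and U_j(t) = e^{i t B_j}. On I_j the
   equation (L_j - lambda) u = f reads u' = (k + i B_j) u - i f, whose solutions
   with f = 0 are e^{k (t - a)} U_j(t - a) c, of norm e^{k (t - a)} |c|.

   For k <> 0 the Duhamel integral, taken over the part of I_j lying in the
   direction in which the exponential decays, is a bounded solution operator of
   L^2. The boundary conditions are met by adding homogeneous solutions: on one
   half-line the one with the boundary value prescribed by the other half-line,
   which decays there, and on I_2 one whose boundary value is the fixed point of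
   a contraction of ratio e^{- |k| (b_2 - a_2)}. Homogeneous solutions satisfying
   the boundary conditions vanish, because they grow on one of the half-lines,
   and because on I_2 their norms at a_2 and b_2 differ by e^{k (b_2 - a_2)} while
   W_2 is an isometry. So lambda is in the resolvent set.

   For k = 0 and small d > 0, e^{d (t - a_1)} U_1(t - a_1) h on I_1, 0 on I_2 and
   e^{- d (t - a_3)} U_3(t - a_3) W_1 h on I_3 make up some u <> 0 in the domain
   with |(L - lambda) u| = d |u|, so that lambda is in the spectrum. *)

(** * Hilbert space preliminaries *)

(** The extended operator [tilde A] is known only through its pairings with vectors of D(A). A
    solution u therefore need not take values in D(A) and need not be differentiable in H. All
    calculus is done on scalar functions t -> <u(t), G> with G in D(A), where the generator acts on
    G, and density of D(A) recovers u afterwards. The group e^{itA} is built from the contractions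
    (1 - i s A)^{-1}, whose existence for all real s is where selfadjointness does its main work.
    The Duhamel integral is likewise defined by its inner products, and its bounds come from pairing
    it with itself. A second obstacle is that [maximal_operator] picks the value L u by choice among
    all f satisfying the weak equation. The choice has to be shown unique in L^2: the equation
    determines <f(t), G> for almost every t, with a null set depending on G, and separability of H
    reduces this to countably many G. The Duhamel kernel has L^1 norm 1/|k| in each variable, which
    is the origin of all the powers of 1/|k| in the resolvent bounds. *)

Section complex_modulus.
Context {R : realType}.
Implicit Types z w : R[i].

Definition cabs z : R := complex.Re `|z|.

Lemma cabsE z : (cabs z)%:C = `|z|.
Proof. by rewrite /cabs RRe_real// normr_real. Qed.

Lemma cabs_ge0 z : 0 <= cabs z.
Proof. by rewrite -ler0c cabsE. Qed.

Lemma sqr_cabs z : cabs z ^+ 2 = complex.Re z ^+ 2 + complex.Im z ^+ 2.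
Proof.
case: z => a b; rewrite /cabs normc_def/= sqr_sqrtr//.
by rewrite addr_ge0 ?sqr_ge0.
Qed.

Lemma cabsM z w : cabs (z * w) = cabs z * cabs w.
Proof. by apply: complexI; rewrite rmorphM/= !cabsE normrM. Qed.

Lemma cabsD z w : cabs (z + w) <= cabs z + cabs w.
Proof. by rewrite -lecR rmorphD/= !cabsE ler_normD. Qed.

Lemma cabsC (x : R) : cabs x%:C = `|x|.
Proof. by rewrite /cabs normc_def/= expr0n addr0 sqrtr_sqr. Qed.

Lemma cabsN z : cabs (- z) = cabs z.
Proof. by rewrite /cabs normrN. Qed.

Lemma cabs_conj z : cabs (conjc z) = cabs z.
Proof.
by apply/eqP; rewrite -(@eqrXn2 _ 2) ?cabs_ge0// !sqr_cabs; case: z => a b /=;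
  rewrite sqrrN.
Qed.

Lemma cabs_eq0 z : (cabs z == 0) = (z == 0).
Proof. by rewrite -(inj_eq (@complexI R)) cabsE normr_eq0. Qed.

Lemma cabsi : cabs ('i : R[i]) = 1.
Proof. by rewrite /cabs normc_def/= expr0n expr1n add0r sqrtr1. Qed.

Lemma ler_Re_cabs z : `|complex.Re z| <= cabs z.
Proof.
rewrite -(@ler_pXn2r _ 2) ?nnegrE ?cabs_ge0// sqr_cabs real_normK ?num_real//.
by rewrite lerDl sqr_ge0.
Qed.

Lemma complex_eq z w : complex.Re z = complex.Re w ->
  complex.Im z = complex.Im w -> z = w.
Proof. by case: z w => [? ?] [? ?] /= -> ->. Qed.

Lemma ReZ (x : R) z : complex.Re (x%:C * z) = x * complex.Re z.
Proof. by rewrite ReM/= mul0r subr0. Qed.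

Lemma ImZ (x : R) z : complex.Im (x%:C * z) = x * complex.Im z.
Proof. by rewrite ImM/= mul0r addr0. Qed.

Lemma ReN z : complex.Re (- z) = - complex.Re z.
Proof. by case: z. Qed.

Lemma ImN z : complex.Im (- z) = - complex.Im z.
Proof. by case: z. Qed.

Lemma ReJ z : complex.Re (conjc z) = complex.Re z.
Proof. by case: z. Qed.

Lemma conjcM z w : conjc (z * w) = conjc z * conjc w.
Proof. by case: z w => [? ?] [? ?]; apply: complex_eq => /=; ring. Qed.

Lemma conjcR (x : R) : conjc x%:C = x%:C.
Proof. by rewrite /= oppr0. Qed.

Lemma conjcMz z : conjc z * z = (cabs z ^+ 2)%:C.
Proof. by rewrite sqr_cabs; case: z => ? ?; apply: complex_eq => /=; ring. Qed.

Lemma conjcN z : conjc (- z) = - conjc z.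
Proof. by case: z. Qed.

Lemma Rei z : complex.Re ('i * z) = - complex.Im z.
Proof. by rewrite ReM/= mul0r mul1r sub0r. Qed.

Lemma Imi z : complex.Im ('i * z) = complex.Re z.
Proof. by rewrite ImM/= mul0r mul1r add0r. Qed.

End complex_modulus.

(** * Orthogonal projection and the Riesz representation theorem *)

Section hilbert.
Context {R : realType} {H : hilbertSpace R}.
Implicit Types x y z : H.

Lemma rnorm0 : rnorm (0 : H) = 0.
Proof. by apply/eqP; rewrite rnorm_eq0. Qed.

Lemma rnormZc (a : R[i]) x : rnorm (a *: x) = cabs a * rnorm x.
Proof. exact: rnormZ. Qed.

Lemma rnormB x y : rnorm (x - y) <= rnorm x + rnorm y.
Proof. by rewrite -(rnormN y); exact: rnormD. Qed.

Lemma rnorm_distC x y : rnorm (x - y) = rnorm (y - x).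
Proof. by rewrite -rnormN opprB. Qed.

Lemma rnorm_triangle z x y : rnorm (x - y) <= rnorm (x - z) + rnorm (z - y).
Proof. by apply: le_trans (rnormD _ _); rewrite addrA subrK. Qed.

Lemma hdotNl x y : hdot H (- x) y = - hdot H x y.
Proof. by rewrite -scaleN1r hdotZl mulN1r. Qed.

Lemma hdotNr x y : hdot H x (- y) = - hdot H x y.
Proof. by rewrite hdotC hdotNl [hdot H x y]hdotC rmorphN. Qed.

Lemma hdotBl x y z : hdot H (x - y) z = hdot H x z - hdot H y z.
Proof. by rewrite hdotDl hdotNl. Qed.

Lemma hdotBr x y z : hdot H z (x - y) = hdot H z x - hdot H z y.
Proof. by rewrite hdotDr hdotNr. Qed.

Lemma hdot0l x : hdot H 0 x = 0.
Proof. by rewrite -(scale0r 0) hdotZl mul0r. Qed.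

Lemma hdot_le x y : cabs (hdot H x y) <= rnorm x * rnorm y.
Proof.
by rewrite -lecR rmorphM/= cabsE !rnormE; exact: hdot_CauchySchwarz.
Qed.

Lemma hdotxx x : hdot H x x = (rnorm x ^+ 2)%:C.
Proof. by rewrite hdotE -rnormE -rmorphXn. Qed.

Lemma sqr_rnormD x y : rnorm (x + y) ^+ 2 =
  rnorm x ^+ 2 + rnorm y ^+ 2 + 2 * complex.Re (hdot H x y).
Proof.
rewrite -!hdot_rnorm !(hdotDl, hdotDr) (hdotC y x) !ReD ReJ; ring.
Qed.

Lemma sqr_rnormB x y : rnorm (x - y) ^+ 2 =
  rnorm x ^+ 2 + rnorm y ^+ 2 - 2 * complex.Re (hdot H x y).
Proof. rewrite sqr_rnormD rnormN hdotNr ReN; ring. Qed.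

Lemma parallelogram x y : rnorm (x + y) ^+ 2 + rnorm (x - y) ^+ 2 =
  2 * rnorm x ^+ 2 + 2 * rnorm y ^+ 2.
Proof. rewrite sqr_rnormD sqr_rnormB; ring. Qed.

Lemma hdot_inj x y : (forall z, hdot H x z = hdot H y z) -> x = y.
Proof.
move=> xy; apply/eqP; rewrite -subr_eq0 -rnorm_eq0 -sqrf_eq0.
by apply/eqP/complexI; rewrite -hdotxx hdotBl xy subrr.
Qed.

(** Norms of H take values in [R[i]]; this form with the real norm [rnorm] lets limit arguments be
    closed by real arithmetic. *)
Definition tends (u : nat -> H) (l : H) :=
  forall e : R, 0 < e -> exists N, forall n, (N <= n)%N -> rnorm (u n - l) < e.

Lemma cvg_tends (u : nat -> H) l : u @ \oo --> l -> tends u l.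
Proof.
move=> /cvgrPdist_lt ul e e0; have /ul : 0 < e%:C by rewrite ltcR.
case=> N _ Nu; exists N => n /Nu /=.
by rewrite rnorm_distC -ltcR rnormE.
Qed.

Lemma tends_cvg (u : nat -> H) l : tends u l -> u @ \oo --> l.
Proof.
move=> ul; apply/cvgrPdist_lt => e e0.
have eE : e = (complex.Re e)%:C by rewrite RRe_real// realE ltW.
have /ul[N Nu] : 0 < complex.Re e by rewrite -ltcR -eE.
by exists N => // n /= /Nu; rewrite rnorm_distC -ltcR rnormE -eE.
Qed.

Lemma tends_unique (u : nat -> H) l l' : tends u l -> tends u l' -> l = l'.
Proof.
move=> ul ul'; apply/eqP; rewrite -subr_eq0 -rnorm_eq0 eq_le rnorm_ge0 andbT.
apply/ler_addgt0Pr => e e0; rewrite add0r.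
have /ul[N Nu] : 0 < e / 2 by rewrite divr_gt0.
have /ul'[M Mu] : 0 < e / 2 by rewrite divr_gt0.
have := Nu (N + M)%N (leq_addr _ _); have := Mu (N + M)%N (leq_addl _ _).
have := rnorm_triangle (u (N + M)%N) l l'; rewrite (rnorm_distC l (u _)); lra.
Qed.

Lemma tends_le (u : nat -> H) l x (c : R) : tends u l ->
  (forall n, rnorm (u n - x) <= c) -> rnorm (l - x) <= c.
Proof.
move=> ul uc; apply/ler_addgt0Pr => e /ul[N /(_ N (leqnn _))].
by have := uc N; have := rnorm_triangle (u N) l x; rewrite (rnorm_distC l (u _)); lra.
Qed.

Lemma complete_tends (u : nat -> H) : (forall e : R, 0 < e ->
  exists N, forall n m, (N <= n)%N -> (N <= m)%N -> rnorm (u n - u m) < e) ->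
  exists l, tends u l.
Proof.
move=> cu; suff /cvg_tends cl : cvg (u @ \oo) by exists (lim (u @ \oo)).
apply/cauchy_cvgP/cauchy_ballP => e e0.
have eE : e = (complex.Re e)%:C by rewrite RRe_real// realE ltW.
have /cu[N Nu] : 0 < complex.Re e by rewrite -ltcR -eE.
near=> x y; rewrite -ball_normE/=.
have [n Nn <-] : (u @` [set n | (N <= n)%N]) x.
  by near: x; exists N => // n /= Nn; exists n.
have [m Nm <-] : (u @` [set n | (N <= n)%N]) y.
  by near: y; exists N => // m /= Nm; exists m.
by rewrite eE -rnormE ltcR; exact: Nu.
Unshelve. all: by end_near. Qed.

Definition subspace_closed (M : set H) := M 0 /\
  (forall (a : R[i]) x y, M x -> M y -> M (a *: x + y)) /\
  (forall u l, (forall n, M (u n)) -> tends u l -> M l).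

(** A minimizing sequence for the distance from x to M is Cauchy by the parallelogram law; its limit
    p attains the distance, and minimality along lines through p in M gives orthogonality. *)
Lemma projection_exists (M : set H) x : subspace_closed M ->
  exists2 p, M p & forall m, M m -> hdot H (x - p) m = 0.
Proof.
move=> [M0 [Ml Mc]].
pose S := [set rnorm (x - m) ^+ 2 | m in M].
have iS : has_inf S.
  split; first by exists (rnorm (x - 0) ^+ 2), 0.
  by exists 0 => _ [m _ <-]; rewrite sqr_ge0.
pose d := inf S.
have dS m : M m -> d <= rnorm (x - m) ^+ 2.
  by move=> Mm; apply: ge_inf; [exact: iS.2|exists m].
have exn (n : nat) : exists m, M m /\ rnorm (x - m) ^+ 2 < d + n.+1%:R^-1.
  have [|_ [m Mm <-] mn] := @inf_adherent _ S n.+1%:R^-1 _ iS.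
    by rewrite invr_gt0.
  by exists m.
have [u uP] := choice exn.
have Mhalf a b : M a -> M b -> M (2^-1%:C *: (a + b)).
  move=> Ma Mb; rewrite scalerDr; apply: (Ml) => //.
  by rewrite -[_ *: b]addr0; apply: (Ml).
(* The midpoint of [u n] and [u m] lies in M, so its distance term is at least 4 d and cancels both
   copies of 2 d in the parallelogram identity. *)
have dist2 n m : rnorm (u n - u m) ^+ 2 <= 2 * n.+1%:R^-1 + 2 * m.+1%:R^-1.
  have := parallelogram (x - u n) (x - u m).
  have -> : x - u n - (x - u m) = u m - u n.
    by rewrite opprB addrC addrA subrK.
  have -> : x - u n + (x - u m) = 2%:C *: (x - 2^-1%:C *: (u n + u m)).
    rewrite scalerBr scalerA -rmorphM/= divff// scale1r.
    by rewrite rmorph_nat scaler_nat mulr2n opprD addrACA.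
  rewrite rnormZc cabsC exprMn normr_nat (rnorm_distC (u m)).
  have := dS _ (Mhalf _ _ (uP n).1 (uP m).1); have := (uP n).2; have := (uP m).2.
  set a := rnorm (u n - u m) ^+ 2; set b := rnorm (x - _ *: _) ^+ 2.
  move: (n.+1%:R^-1) (m.+1%:R^-1) (rnorm _ ^+ 2) (rnorm _ ^+ 2).
  rewrite expr2 => *; lra.
have [|p up] := @complete_tends u.
  move=> e e0; have e2 : 0 < e ^+ 2 / 4 by rewrite divr_gt0// exprn_gt0.
  have [N _ /(_ N (leqnn _)) NN] := near_infty_natSinv_lt (PosNum e2).
  exists N => n m Nn Nm.
  rewrite -(@ltr_pXn2r _ 2) ?nnegrE ?rnorm_ge0 ?ltW//.
  apply: le_lt_trans (dist2 n m) _.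
  have hle k : (N <= k)%N -> k.+1%:R^-1 <= N.+1%:R^-1 :> R.
    by move=> Nk; rewrite lef_pV2 ?posrE// ler_nat ltnS.
  move: NN (hle _ Nn) (hle _ Nm) => /=.
  by move: (n.+1%:R^-1) (m.+1%:R^-1) (N.+1%:R^-1) => *; lra.
have Mp : M p by apply: (Mc u) => // n; exact: (uP n).1.
exists p => //.
have pd : rnorm (x - p) ^+ 2 <= d.
  apply/ler_addgt0Pr => e e0.
  pose c := rnorm (x - p).
  have c0 : 0 <= c by exact: rnorm_ge0.
  (* With a = |u n - p| and b = |x - u n|, this choice makes 2 c a < e / 2, so (c - a)^2 <= b^2 < d
     + e / 2 yields c^2 <= d + e. *)
  have ec : 0 < e / (2 * (2 * c + 1)) by rewrite divr_gt0//; lra.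
  have /up[N Nu] : 0 < Num.min (e / (2 * (2 * c + 1))) 1 by rewrite lt_min ec/=.
  have e2 : 0 < e / 2 by lra.
  have [K _ KK] := near_infty_natSinv_lt (PosNum e2).
  have {}Nu := Nu (N + K)%N (leq_addr _ _); rewrite lt_min in Nu.
  have {KK} /= KK := KK (N + K)%N (leq_addl _ _).
  have := (uP (N + K)%N).2; move: Nu => /andP[].
  rewrite ltr_pdivlMr; last by lra.
  have := rnorm_triangle (u (N + K)%N) x p; rewrite -/c.
  move: KK; move: ((N + K).+1%:R^-1) => r re.
  set a := rnorm (u _ - p); set b := rnorm (x - u _).
  have a0 : 0 <= a by exact: rnorm_ge0.
  have b0 : 0 <= b by exact: rnorm_ge0.
  move=> cab ac a1 bd; have : (c - a) ^+ 2 <= b ^+ 2 \/ c < a.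
    have [ca|] := leP a c; last by right.
    by left; rewrite ler_sqr ?nnegrE; lra.
  move=> [h|h]; nra.
move=> m Mm; set z := hdot H _ _; apply/eqP; rewrite -cabs_eq0.
(* Minimality at p compared with p + t z m: the cross term is 2 t |z|^2 because the multiplier z is
   the inner product itself. A factor t has been divided out; t = 1 / (|m|^2 + 1) then forces z =
   0. *)
have key (t : R) : 0 < t -> 2 * cabs z ^+ 2 <= t * (cabs z ^+ 2 * rnorm m ^+ 2).
  move=> t0; have : d <= rnorm (x - ((t%:C * z) *: m + p)) ^+ 2.
    by apply: dS; exact: (Ml).
  rewrite opprD [- _ - p]addrC addrA sqr_rnormB hdotZr -/z conjcM conjcR.
  rewrite -mulrA ReZ conjcMz /= rnormZc cabsM cabsC gtr0_norm//.
  move: pd t0; rewrite !exprMn; nra.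
have z0 := cabs_ge0 z; rewrite eq_le z0 andbT leNgt; apply/negP => zp.
have m0 : 0 <= rnorm m ^+ 2 by rewrite sqr_ge0.
have m1 : 0 < rnorm m ^+ 2 + 1 by lra.
have := key _ (divr_gt0 ltr01 m1).
rewrite mul1r ler_pdivlMl//; have : 0 < cabs z ^+ 2 by rewrite exprn_gt0.
by move: (cabs z ^+ 2) (rnorm m ^+ 2) m0 => a b b0 a0; nra.
Qed.

(** The functional is conjugate-linear because [hdot] is so in its second argument. If l is not
    zero, take w orthogonal to its kernel: every g differs from a multiple of w by an element of the
    kernel, and a suitable multiple of w represents l. *)
Lemma riesz (l : H -> R[i]) (C : R) :
  (forall (a : R[i]) g h, l (a *: g + h) = conjc a * l g + l h) ->
  (forall g, cabs (l g) <= C * rnorm g) ->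
  exists y, forall g, hdot H y g = l g.
Proof.
move=> ll lC.
have l0 : l 0 = 0.
  by apply/eqP; rewrite -cabs_eq0 eq_le cabs_ge0 (le_trans (lC _))// rnorm0 mulr0.
have [[x0 lx0]|nex] := pselect (exists x, l x <> 0); last first.
  exists 0 => g; rewrite hdot0l; apply/esym; apply: contrapT => lg; apply: nex.
  by exists g.
have [|p /= lp pN] := @projection_exists [set g | l g = 0] x0.
  split; [exact: l0|split=> [a x y /= lx ly|u y /= lu uy]].
    by rewrite ll lx ly mulr0 addr0.
  apply/eqP; rewrite -cabs_eq0 eq_le cabs_ge0 andbT; apply/ler_addgt0Pr => e e0.
  have C1 : 0 < `|C| + 1 by rewrite ltr_wpDl.
  have /uy[n /(_ n (leqnn _)) un] : 0 < e / (`|C| + 1) by rewrite divr_gt0.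
  have -> : l y = l ((-1) *: (u n - y) + u n).
    by rewrite scaleN1r opprB subrK.
  rewrite ll lu addr0 cabsM cabs_conj cabsN (cabsC 1) normr1 mul1r add0r.
  apply: le_trans (lC _) _; move: un; rewrite ltr_pdivlMr// => un.
  apply: le_trans (ltW un); rewrite mulrC ler_wpM2l ?rnorm_ge0//.
  by rewrite (le_trans (ler_norm _))// lerDl.
set w := x0 - p in pN.
have lw : l w = l x0.
  rewrite /w (_ : x0 - p = (-1) *: p + x0); last by rewrite scaleN1r addrC.
  by rewrite ll lp mulr0 add0r.
have lw0 : l w != 0 by rewrite lw; apply/eqP.
have w0 : rnorm w != 0.
  by rewrite rnorm_eq0; apply: contra_neq lw0 => ->.
exists ((l w / (rnorm w ^+ 2)%:C) *: w) => g; rewrite hdotZl.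
have /pN : l (- conjc (l g / l w) *: w + g) = 0.
  by rewrite ll conjcN conjcK mulNr divfK// addNr.
rewrite hdotDr hdotZr conjcN conjcK hdotxx mulNr addrC => /subr0_eq ->.
have w2 : (rnorm w ^+ 2)%:C != 0.
  by rewrite -(rmorph0 (real_complex R)) (inj_eq (@complexI R)) sqrf_eq0.
by move: w2; move: ((rnorm w ^+ 2)%:C) => W w2; field; rewrite w2 lw0.
Qed.

End hilbert.

(** * The unitary group generated by a selfadjoint operator *)

Section resolvent.
Context {R : realType} {H : hilbertSpace R} (A : selfadjoint_operator H).
Implicit Types (f g x y : H) (s t a b : R).

Lemma tends_hdot_eq (u v : nat -> H) l m x y : tends u l -> tends v m ->
  (forall n, hdot H (u n) x = hdot H (v n) y) -> hdot H l x = hdot H m y.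
Proof.
move=> ul vm uv; apply/eqP; rewrite -subr_eq0 -cabs_eq0 eq_le cabs_ge0 andbT.
apply/ler_addgt0Pr => e e0; rewrite add0r.
have x1 : 0 < rnorm x + rnorm y + 1 by rewrite ltr_wpDl// addr_ge0 ?rnorm_ge0.
have h : 0 < e / 2 / (rnorm x + rnorm y + 1) by rewrite divr_gt0// divr_gt0.
have /ul[N uN] := h; have /vm[M vM] := h.
have {}uN := uN (N + M)%N (leq_addr _ _).
have {}vM := vM (N + M)%N (leq_addl _ _).
rewrite (_ : _ - _ = hdot H (v (N + M)%N - m) y - hdot H (u (N + M)%N - l) x).
  rewrite (le_trans (cabsD _ _))// cabsN.
  have := hdot_le (v (N + M)%N - m) y; have := hdot_le (u (N + M)%N - l) x.
  move: uN vM; rewrite !ltr_pdivlMr//.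
  have := rnorm_ge0 x; have := rnorm_ge0 y.
  have := rnorm_ge0 (u (N + M)%N - l); have := rnorm_ge0 (v (N + M)%N - m).
  set p := rnorm (u _ - l); set q := rnorm (v _ - m); nra.
by rewrite !hdotBl uv; ring.
Qed.

Lemma dom0 : dom A 0. Proof. by case: (sa_linear A). Qed.

Lemma domP (c : R[i]) x y : dom A x -> dom A y -> dom A (c *: x + y).
Proof. by move=> Ax Ay; have [_ /(_ c x y Ax Ay)[]] := sa_linear A. Qed.

Lemma opP (c : R[i]) x y : dom A x -> dom A y ->
  A (c *: x + y) = c *: A x + A y.
Proof. by move=> Ax Ay; have [_ /(_ c x y Ax Ay)[]] := sa_linear A. Qed.

Lemma op0 : A 0 = 0.
Proof.
have := opP 1 dom0 dom0; rewrite !scale1r addr0 => /eqP.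
by rewrite -[X in X == _]addr0 (inj_eq (addrI _)) eq_sym => /eqP.
Qed.

Lemma domZ (c : R[i]) x : dom A x -> dom A (c *: x).
Proof. by move=> Ax; rewrite -[_ *: _]addr0; apply: domP => //; exact: dom0. Qed.

Lemma opZ (c : R[i]) x : dom A x -> A (c *: x) = c *: A x.
Proof.
move=> Ax; rewrite -[c *: x]addr0 opP//; last exact: dom0.
by rewrite op0 addr0.
Qed.

Lemma opD x y : dom A x -> dom A y -> A (x + y) = A x + A y.
Proof. by move=> Ax Ay; rewrite -[x in LHS]scale1r opP// scale1r. Qed.

Lemma domB x y : dom A x -> dom A y -> dom A (x - y).
Proof. by move=> Ax Ay; rewrite -scaleN1r addrC; exact: domP. Qed.

Lemma opB x y : dom A x -> dom A y -> A (x - y) = A x - A y.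
Proof.
by move=> Ax Ay; rewrite -[- y]scaleN1r opD ?opZ//; [rewrite scaleN1r|exact: domZ].
Qed.

(** A equals its adjoint, and an adjoint is closed: the identity <A x, u n> = <x, A (u n)> passes to
    the limit for each fixed x in D(A). *)
Lemma op_closed (u : nat -> H) l m : (forall n, dom A (u n)) -> tends u l ->
  tends (fun n => A (u n)) m -> dom A l /\ A l = m.
Proof.
move=> uA ul Aum; have [_ /(_ l m)[h _]] := sa_selfadjoint A; apply: h => x Ax.
rewrite hdotC [RHS]hdotC; congr conjc.
by apply: (tends_hdot_eq ul Aum) => n; exact: hdotAC.
Qed.

Lemma dom_approx x e : 0 < e -> exists2 y, dom A y & rnorm (x - y) < e.
Proof.
move=> e0; have [dA _] := sa_selfadjoint A.
have ec : 0 < e%:C by rewrite ltcR.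
have [|y [xy Ay]] := dA (ball x e%:C) _ (ball_open x _).
  by exists x; exact: ballxx.
by exists y => //; move: xy; rewrite -ball_normE/= -rnormE ltcR.
Qed.

(** Symmetry makes <x, A x> real, so the cross term with the imaginary factor i s has real part
    zero. *)
Lemma rnorm_resolv s x : dom A x ->
  rnorm (x - (s%:C * 'i) *: A x) ^+ 2 = rnorm x ^+ 2 + s ^+ 2 * rnorm (A x) ^+ 2.
Proof.
move=> Ax; rewrite sqr_rnormB rnormZc cabsM cabsi mulr1 cabsC exprMn.
rewrite real_normK ?num_real//.
have : hdot H x (A x) = conjc (hdot H x (A x)) by rewrite -hdotC hdotAC.
rewrite hdotZr; case: (hdot H x (A x)) => a b [] ?.
have -> : b = 0 by lra.
by rewrite conjcM !ReM/= !(mulr0, mul0r, subr0, mulr1, oppr0, mulN1r, addr0).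
Qed.

(** The range M of 1 - i s A is closed, by the lower bound [bnd] and closedness of A. A vector w
    orthogonal to M satisfies A w = conj(1 / (i s)) w by selfadjointness, hence w - i s A w = 2 w;
    this is again orthogonal to w, so w = 0. *)
Lemma resolv_surj s f : s != 0 ->
  exists x, dom A x /\ x - (s%:C * 'i) *: A x = f.
Proof.
move=> s0.
have is0 : s%:C * 'i != 0 :> R[i] by rewrite -cabs_eq0 cabsM cabsi mulr1 cabsC normr_eq0.
pose M := [set x - (s%:C * 'i) *: A x | x in dom A].
have lin c x y : dom A x -> dom A y ->
    c *: (x - (s%:C * 'i) *: A x) + (y - (s%:C * 'i) *: A y) =
    (c *: x + y) - (s%:C * 'i) *: A (c *: x + y).
  move=> Ax Ay; rewrite opP// scalerBr !scalerDr !scalerA (mulrC c).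
  by rewrite opprD addrACA.
have bnd x : dom A x -> rnorm x <= rnorm (x - (s%:C * 'i) *: A x).
  move=> Ax; rewrite -(@ler_pXn2r _ 2) ?nnegrE ?rnorm_ge0// rnorm_resolv//.
  by rewrite lerDl mulr_ge0 ?sqr_ge0.
have [|p [x Ax px] pM] := @projection_exists _ H M f.
  split; first by exists 0; rewrite ?op0 ?scaler0 ?subr0//; exact: dom0.
  split=> [c _ _ [x Ax <-] [y Ay <-]|u l uM ul].
    by exists (c *: x + y); [exact: domP|rewrite lin].
  have /choice[v vP] n : exists x, dom A x /\ x - (s%:C * 'i) *: A x = u n.
    by have [x Ax xu] := uM n; exists x.
  have [w vw] : exists w, tends v w.
    apply: complete_tends => e e0.
    have /ul[N uN] : 0 < e / 2 by lra.
    exists N => n m Nn Nm.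
    have := bnd _ (domB (vP n).1 (vP m).1).
    rewrite (opB (vP n).1 (vP m).1) scalerBr opprD addrACA -opprD !(vP _).2.
    have := uN _ Nn; have := uN _ Nm; have := rnorm_triangle l (u n) (u m).
    rewrite (rnorm_distC l); lra.
  have Av n : A (v n) = (s%:C * 'i)^-1 *: (v n - u n).
    by rewrite -(vP n).2 opprB addrC subrK scalerA mulVf// scale1r.
  have Avt : tends (fun n => A (v n)) ((s%:C * 'i)^-1 *: (w - l)).
    move=> e e0; pose c := cabs ((s%:C * 'i)^-1) + 1.
    have c0 : 0 < c by rewrite ltr_wpDl// cabs_ge0.
    have h : 0 < e / 2 / c by rewrite divr_gt0// divr_gt0.
    have /ul[N uN] := h; have /vw[K vK] := h.
    exists (N + K)%N => n NKn; rewrite Av -scalerBr rnormZc.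
    have {}uN := uN n (leq_trans (leq_addr _ _) NKn).
    have {}vK := vK n (leq_trans (leq_addl _ _) NKn).
    have : rnorm (v n - u n - (w - l)) < e / c.
      rewrite (_ : _ - _ = (v n - w) - (u n - l)); last first.
        by rewrite opprD addrACA -opprD.
      by rewrite (le_lt_trans (rnormB _ _))//; move: uN vK; lra.
    rewrite ltr_pdivlMr// => /le_lt_trans; apply; rewrite mulrC ler_wpM2l ?rnorm_ge0//.
    by rewrite lerDl.
  have [Aw Awe] := op_closed (fun n => (vP n).1) vw Avt.
  by exists w => //; rewrite Awe scalerA divff// scale1r opprB addrC subrK.
have fp w : w = f - p -> w = 0.
  move=> wE.
  have wM y : dom A y -> hdot H w (y - (s%:C * 'i) *: A y) = 0.
    by move=> Ay; rewrite wE; apply: pM; exists y.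
  have [Aw Awe] : dom A w /\ A w = conjc ((s%:C * 'i)^-1) *: w.
    have [_ /(_ w (conjc ((s%:C * 'i)^-1) *: w))[h _]] := sa_selfadjoint A.
    apply: h => y Ay; rewrite hdotZr conjcK.
    have /(congr1 conjc) := wM _ Ay.
    rewrite -hdotC conjc0 hdotBl hdotZl => /subr0_eq ->.
    by rewrite mulrA mulVf// mul1r.
  have := wM _ Aw; rewrite Awe scalerA hdotBr hdotZr conjcM conjcK conjcM conjcR.
  rewrite (_ : conjc 'i = - 'i); last by apply: complex_eq; rewrite /= ?oppr0.
  rewrite mulrN mulNr divff// mulN1r opprK hdotxx -rmorphD/= => /complexI.
  have := sqr_ge0 (rnorm w) => ? ?; apply/eqP; rewrite -rnorm_eq0 -sqrf_eq0.
  by apply/eqP; lra.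
by exists x; split=> //; rewrite px; apply/esym/subr0_eq/fp.
Qed.
End resolvent.

Section group.
Context {R : realType} {H : hilbertSpace R} (A : selfadjoint_operator H).
Implicit Types (f g x y : H) (s t a b : R).

(** The contraction (1 - i s A)^{-1}, one backward Euler step of size s for u' = i A u. At s = 0 the
    defining condition would force f into D(A), so the identity is put in by hand. *)
Definition resolv s f : H := if s == 0 then f else
  xget 0 [set x | dom A x /\ x - (s%:C * 'i) *: A x = f].
Local Notation J := resolv.

Lemma resolv0 f : J 0 f = f.
Proof. by rewrite /resolv eqxx. Qed.

Lemma resolvP s f : s != 0 ->
  dom A (J s f) /\ J s f - (s%:C * 'i) *: A (J s f) = f.
Proof.
move=> s0; rewrite /resolv (negbTE s0).
have [x xP] := resolv_surj A f s0.
exact: (@xgetI _ _ [set x | dom A x /\ x - (s%:C * 'i) *: A x = f] _ xP).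
Qed.

Lemma resolv_bound s x : dom A x ->
  rnorm x <= rnorm (x - (s%:C * 'i) *: A x).
Proof.
move=> Ax; rewrite -(@ler_pXn2r _ 2) ?nnegrE ?rnorm_ge0// rnorm_resolv//.
by rewrite lerDl mulr_ge0 ?sqr_ge0.
Qed.

Lemma resolvK s x : dom A x -> J s (x - (s%:C * 'i) *: A x) = x.
Proof.
move=> Ax; have [->|s0] := eqVneq s 0.
  by rewrite mul0r scale0r subr0 resolv0.
have [dy yE] := resolvP (x - (s%:C * 'i) *: A x) s0; set y := J s _ in dy yE *.
apply/eqP; rewrite -subr_eq0 -rnorm_eq0 eq_le rnorm_ge0 andbT.
rewrite (le_trans (resolv_bound s (domB dy Ax)))// opB// scalerBr opprD.
by rewrite addrACA -opprD yE subrr rnorm0.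
Qed.

(** Substituting this form of f reduces identities about [resolv] to [resolvK], with the exceptional
    value s = 0 kept apart. *)
Lemma resolv_ind s f : s = 0 \/ exists2 x, dom A x & f = x - (s%:C * 'i) *: A x.
Proof.
have [->|s0] := eqVneq s 0; [by left|right].
by have [dx xE] := resolvP f s0; exists (J s f).
Qed.

Lemma resolv_lin s (c : R[i]) f g : J s (c *: f + g) = c *: J s f + J s g.
Proof.
have [->|[x Ax ->]] := resolv_ind s f; first by rewrite !resolv0.
have [->|[y Ay ->]] := resolv_ind s g; first by rewrite !resolv0.
rewrite !resolvK//.
have -> : c *: (x - (s%:C * 'i) *: A x) + (y - (s%:C * 'i) *: A y) =
    (c *: x + y) - (s%:C * 'i) *: A (c *: x + y).
  rewrite opP// scalerBr !scalerDr !scalerA (mulrC c).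
  by rewrite opprD addrACA.
by rewrite resolvK//; exact: domP.
Qed.

Lemma resolv_le s f : rnorm (J s f) <= rnorm f.
Proof.
have [->|[x Ax ->]] := resolv_ind s f; first by rewrite !resolv0.
by rewrite resolvK//; exact: resolv_bound.
Qed.

Lemma resolv_dom s f : dom A f -> dom A (J s f) /\ A (J s f) = J s (A f).
Proof.
have [->|s0] := eqVneq s 0; first by rewrite !resolv0.
move=> Af; have [dx xE] := resolvP f s0; split=> //.
have is0 : s%:C * 'i != 0 :> R[i].
  by rewrite -cabs_eq0 cabsM cabsi mulr1 cabsC normr_eq0.
set x := J s f in dx xE *.
have AxE : A x = (s%:C * 'i)^-1 *: (x - f).
  by rewrite -[in X in _ *: X]xE opprB addrC subrK scalerA mulVf// scale1r.
have dAx : dom A (A x) by rewrite AxE; apply: domZ; exact: domB.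
by rewrite -[in RHS]xE opB ?opZ ?resolvK//; exact: domZ.
Qed.

Lemma resolvKr s f : dom A f -> J s f - (s%:C * 'i) *: J s (A f) = f.
Proof.
move=> Af; have [_ <-] := resolv_dom s Af.
have [->|s0] := eqVneq s 0; last by case: (resolvP f s0).
by rewrite resolv0 mul0r scale0r subr0.
Qed.

Lemma resolv_comm s t f : J s (J t f) = J t (J s f).
Proof.
have [->|[x Ax ->]] := resolv_ind s f; first by rewrite !resolv0.
have [dx AJ] := resolv_dom t Ax.
rewrite (resolvK s Ax) addrC -scaleNr resolv_lin addrC scaleNr -AJ.
by rewrite resolvK.
Qed.

Lemma resolv_near s f : dom A f -> rnorm (J s f - f) <= `|s| * rnorm (A f).
Proof.
move=> Af; rewrite -[X in _ - X](resolvKr s Af) opprB addrC subrK rnormZc.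
by rewrite cabsM cabsi mulr1 cabsC ler_wpM2l// resolv_le.
Qed.

Lemma resolvB s f g : J s (f - g) = J s f - J s g.
Proof. by rewrite -[- g]scaleN1r addrC resolv_lin scaleN1r addrC. Qed.

Lemma resolvZ s (c : R[i]) f : J s (c *: f) = c *: J s f.
Proof.
rewrite -[c *: f]addr0 resolv_lin (_ : J s 0 = 0) ?addr0//.
by rewrite -(subrr (0 : H)) resolvB !subrr.
Qed.

Definition dom2 f := dom A f /\ dom A (A f).

Lemma resolv_dom2 s f : dom2 f ->
  dom2 (J s f) /\ A (A (J s f)) = J s (A (A f)).
Proof.
move=> [Af AAf]; have [d1 e1] := resolv_dom s Af.
have [d2 e2] := resolv_dom s AAf.
by rewrite /dom2 e1.
Qed.

(** For z = J_a J_b f, expanding (1 - i b A)(1 - i a A) z = f gives f = (1 - i (a + b) A) z - a b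
    A^2 z. Applying the contraction J_{a+b} leaves only the last term as error. *)
Lemma resolv_mul a b f : dom2 f ->
  rnorm (J (a + b) f - J a (J b f)) <= `|a * b| * rnorm (A (A f)).
Proof.
move=> f2; have [b2 bE] := resolv_dom2 b f2; have [z2 zE] := resolv_dom2 a b2.
set z := J a (J b f) in z2 zE *.
have e1 : J b f = z - (a%:C * 'i) *: A z.
  by rewrite -[LHS](resolvKr a b2.1) -(resolv_dom a b2.1).2.
have e2 : f = z - ((a + b)%:C * 'i) *: A z - (a * b)%:C *: A (A z).
  rewrite -[LHS](resolvKr b f2.1) -(resolv_dom b f2.1).2 e1.
  rewrite opB; [|exact: z2.1|by apply: domZ; exact: z2.2].
  rewrite opZ; last exact: z2.2.
  rewrite scalerBr scalerA opprB addrA addrAC (_ : _ * (a%:C * 'i) = - (a * b)%:C).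
    rewrite scaleNr; congr (_ - _); rewrite -addrA -opprD -scalerDl.
    by congr (_ - _ *: _); rewrite rmorphD; ring.
  by apply: complex_eq => /=; ring.
rewrite {1}e2 resolvB resolvK; last exact: z2.1.
rewrite addrC addKr rnormN resolvZ rnormZc cabsC ler_wpM2l//.
rewrite (le_trans (resolv_le _ _))// zE bE (le_trans (resolv_le _ _))//.
exact: resolv_le.
Qed.

Lemma resolv_cvg f e : 0 < e -> exists2 d, 0 < d &
  forall s, `|s| < d -> rnorm (J s f - f) < e.
Proof.
move=> e0; have e3 : 0 < e / 3 by lra.
have [g Ag fg] := dom_approx A f e3.
have d0 : 0 < e / 3 / (rnorm (A g) + 1).
  by rewrite divr_gt0// ltr_wpDl// rnorm_ge0.
exists (e / 3 / (rnorm (A g) + 1)) => // s.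
rewrite ltr_pdivlMr; last by rewrite ltr_wpDl// rnorm_ge0.
have := resolv_near s Ag; have := resolv_le s (f - g); rewrite resolvB.
have := rnorm_triangle (J s g) (J s f) f; have := rnorm_triangle g (J s g) f.
rewrite (rnorm_distC g f); have := normr_ge0 s; nra.
Qed.

(** The approximant is J_s f for small s: it lies one degree of domain higher than f, and A J_s f =
    J_s (A f) makes it close to f in the graph norm too. *)
Lemma dom2_approx f e : 0 < e -> dom A f ->
  exists g, [/\ dom2 g, rnorm (f - g) < e & rnorm (A f - A g) < e].
Proof.
move=> e0 Af; have [d d0 dP] := resolv_cvg f e0.
have [d' d'0 d'P] := resolv_cvg (A f) e0.
pose s := Num.min d d' / 2.
have m0 : 0 < Num.min d d' by rewrite lt_min d0.
have s0 : 0 < s by rewrite divr_gt0.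
have sm : `|s| < Num.min d d' by rewrite gtr0_norm// /s; lra.
move: sm; rewrite lt_min => /andP[sd sd'].
have [h1 h2] := resolv_dom s Af.
exists (J s f); split.
- by split=> //; rewrite h2; case: (resolvP (A f) (lt0r_neq0 s0)).
- by rewrite rnorm_distC; exact: dP.
- by rewrite rnorm_distC h2; exact: d'P.
Qed.

Lemma dom2_dense f e : 0 < e -> exists2 g, dom2 g & rnorm (f - g) < e.
Proof.
move=> e0; have e2 : 0 < e / 2 by lra.
have [g Ag fg] := dom_approx A f e2; have [h [h2 gh _]] := dom2_approx e2 Ag.
by exists h => //; have := rnorm_triangle g f h; lra.
Qed.

End group.

(** * The exponential formula and the unitary group *)

Section group.
Context {R : realType} {H : hilbertSpace R} (A : selfadjoint_operator H).
Implicit Types (f g x y : H) (s t a b : R).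
Local Notation J := (resolv A).

Lemma iter_comm (T : Type) (P Q : T -> T) n (z : T) :
  (forall w : T, P (Q w) = Q (P w)) -> iter n P (Q z) = Q (iter n P z).
Proof. by move=> PQ; elim: n => //= n ->. Qed.

Lemma iter_comp (T : Type) (P Q : T -> T) n (z : T) :
  (forall w : T, P (Q w) = Q (P w)) ->
  iter n (P \o Q) z = iter n P (iter n Q z).
Proof.
move=> PQ; elim: n => //= n ->.
by congr P; rewrite (iter_comm _ _ PQ).
Qed.

Lemma iter_resolvB s n f g :
  iter n (J s) (f - g) = iter n (J s) f - iter n (J s) g.
Proof. by elim: n => //= n ->; rewrite resolvB. Qed.

Lemma iter_resolv_le s n f : rnorm (iter n (J s) f) <= rnorm f.
Proof. by elim: n => //= n; apply: le_trans; exact: resolv_le. Qed.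

Lemma iter_resolv_dom s n f : dom A f ->
  dom A (iter n (J s) f) /\ A (iter n (J s) f) = iter n (J s) (A f).
Proof.
move=> Af; elim: n => //= n [dn en].
by have [h1 h2] := resolv_dom s dn; rewrite h2 en.
Qed.

Lemma iter_resolv_near s n f : dom A f ->
  rnorm (iter n (J s) f - f) <= n%:R * (`|s| * rnorm (A f)).
Proof.
move=> Af; elim: n => [|n IH]; first by rewrite subrr rnorm0 mul0r.
rewrite iterS (le_trans (rnorm_triangle (J s f) _ _))//.
rewrite -natr1 mulrDl mul1r lerD//; last exact: resolv_near.
by rewrite -resolvB (le_trans (resolv_le _ _ _)).
Qed.

(** Stability plus consistency: in the telescoping sum each local error is propagated by the
    contraction J_s, and Q does not increase |A^2 y|, so n steps cost n local errors. *)
Lemma iter_diff (P : H -> H) s (Q : H -> H) (c : R) n f :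
  (forall y, dom2 A y -> dom2 A (Q y) /\ rnorm (A (A (Q y))) <= rnorm (A (A y))) ->
  (forall y, dom2 A y -> rnorm (J s y - Q y) <= c * rnorm (A (A y))) -> 0 <= c ->
  dom2 A f -> rnorm (iter n (J s) f - iter n Q f) <= n%:R * (c * rnorm (A (A f))).
Proof.
move=> Qd PQ c0; elim: n f => [|n IH] f f2.
  by rewrite subrr rnorm0 mul0r.
rewrite !iterSr (le_trans (rnorm_triangle (iter n (J s) (Q f)) _ _))//.
rewrite -natr1 mulrDl mul1r addrC lerD//.
  have [q2 qle] := Qd _ f2; rewrite (le_trans (IH _ q2))//.
  by rewrite ler_wpM2l// ler_wpM2l.
by rewrite -iter_resolvB (le_trans (iter_resolv_le _ _ _))// PQ.
Qed.

(* Backward Euler approximation of e^{itA} with 2^k steps. *)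
Definition euler t k f := iter (2 ^ k) (J (t / 2 ^+ k)) f.

(** One step of size 2 s against two of size s, with s = t / 2^{k+1}, costs s^2 |A^2 f|; the 2^k
    steps add up to t^2 / 2^{k+2}. Writing this as a difference of powers lets the errors telescope
    over k. *)
Lemma euler_step t k f : dom2 A f -> rnorm (euler t k f - euler t k.+1 f) <=
  t ^+ 2 / 2 * (2^-1 ^+ k - 2^-1 ^+ k.+1) * rnorm (A (A f)).
Proof.
move=> f2; pose s := t / 2 ^+ k.+1.
have sE : t / 2 ^+ k = s + s.
  by rewrite /s exprSr; field; rewrite expf_neq0.
have -> : euler t k.+1 f = iter (2 ^ k) (J s \o J s) f.
  by rewrite iter_comp// /euler expnSr muln2 -addnn iterD.
rewrite /euler sE.
have := @iter_diff (J (s + s)) (s + s) (J s \o J s) (s ^+ 2) (2 ^ k) f.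
move=> h; apply: le_trans (h _ _ _ f2) _.
- move=> y y2 /=; have [a1 a2] := resolv_dom2 s y2.
  have [b1 b2] := resolv_dom2 s a1; split=> //.
  by rewrite b2 a2 (le_trans (resolv_le _ _ _))// resolv_le.
- move=> y y2; apply: le_trans (resolv_mul s s y2) _.
  by rewrite -expr2 ger0_norm// sqr_ge0.
- exact: sqr_ge0.
rewrite mulrA ler_wpM2r ?rnorm_ge0// natrX /s !exprVn !exprS le_eqVlt.
by apply/orP; left; apply/eqP; field; rewrite expf_neq0.
Qed.

Lemma euler_dist t k j f : dom2 A f -> rnorm (euler t k f - euler t (k + j) f) <=
  t ^+ 2 / 2 * 2^-1 ^+ k * rnorm (A (A f)).
Proof.
move=> f2; suff h : rnorm (euler t k f - euler t (k + j) f) <=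
    t ^+ 2 / 2 * (2^-1 ^+ k - 2^-1 ^+ (k + j)) * rnorm (A (A f)).
  apply: le_trans h _; rewrite ler_wpM2r ?rnorm_ge0// ler_wpM2l//.
    by rewrite divr_ge0// sqr_ge0.
  by rewrite lerBlDr lerDl exprn_ge0.
elim: j => [|j IH].
  by rewrite addn0 subrr rnorm0 subrr mulr0 mul0r.
rewrite (le_trans (rnorm_triangle (euler t (k + j) f) _ _))//.
rewrite addnS; have := euler_step t (k + j) f2; move: IH.
set p := rnorm _; set q := rnorm _; set r := rnorm _; lra.
Qed.

Lemma eulerB t k f g : euler t k (f - g) = euler t k f - euler t k g.
Proof. exact: iter_resolvB. Qed.

Lemma euler_le t k f : rnorm (euler t k f) <= rnorm f.
Proof. exact: iter_resolv_le. Qed.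

(** On [dom2] the sequence is Cauchy by [euler_dist]; uniform contractivity carries this to all f by
    density. The two passages between f and g cost e / 8 each, the Cauchy estimate on g costs e /
    4. *)
Lemma euler_cvg t f : exists l, tends (fun k => euler t k f) l.
Proof.
apply: complete_tends => e e0; have e8 : 0 < e / 8 by lra.
have [g g2 fg] := dom2_dense A f e8.
pose c := t ^+ 2 / 2 * rnorm (A (A g)).
have c0 : 0 <= c by rewrite mulr_ge0 ?rnorm_ge0// divr_ge0// sqr_ge0.
have h0 : 0 < e / 4 / (c + 1) by rewrite divr_gt0//; lra.
have [N _ /(_ N (leqnn _)) NN] := near_infty_natSinv_expn_lt (PosNum h0).
have main n : (N <= n)%N -> rnorm (euler t n f - euler t N f) < e / 2.
  move=> Nn; have small : t ^+ 2 / 2 * 2^-1 ^+ N * rnorm (A (A g)) < e / 4.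
    move: NN => /=; rewrite -exprVn ltr_pdivlMr; last by lra.
    have -> : t ^+ 2 / 2 * 2^-1 ^+ N * rnorm (A (A g)) = c * 2^-1 ^+ N.
      by rewrite /c mulrAC.
    have : 0 <= (2^-1 : R) ^+ N by exact: exprn_ge0.
    nra.
  have := le_lt_trans (euler_dist t N (n - N) g2) small; rewrite subnKC//.
  have := euler_le t n (f - g); have := euler_le t N (f - g); rewrite !eulerB.
  have := rnorm_triangle (euler t n g) (euler t n f) (euler t N f).
  have := rnorm_triangle (euler t N g) (euler t n g) (euler t N f).
  rewrite (rnorm_distC (euler t n g) (euler t N g)).
  rewrite (rnorm_distC (euler t N g) (euler t N f)).
  lra.
exists N => n m Nn Nm; have := main _ Nn; have := main _ Nm.
have := rnorm_triangle (euler t N f) (euler t n f) (euler t m f).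
rewrite (rnorm_distC (euler t N f) (euler t m f)); lra.
Qed.

(** This is e^{i t A}, the strong limit of (1 - i t A / 2^k)^{-2^k}. *)
Definition grp t f : H := xget 0 [set l | tends (fun k => euler t k f) l].
Local Notation U := grp.

Lemma grpP t f : tends (fun k => euler t k f) (U t f).
Proof.
have [l lP] := euler_cvg t f.
exact: (@xgetI _ _ [set l | tends (fun k => euler t k f) l] _ lP).
Qed.

Lemma tends_lin (c : R[i]) (u v : nat -> H) l m : tends u l -> tends v m ->
  tends (fun n => c *: u n + v n) (c *: l + m).
Proof.
move=> ul vm e e0; have h : 0 < e / 2 / (cabs c + 1).
  by rewrite divr_gt0 ?ltr_wpDl ?cabs_ge0//; lra.
have h2 : 0 < e / 2 by lra.
have [N uN] := ul _ h; have [M vM] := vm _ h2.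
exists (N + M)%N => n NMn.
have := uN n (leq_trans (leq_addr _ _) NMn).
have := vM n (leq_trans (leq_addl _ _) NMn).
have c1 : 0 < cabs c + 1 by rewrite ltr_wpDl ?cabs_ge0.
rewrite opprD addrACA -scalerBr => vn; rewrite (ltr_pdivlMr _ _ c1) => un.
rewrite (le_lt_trans (rnormD _ _))// rnormZc.
have := rnorm_ge0 (u n - l); have := cabs_ge0 c; nra.
Qed.

Lemma grp_lin t (c : R[i]) f g : U t (c *: f + g) = c *: U t f + U t g.
Proof.
apply: (tends_unique (grpP t _)).
have := tends_lin c (grpP t f) (grpP t g); congr tends; apply/funext => k.
rewrite /euler; move: (2 ^ k)%N => n.
by elim: n => //= n IH; rewrite -resolv_lin IH.
Qed.

Lemma grpB t f g : U t (f - g) = U t f - U t g.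
Proof. by rewrite -[- g]scaleN1r addrC grp_lin scaleN1r addrC. Qed.

Lemma grp_0 t : U t 0 = 0.
Proof. by rewrite -(subrr (0 : H)) grpB !subrr. Qed.

Lemma grpZ t (c : R[i]) f : U t (c *: f) = c *: U t f.
Proof. by rewrite -[c *: f]addr0 grp_lin grp_0 addr0. Qed.

Lemma grp_le t f : rnorm (U t f) <= rnorm f.
Proof.
rewrite -[U t f]subr0; apply: (tends_le (grpP t f)) => k.
by rewrite subr0 euler_le.
Qed.

Lemma grp0 f : U 0 f = f.
Proof.
apply: (tends_unique (grpP 0 f)) => e e0; exists 0%N => k _.
rewrite (_ : euler 0 k f = f) ?subrr ?rnorm0// /euler mul0r.
by elim: (2 ^ k)%N => //= n ->; rewrite resolv0.
Qed.

(** By commutation the composed iterations are powers of J_a J_b, and [resolv_mul] compares one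
    factor with J_{a+b}; the 2^k local errors |a b| |A^2 f| sum to |s t| |A^2 f| / 2^k. *)
Lemma euler_add s t k f : dom2 A f ->
  rnorm (euler (s + t) k f - euler s k (euler t k f)) <=
  `|s * t| * rnorm (A (A f)) * 2^-1 ^+ k.
Proof.
move=> f2; rewrite /euler -iter_comp; last by move=> y; exact: resolv_comm.
pose a := s / 2 ^+ k; pose b := t / 2 ^+ k.
rewrite mulrDl -/a -/b.
have := @iter_diff (J (a + b)) (a + b) (J a \o J b) `|a * b| (2 ^ k) f.
move=> h; apply: le_trans (h _ _ _ f2) _.
- move=> y y2 /=; have [a1 a2] := resolv_dom2 b y2.
  have [b1 b2] := resolv_dom2 a a1; split=> //.
  by rewrite b2 a2 (le_trans (resolv_le _ _ _))// resolv_le.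
- by move=> y y2; exact: resolv_mul.
- exact: normr_ge0.
have k0 : (0 : R) < 2 ^+ k by rewrite exprn_gt0.
have -> : `|a * b| = `|s * t| / 2 ^+ k / 2 ^+ k.
  rewrite /a /b (_ : _ * _ = s * t / 2 ^+ k / 2 ^+ k); last by ring.
  by rewrite 2!normrM normrV ?unitfE ?gt_eqF// (ger0_norm (ltW k0)).
rewrite natrX exprVn le_eqVlt; apply/orP; left; apply/eqP.
by field; rewrite gt_eqF.
Qed.

Lemma tends_shift (u v : nat -> H) l (c : R) : tends u l ->
  (forall n, rnorm (v n - u n) <= c * 2^-1 ^+ n) -> 0 <= c -> tends v l.
Proof.
move=> ul vu c0 e e0; have e2 : 0 < e / 2 by lra.
have h0 : 0 < e / 2 / (c + 1) by rewrite divr_gt0//; lra.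
have [N _ NN] := near_infty_natSinv_expn_lt (PosNum h0).
have [M uM] := ul _ e2; exists (N + M)%N => n NMn.
have := uM n (leq_trans (leq_addl _ _) NMn).
have /= := NN n (leq_trans (leq_addr _ _) NMn).
have := rnorm_triangle (u n) (v n) l; have := vu n.
rewrite -exprVn ltr_pdivlMr; last by lra.
have : 0 <= (2^-1 : R) ^+ n by exact: exprn_ge0.
move: (2^-1 ^+ n) => r; nra.
Qed.

Lemma tends_euler s t f : tends (fun k => euler s k (euler t k f)) (U s (U t f)).
Proof.
move=> e e0; have e2 : 0 < e / 2 by lra.
have [N uN] := grpP t f e2; have [M vM] := grpP s (U t f) e2.
exists (N + M)%N => n NMn.
have := uN n (leq_trans (leq_addr _ _) NMn).
have := vM n (leq_trans (leq_addl _ _) NMn).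
have := euler_le s n (euler t n f - U t f); rewrite eulerB.
have := rnorm_triangle (euler s n (U t f)) (euler s n (euler t n f)) (U s (U t f)).
lra.
Qed.

Lemma grpD s t f : U (s + t) f = U s (U t f).
Proof.
have main g : dom2 A g -> U (s + t) g = U s (U t g).
  move=> g2; apply: (tends_unique _ (tends_euler s t g)).
  have h := @tends_shift _ (fun k => euler s k (euler t k g)) _
    (`|s * t| * rnorm (A (A g))) (grpP (s + t) g).
  apply: h => [n|]; first by rewrite rnorm_distC; exact: euler_add.
  by rewrite mulr_ge0 ?rnorm_ge0.
apply/eqP; rewrite -subr_eq0 -rnorm_eq0 eq_le rnorm_ge0 andbT.
apply/ler_addgt0Pr => e e0; rewrite add0r; have e2 : 0 < e / 2 by lra.
have [g g2 fg] := dom2_dense A f e2.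
have := rnorm_triangle (U (s + t) g) (U (s + t) f) (U s (U t f)).
have := grp_le (s + t) (f - g); rewrite grpB (main _ g2).
have := grp_le s (U t g - U t f); rewrite grpB.
have := grp_le t (g - f); rewrite grpB.
rewrite (rnorm_distC g f); lra.
Qed.

Lemma grpK t f : U (- t) (U t f) = f.
Proof. by rewrite -grpD addNr grp0. Qed.

Lemma grpKV t f : U t (U (- t) f) = f.
Proof. by rewrite -grpD subrr grp0. Qed.

(** Contractivity holds for both signs of t, and U(-t) inverts U(t). *)
Lemma rnorm_grp t f : rnorm (U t f) = rnorm f.
Proof.
by apply/le_anti; rewrite grp_le/= -[in leLHS](grpK t f) grp_le.
Qed.

(** The Euler approximations commute with A on D(A), so closedness of A applies to their limit. *)
Lemma grp_dom t f : dom A f -> dom A (U t f) /\ A (U t f) = U t (A f).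
Proof.
move=> Af.
have d k := iter_resolv_dom (t / 2 ^+ k) (2 ^ k) Af.
apply: (op_closed (fun k => (d k).1) (grpP t f)).
have := grpP t (A f); congr tends; apply/funext => k.
by rewrite (d k).2.
Qed.

Lemma hdot_isometry (V : H -> H) f g :
  (forall (c : R[i]) x y, V (c *: x + y) = c *: V x + V y) ->
  (forall x, rnorm (V x) = rnorm x) -> hdot H (V f) (V g) = hdot H f g.
Proof.
move=> Vl Vn.
have ReV x y : complex.Re (hdot H (V x) (V y)) = complex.Re (hdot H x y).
  rewrite !Re_polarization ![_ + (-1) *: _]addrC -!Vl Vn.
  by rewrite -[V x + _]add0r -[V x]scale1r add0r -Vl Vn scale1r.
apply: complex_eq; first exact: ReV.
have V0 : V 0 = 0.
  by have := Vl 1 0 0; rewrite !scale1r addr0 => /eqP;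
    rewrite -[X in X == _]addr0 (inj_eq (addrI _)) eq_sym => /eqP.
rewrite !Im_polarization -[RHS]ReV; congr (complex.Re (hdot H _ _)).
by rewrite -['i *: g]addr0 Vl V0 addr0.
Qed.

Lemma grp_adj t f g : hdot H (U t f) g = hdot H f (U (- t) g).
Proof.
rewrite -{1}[g](grpKV t); apply: hdot_isometry => [c x y|x].
  exact: grp_lin.
exact: rnorm_grp.
Qed.

Lemma grp_lip t f : dom A f -> rnorm (U t f - f) <= `|t| * rnorm (A f).
Proof.
move=> Af; apply: (tends_le (grpP t f)) => k.
apply: le_trans (iter_resolv_near _ _ Af) _.
have k0 : (0 : R) < 2 ^+ k by rewrite exprn_gt0.
rewrite mulrA ler_wpM2r ?rnorm_ge0// natrX normrM normrV ?unitfE ?gt_eqF//.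
by rewrite (ger0_norm (ltW k0)) mulrC divfK ?gt_eqF.
Qed.

(** Comparison with the single Euler step J_t f, which differs from U(t) f by at most t^2 / 2 |A^2
    f| and whose own first-order remainder is i t (J_t - 1) A f. *)
Lemma grp_taylor2 t f : dom2 A f ->
  rnorm (U t f - f - (t%:C * 'i) *: A f) <= 2 * t ^+ 2 * rnorm (A (A f)).
Proof.
move=> f2.
have h1 : rnorm (U t f - J t f) <= t ^+ 2 / 2 * rnorm (A (A f)).
  apply: (tends_le (grpP t f)) => k.
  have := euler_dist t 0 k f2; rewrite expr0 mulr1 rnorm_distC.
  by rewrite [euler t 0 f]/euler /= expr0 divr1.
have e1 : J t f - f - (t%:C * 'i) *: A f = (t%:C * 'i) *: (J t (A f) - A f).
  rewrite scalerBr; congr (_ - _).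
  by rewrite -[X in _ - X](resolvKr t f2.1) opprB addrC subrK.
have h2 : rnorm (J t f - f - (t%:C * 'i) *: A f) <= t ^+ 2 * rnorm (A (A f)).
  rewrite e1 rnormZc cabsM cabsi mulr1 cabsC -[t ^+ 2]real_normK ?num_real//.
  by rewrite expr2 -mulrA ler_wpM2l//; apply: resolv_near; case: f2.
have := rnorm_triangle (J t f - f - (t%:C * 'i) *: A f)
  (U t f - f - (t%:C * 'i) *: A f) 0.
rewrite !subr0 (_ : _ - _ - (_ - _ - _) = U t f - J t f); last first.
  by rewrite -[U t f - f - _]addrA -[J t f - f - _]addrA opprD addrACA subrr addr0.
have := sqr_ge0 t; have := rnorm_ge0 (A (A f)).
set n1 := rnorm (A (A f)) in h1 h2 *; nra.
Qed.

(** Approximation of f by g in [dom2] in the graph norm: the second-order estimate handles g, the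
    Lipschitz bound [grp_lip] handles f - g. *)
Lemma grp_taylor f e : dom A f -> 0 < e -> exists2 d, 0 < d &
  forall t, `|t| < d -> rnorm (U t f - f - (t%:C * 'i) *: A f) <= e * `|t|.
Proof.
move=> Af e0; have e4 : 0 < e / 4 by lra.
have [g [g2 fg Afg]] := dom2_approx e4 Af.
pose c := rnorm (A (A g)).
have c0 : 0 <= c by exact: rnorm_ge0.
have d0 : 0 < e / 4 / (2 * c + 1) by rewrite divr_gt0//; lra.
exists (e / 4 / (2 * c + 1)) => // t; rewrite ltr_pdivlMr; last by lra.
move=> td.
have h1 := grp_lip t (domB Af g2.1); rewrite opB// in h1; last by case: g2.
have h2 := grp_taylor2 t g2; rewrite -/c in h2.
have h3 : rnorm ((t%:C * 'i) *: (A f - A g)) = `|t| * rnorm (A f - A g).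
  by rewrite rnormZc cabsM cabsi mulr1 cabsC.
have -> : U t f - f - (t%:C * 'i) *: A f = (U t (f - g) - (f - g)) +
   (U t g - g - (t%:C * 'i) *: A g) - (t%:C * 'i) *: (A f - A g).
  rewrite grpB scalerBr; move: (U t f) (U t g) (_ *: A f) (_ *: A g).
  move=> p q r s; have -> : p - q - (f - g) = (p - f) - (q - g).
    by rewrite opprD addrACA -opprD.
  by rewrite addrA subrK opprB addrA subrK.
rewrite (le_trans (rnormB _ _))// h3.
have := rnormD (U t (f - g) - (f - g)) (U t g - g - (t%:C * 'i) *: A g).
have := normr_ge0 t; rewrite -[t ^+ 2]real_normK ?num_real// in h2.
set n := `|t| in td h1 h2 h3 *; nra.
Qed.

Lemma grp_cvg f e : 0 < e -> exists2 d, 0 < d &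
  forall t, `|t| < d -> rnorm (U t f - f) < e.
Proof.
move=> e0; have e3 : 0 < e / 3 by lra.
have [g Ag fg] := dom_approx A f e3.
have d0 : 0 < e / 3 / (rnorm (A g) + 1).
  by rewrite divr_gt0// ltr_wpDl// rnorm_ge0.
exists (e / 3 / (rnorm (A g) + 1)) => // s.
rewrite ltr_pdivlMr; last by rewrite ltr_wpDl// rnorm_ge0.
have := grp_lip s Ag; have := grp_le s (f - g); rewrite grpB.
have := rnorm_triangle (U s g) (U s f) f; have := rnorm_triangle g (U s g) f.
rewrite (rnorm_distC g f); have := normr_ge0 s; nra.
Qed.

End group.

(** * Test functions and weak derivatives *)

Section smooth.
Context {R : realType}.
Implicit Types (f g : R -> R) (p q : {poly R}) (t x a b : R).

(** The recursion passes to the derivative of f, so closure under sums, products and affine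
    substitutions follows by induction on n. *)
Fixpoint differentiable_upto (n : nat) f : Prop :=
  (forall t, derivable f t 1) /\
  (if n is m.+1 then differentiable_upto m (derive1 f) else True).

Lemma differentiable_uptoW n f : differentiable_upto n.+1 f ->
  differentiable_upto n f.
Proof.
elim: n f => [|n IH] f [df dn]; first by split.
by split=> //; apply: IH.
Qed.

Definition smooth f := forall n, differentiable_upto n f.

Lemma smooth_derivable f : smooth f ->
  forall n t, derivable (derive1n n f) t 1.
Proof.
move=> sf n; have := sf n; elim: n f {sf} => [|n IH] f [df dn] t.
  exact: df.
by rewrite derive1Sn; exact: IH.
Qed.

Lemma smooth_derive1 f : smooth f -> smooth (derive1 f).
Proof. by move=> sf n; have [] := sf n.+1. Qed.

Lemma smooth_continuous f : smooth f -> continuous f.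
Proof.
move=> /(_ 0%N)[df _] t; apply: differentiable_continuous.
exact/derivable1_diffP.
Qed.

Lemma smooth_der f t : smooth f -> derivable f t 1.
Proof. by move=> /(_ 0%N)[]. Qed.

Lemma derive1_is_derive f f' : (forall t, is_derive t 1 f (f' t)) ->
  derive1 f = f'.
Proof.
by move=> ff'; apply/funext => t; rewrite derive1E; case: (ff' t).
Qed.

Lemma derivable_is_derive1 f t : derivable f t 1 ->
  is_derive t 1 f (derive1 f t).
Proof. by move=> df; apply: DeriveDef => //; rewrite derive1E. Qed.

Lemma is_derive_eps f x (l : R) : (forall e, 0 < e -> exists2 d, 0 < d &
  forall h, `|h| < d -> `|f (x + h) - f x - h * l| <= e * `|h|) ->
  is_derive x 1 f l.
Proof.
move=> fP.
have dl : (fun h => h^-1 *: (f (h *: 1 + x) - f x)) @ 0^' --> l.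
  apply/cvgrPdist_le => e /fP[d d0 dP].
  near=> h.
  have h0 : h != 0 by near: h; exact: nbhs_dnbhs_neq.
  have hd : `|h| < d.
    near: h; exact: dnbhs0_lt.
  rewrite /GRing.scale/= mulr1 (addrC h).
  have := dP _ hd; rewrite -(@ler_pM2l _ (`|h|^-1)) ?invr_gt0 ?normr_gt0//.
  rewrite [X in _ <= X]mulrCA mulVf ?normr_eq0// mulr1 -normfV -normrM distrC.
  by apply: le_trans; rewrite le_eqVlt; apply/orP; left; apply/eqP;
    congr `|_|; field.
have df : derivable f x 1 by apply/cvg_ex; exists l.
by apply: DeriveDef => //; exact: cvg_lim dl.
Unshelve. all: by end_near. Qed.

Lemma differentiable_uptoD n f g : differentiable_upto n f ->
  differentiable_upto n g -> differentiable_upto n (f + g).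
Proof.
elim: n f g => [|n IH] f g [df dn] [dg dm].
  by split=> [t|//]; exact: derivableD.
split=> [t|]; first exact: derivableD.
suff -> : derive1 (f + g) = derive1 f + derive1 g by exact: IH.
by apply: derive1_is_derive => t; apply: is_deriveD;
  exact: derivable_is_derive1.
Qed.

Lemma differentiable_uptoM n f g : differentiable_upto n f ->
  differentiable_upto n g -> differentiable_upto n (f * g).
Proof.
elim: n f g => [|n IH] f g hf hg.
  by case: hf hg => [df _] [dg _]; split=> [t|//]; exact: derivableM.
case: (hf) (hg) => [df dn] [dg dm].
split=> [t|]; first exact: derivableM.
suff -> : derive1 (f * g) = f * derive1 g + g * derive1 f.
  by apply: differentiable_uptoD; apply: IH => //; exact: differentiable_uptoW.
by apply: derive1_is_derive => t; apply: is_deriveM;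
  exact: derivable_is_derive1.
Qed.

Lemma differentiable_uptoZ n c f : differentiable_upto n f ->
  differentiable_upto n (c *: f).
Proof.
elim: n f => [|n IH] f [df dn].
  by split=> [t|//]; exact: derivableZ.
split=> [t|]; first exact: derivableZ.
suff -> : derive1 (c *: f) = c *: derive1 f by exact: IH.
by apply: derive1_is_derive => t; apply: is_deriveZ;
  exact: derivable_is_derive1.
Qed.

Lemma smoothM f g : smooth f -> smooth g -> smooth (f * g).
Proof. by move=> sf sg n; exact: differentiable_uptoM. Qed.

Lemma smoothB f g : smooth f -> smooth g -> smooth (f - g).
Proof.
move=> sf sg n; apply: differentiable_uptoD => //.
by rewrite -scaleN1r; exact: differentiable_uptoZ.
Qed.

Lemma is_derive_affine f c d t df : is_derive (c * t + d) 1 f df ->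
  is_derive t 1 (fun x => f (c * x + d)) (c * df).
Proof.
move=> fd.
have ga : is_derive t 1 (fun x : R => c * x + d) c.
  have -> : (fun x : R => c * x + d) = c \*: id + cst d by [].
  by apply: is_derive_eq; rewrite addr0 /GRing.scale/= mulr1.
have := @is_derive1_comp R f (fun x => c * x + d) t df c fd ga.
by rewrite mulrC.
Qed.

Lemma smooth_affine f c d : smooth f -> smooth (fun x => f (c * x + d)).
Proof.
move=> sf n; have := sf n; elim: n f {sf} => [|n IH] f [df dn].
  split=> [t|//].
  by case: (is_derive_affine (derivable_is_derive1 (df (c * t + d)))).
have h t := is_derive_affine (derivable_is_derive1 (df (c * t + d))).
split=> [t|]; first by case: (h t).
rewrite (derive1_is_derive h).
exact: (differentiable_uptoZ c (IH _ dn)).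
Qed.

Lemma poly_growth p : exists C N, forall x, 1 <= x -> `|p.[x]| <= C * x ^+ N.
Proof.
elim/poly_ind: p => [|p c [C [N IH]]].
  by exists 0, 0%N => x _; rewrite horner0 normr0 mul0r.
exists (C + `|c|), N.+1 => x x1; rewrite hornerMXaddC.
have x0 : 0 <= x by lra.
rewrite (le_trans (ler_normD _ _))// mulrDl lerD//.
  by rewrite normrM (ger0_norm x0) exprSr mulrA ler_wpM2r// IH.
by rewrite ler_peMr// exprn_ege1.
Qed.

(* This family is closed under differentiation, hence consists of smooth functions. *)
Definition flat p x := if 0 < x then p.[x^-1] * expR (- x^-1) else 0.

(** With y = 1 / x the exponential beats every power of y. The quadratic bound in x is what gives
    [flat p] derivative 0 at the origin. *)
Lemma flat_le p : exists C, forall x, 0 < x -> x <= 1 ->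
  `|flat p x| <= C * x ^+ 2.
Proof.
have [C [N pN]] := poly_growth p.
pose M := (N.+2)`!%:R : R.
exists (`|C| * M) => x x0 x1; rewrite /flat x0 normrM.
set y := x^-1; have y1 : 1 <= y by rewrite /y invf_ge1.
have y0 : 0 <= y by lra.
have /ltW ey : 0 < expR (- y) by exact: expR_gt0.
rewrite (ger0_norm ey).
have M0 : 0 < M by rewrite ltr0n fact_gt0.
(* One term of the exponential series. The exponent N + 2 covers the growth y^N of p and the factor
   y^2 that becomes x^2. *)
have h : y ^+ N.+2 <= M * expR y.
  have := expR_ge1Dxn N.+1 y0; rewrite -/M => h1.
  by rewrite mulrC -ler_pdivrMr//; apply: le_trans h1; rewrite lerDr.
have -> : x = y^-1 by rewrite /y invrK.
have yy : 0 < y ^+ 2 by rewrite exprn_gt0//; lra.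
rewrite exprVn ler_pdivlMr// expRN.
apply: (@le_trans _ _ (C * y ^+ N / expR y * y ^+ 2)).
  by rewrite ler_wpM2r ?sqr_ge0// ler_wpM2r ?invr_ge0 ?expR_ge0// pN.
rewrite mulrAC ler_pdivrMr ?expR_gt0// -mulrA -exprD addn2.
apply: (@le_trans _ _ (`|C| * y ^+ N.+2)).
  by rewrite ler_wpM2r ?exprn_ge0// ler_norm.
by rewrite -mulrA ler_wpM2l.
Qed.

Lemma is_derive_flat p x : is_derive x 1 (flat p) (flat ('X^2 * (p - p^`())) x).
Proof.
have [x0|x0|->] := ltgtP x 0.
- apply: (@near_eq_is_derive _ _ _ (cst 0)) => //.
  + near=> y; rewrite /flat ifF//; apply/negbTE; rewrite -leNgt ltW//.
    near: y; exact: lt_nbhsl.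
  + rewrite /flat ifF; first exact: is_derive_cst.
    by apply/negbTE; rewrite -leNgt ltW.
- apply: (@near_eq_is_derive R R R (fun y : R => p.[y^-1] * expR (- y^-1))) => //.
  + near=> y; rewrite /flat ifT//; near: y; exact: lt_nbhsr.
  + rewrite /flat x0.
    have xn0 : x != 0 by rewrite gt_eqF.
    have iv : is_derive x 1 (fun y : R => y^-1) (- x ^- 2).
      have := @is_deriveV _ (@id R) x 1 1 xn0 (is_derive_id _ _).
      by rewrite /GRing.scale/= mulr1.
    have h1 := @is_derive1_comp R (fun y => p.[y]) (fun y => y^-1) x _ _
      (is_derive_poly _ _) iv.
    have iv' : is_derive x 1 (fun y : R => - y^-1) (x ^- 2).
      by rewrite -[x ^- 2]opprK; exact: is_deriveN.
    have h2 := @is_derive1_comp R expR (fun y => - y^-1) x _ _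
      (is_derive_expR _) iv'.
    have := is_deriveM h1 h2.
    move=> /is_derive_eq; apply.
    rewrite /GRing.scale/= !hornerE/= !derivE; rewrite exprVn; ring.
- rewrite [flat (_ * _) 0]/flat ltxx.
  have [C hC] := flat_le p.
  apply: is_derive_eps => e e0.
  have C1 : 0 < `|C| + 1 by rewrite ltr_wpDl.
  exists (Num.min 1 (e / (`|C| + 1))); first by rewrite lt_min ltr01 divr_gt0.
  move=> h; rewrite lt_min => /andP[h1 h2].
  rewrite [flat p 0]/flat ltxx mulr0 !subr0 add0r.
  have [h0|h0] := leP h 0.
    rewrite /flat ifF; last by apply/negbTE; rewrite -leNgt.
    by rewrite normr0 mulr_ge0// ltW.
  rewrite gtr0_norm// in h1 h2 *.
  apply: le_trans (hC _ h0 (ltW h1)) _.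
  move: h2; rewrite ltr_pdivlMr// => h2.
  rewrite expr2 mulrA ler_wpM2r ?(ltW h0)//.
  have := ler_norm C; nra.
Unshelve. all: by end_near. Qed.

Lemma smooth_flat p : smooth (flat p).
Proof.
move=> n; elim: n p => [|n IH] p.
  by split=> // t; case: (is_derive_flat p t).
split=> [t|]; first by case: (is_derive_flat p t).
by rewrite (derive1_is_derive (is_derive_flat p)); exact: IH.
Qed.

(** On ]a, b[ this is exp(-1/((n+1)(x-a)) - 1/((n+1)(b-x))): smooth bumps that increase to the
    indicator of ]a, b[ with n. *)
Definition cutoff a b n x : R :=
  flat 1 (n.+1%:R * (x - a)) * flat 1 (n.+1%:R * (b - x)).

Lemma smooth_cutoff a b n : smooth (cutoff a b n).
Proof.
have := smoothM (smooth_affine n.+1%:R (- (n.+1%:R * a)) (smooth_flat 1))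
  (smooth_affine (- n.+1%:R) (n.+1%:R * b) (smooth_flat 1)).
congr smooth; apply/funext => x; rewrite /cutoff mulrfctE.
by congr (flat _ _ * flat _ _); ring.
Qed.

Lemma flat1_ge0 x : 0 <= flat 1 x.
Proof. by rewrite /flat; case: ifP => // _; rewrite hornerC mul1r expR_ge0. Qed.

Lemma flat1_le1 x : flat 1 x <= 1.
Proof.
rewrite /flat; case: ifPn => // x0; rewrite hornerC mul1r -expR0 ler_expR.
by rewrite lerNl oppr0 invr_ge0 ltW.
Qed.

Lemma cutoff_ge0 a b n x : 0 <= cutoff a b n x.
Proof. by rewrite mulr_ge0// flat1_ge0. Qed.

Lemma cutoff_le1 a b n x : cutoff a b n x <= 1.
Proof. by rewrite mulr_ile1 ?flat1_ge0 ?flat1_le1. Qed.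

Lemma cutoff_out a b n x : ~ (a < x < b) -> cutoff a b n x = 0.
Proof.
move=> /negP; rewrite negb_and -!leNgt /cutoff /flat => /orP[xa|bx].
  rewrite ifF ?mul0r//; apply/negbTE; rewrite -leNgt pmulr_rle0//; lra.
rewrite [X in _ * X]ifF ?mulr0//; apply/negbTE; rewrite -leNgt pmulr_rle0//; lra.
Qed.

Lemma cutoff_shift a b n h x : cutoff a b n (x - h) = cutoff (a + h) (b + h) n x.
Proof. by rewrite /cutoff; congr (flat _ _ * flat _ _); ring. Qed.

Lemma cutoff_cvg a b x : a < x < b -> cutoff a b ^~ x @ \oo --> (1 : R).
Proof.
move=> /andP[ax xb].
have h (y : R) : 0 < y -> flat 1 (n.+1%:R * y) @[n --> \oo] --> (1 : R).
  move=> y0; have -> : (fun n => flat 1 (n.+1%:R * y)) =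
      (fun n => expR (- (n.+1%:R^-1 * y^-1))).
    apply/funext => n; rewrite /flat ifT; last by rewrite mulr_gt0.
    by rewrite hornerC mul1r invfM.
  rewrite -[X in _ --> X]expR0; apply: continuous_cvg; first exact: continuous_expR.
  rewrite -[X in _ --> X]oppr0 -(mul0r y^-1); apply: cvgN.
  apply: cvgMl; exact: cvg_harmonic.
rewrite -[X in _ --> X](mulr1 1); apply: cvgM; apply: h; lra.
Qed.
End smooth.

(** * The fundamental lemma of the calculus of variations *)

Section du_bois_reymond.
Context {R : realType}.
Local Notation mu := (@lebesgue_measure R).
Implicit Types (F K : R -> R) (I : interval R) (a b c d h x y : R).

Lemma eq_Rintegral_supp (A B : set R) F : B `<=` A ->
  (forall x, A x -> ~ B x -> F x = 0) ->
  \int[mu]_(x in A) F x = \int[mu]_(x in B) F x.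
Proof.
move=> BA F0; rewrite Rintegral_mkcond [RHS]Rintegral_mkcond.
apply: eq_Rintegral => x _; rewrite !patchE.
case: ifPn => [|/negP]; rewrite inE => Ax.
  case: ifPn => // /negP; rewrite inE => nBx; exact: F0.
by case: ifPn => //; rewrite inE => /BA.
Qed.

Lemma integrable_bounded_mul (A : set R) F (phi : R -> R) (M : R) :
  @measurable _ (measurableTypeR R) A ->
  measurable_fun A phi -> (forall x, A x -> `|phi x| <= M) ->
  mu.-integrable A (EFin \o F) ->
  mu.-integrable A (EFin \o (fun x => phi x * F x)).
Proof.
move=> mA mphi phiM iF.
have iFM := integrableZl mA M iF.
apply: (le_integrable mA _ _ iFM) => [|x Ax /=].
  apply/measurable_EFinP; apply: measurable_funM => //.
  apply/measurable_EFinP; exact: (measurable_int mu iF).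
rewrite lee_fin !normrM ler_wpM2r//.
by rewrite (le_trans (phiM _ Ax))// ler_norm.
Qed.

Lemma test_cutoff I a b n : `[a, b] `<=` [set` I] -> test_function I (cutoff a b n).
Proof.
move=> abI; split.
  by move=> k t; apply: smooth_derivable; exact: smooth_cutoff.
exists [set` `[a, b]]; split => //; first exact: segment_compact.
move=> t /= tab; apply: cutoff_out => /andP[ta tb]; apply: tab.
by rewrite in_itv/= !ltW.
Qed.

Lemma integral_cutoff_cvg (A : set R) F a b : `]a, b[ `<=` A ->
  mu.-integrable `]a, b[ (EFin \o F) ->
  \int[mu]_(x in A) (cutoff a b n x * F x) @[n --> \oo] -->
  \int[mu]_(x in `]a, b[) F x.
Proof.
move=> abA iF.
have mF : measurable_fun `]a, b[ F by apply/measurable_EFinP; exact: (measurable_int mu iF).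
have mb n : measurable_fun `]a, b[ (cutoff a b n).
  apply: measurable_funTS; apply: continuous_measurable_fun.
  by apply: smooth_continuous; exact: smooth_cutoff.
have ib n : mu.-integrable `]a, b[ (EFin \o (fun x => cutoff a b n x * F x)).
  apply: (@integrable_bounded_mul _ _ _ 1) => // x _.
  by rewrite ger0_norm ?cutoff_le1 ?cutoff_ge0.
have iFa : mu.-integrable `]a, b[ (fun x => `|(F x)%:E|%E).
  exact: (integrable_abse iF).
have [] := @dominated_convergence _ _ _ mu `]a, b[ (measurable_itv _)
  (fun n x => (cutoff a b n x * F x)%:E) (EFin \o F) (fun x => `|(F x)%:E|%E).
- by move=> n; exact: (measurable_int mu (ib n)).
- exact: (measurable_int mu iF).
- apply: aeW => x; rewrite /= in_itv/= => xab.
  apply: cvg_EFin; first by near=> n.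
  rewrite -[X in _ --> X]mul1r; apply: cvgMl; exact: cutoff_cvg.
- exact: iFa.
- apply: aeW => x n _; rewrite lee_fin normrM.
  by rewrite ler_piMl// ger0_norm ?cutoff_le1 ?cutoff_ge0.
move=> _ _ h.
have h' : \int[mu]_(x in `]a, b[) (cutoff a b n x * F x) @[n --> \oo] -->
    \int[mu]_(x in `]a, b[) F x.
  apply: fine_cvg; rewrite /Rintegral fineK; first exact: h.
  exact: integrable_fin_num.
apply: cvg_trans h'; apply: near_eq_cvg; near=> n.
apply/esym/eq_Rintegral_supp => // x _ /=; rewrite in_itv/= => /negP nx.
by rewrite cutoff_out ?mul0r//; exact/negP.
Unshelve. all: by end_near. Qed.

Lemma integral_eq0_cutoff I F a b : `[a, b] `<=` [set` I] ->
  mu.-integrable `]a, b[ (EFin \o F) ->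
  (forall phi, test_function I phi ->
    \int[mu]_(x in [set` I]) (phi x * F x) = 0) ->
  \int[mu]_(x in `]a, b[) F x = 0.
Proof.
move=> abI iF F0.
have sub : `]a, b[ `<=` [set` I].
  by apply: subset_trans abI; apply: subset_itv; rewrite bnd_simp.
have := integral_cutoff_cvg sub iF.
under eq_fun do rewrite (F0 _ (test_cutoff _ abI)).
by move=> /(cvg_unique (@Rhausdorff R) (cvg_cst _)) <-.
Qed.

(** The primitive from -oo of F cut off to ]c, d[ takes at x the value of the integral over ]c,
    min(x, d)[, hence vanishes identically; Lebesgue differentiation returns the function almost
    everywhere. *)
Lemma ae_eq0_interval F c d : mu.-integrable `]c, d[ (EFin \o F) ->
  (forall a b, c <= a -> b <= d -> \int[mu]_(x in `]a, b[) F x = 0) ->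
  \forall x \ae mu, c < x < d -> F x = 0.
Proof.
move=> iF F0; pose G := F \_ `]c, d[.
have iG : mu.-integrable setT (EFin \o G).
  by rewrite /G -restrict_EFin; apply/integrable_restrict => //=; rewrite setTI.
have G0 x : \int[mu]_(t in `]-oo, x]) G t = 0.
  pose m := Num.min x d.
  have iGm : mu.-integrable `]c, m[ (EFin \o F).
    apply: integrableS iF => //; apply: subset_itvl.
    by rewrite bnd_simp ge_min lexx orbT.
  have <- : \int[mu]_(t in `]c, m[) F t = 0.
    by apply: F0; rewrite // ge_min lexx orbT.
  rewrite -Rintegral_itv_bndo_bndc; last exact: integrableS iG.
  rewrite (@eq_Rintegral_supp _ `]c, m[).
  - by apply: eq_Rintegral => t; rewrite inE/= in_itv/= /G patchE => /andP[ct];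
      rewrite lt_min => /andP[_ td]; rewrite ifT// inE/= in_itv/= ct.
  - by move=> t /=; rewrite !in_itv/= lt_min => /and3P[].
  - move=> t /=; rewrite !in_itv/= lt_min /G patchE => tx /negP.
    case: ifPn => //; rewrite inE/= in_itv/= => /andP[-> ->].
    by rewrite tx.
have locG : locally_integrable setT G.
  by apply: open_integrable_locally => //; exact: openT.
have iGy y : mu.-integrable `]-oo, y] (EFin \o G) by exact: integrableS iG.
have := FTC1Ny iGy locG.
apply: filterS => x [_ Gx] xcd.
move: Gx; rewrite (_ : (fun _ => _) = cst 0); last first.
  by apply/funext => y; rewrite G0.
by rewrite derive1_cst /G patchE ifT// inE/= in_itv.
Qed.

(** An open set is covered by the rational segments it contains. They are enumerated by codes of
    pairs of rationals, so that countably many null sets are combined. *)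
Lemma ae_eq0_open (D : set R) F : open D ->
  (forall a b, `[a, b] `<=` D -> mu.-integrable `]a, b[ (EFin \o F)) ->
  (forall a b, `[a, b] `<=` D -> \int[mu]_(x in `]a, b[) F x = 0) ->
  \forall x \ae mu, D x -> F x = 0.
Proof.
move=> oD iF F0.
pose P (n : nat) x := if @unpickle (rat * rat)%type n is Some (p, q) then
  `[ratr p, ratr q] `<=` D -> (ratr p : R) < x < ratr q -> F x = 0 else True.
have /ae_foralln : forall n, \forall x \ae mu, P n x.
  move=> n; rewrite /P; case: unpickle => [[p q]|]; last exact: aeW.
  have [sD|nD] := pselect (`[(ratr p : R), ratr q] `<=` D); last exact: aeW.
  have := @ae_eq0_interval F (ratr p) (ratr q) (iF _ _ sD).
  move=> h; have {h} : \forall x \ae mu, (ratr p : R) < x < ratr q -> F x = 0.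
    apply: h => a b pa bq; have [ab|ba] := ltP a b; last first.
      by rewrite set_itv_ge ?Rintegral_set0// bnd_simp -leNgt.
    by apply: F0; apply: subset_trans sD; apply: subset_itv; rewrite bnd_simp.
  by apply: filterS => x h _.
apply: filterS => x h Dx.
have /nbhs_ballP[e /= e0 eD] := open_nbhs_nbhs (conj oD Dx).
have [p /andP[xp px]] : exists p : rat, x - e < ratr p < x.
  by have [p] := @rat_in_itvoo R (x - e) x ltac:(lra); rewrite in_itv/=; exists p.
have [q /andP[xq qx]] : exists q : rat, x < ratr q < x + e.
  by have [q] := @rat_in_itvoo R x (x + e) ltac:(lra); rewrite in_itv/=; exists q.
have := h (pickle (p, q)); rewrite /P pickleK; apply; last first.
  by rewrite px xq.
move=> t; rewrite /= in_itv/= => /andP[pt tq]; apply: eD.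
by rewrite ball_itv/= in_itv/=; apply/andP; split; lra.
Qed.
End du_bois_reymond.

(** * A continuous weak derivative is a classical derivative *)

Section weak_derivative.
Context {R : realType}.
Local Notation mu := (@lebesgue_measure R).
Implicit Types (F K : R -> R) (I : interval R) (a b c d h x y e t r : R).

Lemma integrable_within F c d a b : {within `[c, d], continuous F} ->
  c <= a -> b <= d -> mu.-integrable `]a, b[ (EFin \o F).
Proof.
move=> cF ca bd.
have iF : mu.-integrable `[c, d] (EFin \o F).
  by apply: continuous_compact_integrable => //; exact: segment_compact.
by apply: integrableS iF => //; apply: subset_itv; rewrite bnd_simp.
Qed.

Lemma continuous_inner F c d x : {within `[c, d], continuous F} -> c < x < d ->
  {for x, continuous F}.
Proof.
move=> cF /andP[cx xd]; have cd : c < d := lt_trans cx xd.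
by move/(continuous_within_itvP _ cd) : cF => [+ _ _]; apply; rewrite in_itv/= cx.
Qed.

Lemma derivable_LR F a b : (forall t, a <= t <= b -> derivable F t 1) -> a < b ->
  derivable_oo_LRcontinuous F a b.
Proof.
move=> dF ab.
have cF t : a <= t <= b -> F @ t --> F t.
  by move=> tab; apply: differentiable_continuous; apply/derivable1_diffP/dF.
split.
- by move=> t; rewrite in_itv/= => /andP[at_ tb]; apply: dF; rewrite !ltW.
- by apply: cvg_at_right_filter; apply: cF; rewrite lexx ltW.
- by apply: cvg_at_left_filter; apply: cF; rewrite lexx ltW.
Qed.

(** Near x the integrals are at least (F x - r / 2) e, near y at most (F y + r / 2) e. Only one
    inequality is stated; exchanging x and y gives equality. *)
Lemma eq_at_of_eq_integrals F c d x y (e0 : R) : {within `[c, d], continuous F} ->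
  c < x < d -> c < y < d -> 0 < e0 ->
  (forall e : R, 0 < e < e0 ->
    \int[mu]_(t in `]x, x + e[) F t = \int[mu]_(t in `]y, y + e[) F t) ->
  F x <= F y.
Proof.
move=> cF xcd ycd e00 Fe; apply/ler_addgt0Pr => r r0; have r2 : 0 < r / 2 by lra.
have nb z : c < z < d -> exists2 e : R, 0 < e & z + e <= d /\
    forall t, z < t < z + e -> `|F z - F t| < r / 2.
  move=> zcd; have /cvgrPdist_lt/(_ _ r2) := continuous_inner cF zcd.
  case/nbhs_ballP => e /= e1 eP; exists (Num.min e (d - z)).
    by rewrite lt_min e1 subr_gt0; case/andP: zcd.
  split; first by rewrite -lerBrDl ge_min lexx orbT.
  move=> t /andP[zt]; rewrite -ltrBlDl lt_min => /andP[te _]; apply: eP.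
  by rewrite /ball/= ltr_norml; apply/andP; split; lra.
have [ex ex0 [exd xP]] := nb _ xcd; have [ey ey0 [eyd yP]] := nb _ ycd.
pose e := Num.min (Num.min ex ey) (e0 / 2).
have e1 : 0 < e by rewrite !lt_min ex0 ey0/=; lra.
have ee : e < e0.
  by rewrite (@le_lt_trans _ _ (e0 / 2)) ?ge_min ?lexx ?orbT//; lra.
have eex : e <= ex by rewrite !ge_min lexx.
have eey : e <= ey by rewrite !ge_min lexx orbT.
have := Fe e; rewrite e1 ee => /(_ isT) FE.
have mz z : mu [set` `]z, z + e[] = e%:E.
  by rewrite lebesgue_measure_itv/= lte_fin ltrDl e1 -EFinD addrC addKr.
have cst z k : \int[mu]_(t in `]z, z + e[) k = k * e.
  rewrite Rintegral_cst; last exact: measurable_itv.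
  congr (_ * _); have /= -> := congr1 fine (mz z); by [].
have icst z k : mu.-integrable `]z, z + e[ (EFin \o (fun=> k)).
  apply: (@integrable_within _ z (z + e)) => //.
  by apply: continuous_subspaceT; exact: cst_continuous.
have lo : (F x - r / 2) * e <= \int[mu]_(t in `]x, x + e[) F t.
  rewrite -(cst x); apply: le_Rintegral.
  - exact: measurable_itv.
  - exact: icst.
  - apply: (integrable_within cF); first by case/andP: xcd => /ltW.
    lra.
  move=> t; rewrite /= in_itv/= => /andP[xt te].
  have := xP t; rewrite xt/= => /(_ ltac:(lra)); rewrite ltr_norml => /andP[]; lra.
have hi : \int[mu]_(t in `]y, y + e[) F t <= (F y + r / 2) * e.
  clear lo; rewrite -(cst y); apply: le_Rintegral.
  - exact: measurable_itv.
  - apply: (integrable_within cF); first by case/andP: ycd => /ltW.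
    by rewrite (le_trans _ eyd)// lerD2l.
  - exact: icst.
  move=> t; rewrite /= in_itv/= => /andP[xt te].
  have := yP t; rewrite xt/= => /(_ ltac:(lra)); rewrite ltr_norml => /andP[]; lra.
have : (F x - r / 2) * e <= (F y + r / 2) * e by rewrite (le_trans lo)// FE.
clear lo hi FE; rewrite ler_pM2r//; lra.
Qed.

Definition cutoff_prim a b n x : R :=
  \int[mu]_(t in `]-oo, x]) cutoff a b n t.

Lemma cutoff_integrable a b n (A : set R) :
  @measurable _ (measurableTypeR R) A ->
  mu.-integrable A (EFin \o cutoff a b n).
Proof.
move=> mA.
suff : mu.-integrable setT (EFin \o cutoff a b n).
  by move=> iT; exact: integrableS iT.
have -> : EFin \o cutoff a b n = (EFin \o cutoff a b n) \_ `[a, b].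
  apply/funext => x; rewrite patchE; case: ifPn => // /negP nx.
  rewrite /= cutoff_out// => /andP[ax xb]; apply: nx.
  by rewrite inE/= in_itv/= !ltW.
apply/integrable_restrict => //=; rewrite setTI.
apply: continuous_compact_integrable; first exact: segment_compact.
by apply: continuous_subspaceT; apply: smooth_continuous; exact: smooth_cutoff.
Qed.

Lemma is_derive_cutoff_prim a b n x :
  is_derive x 1 (cutoff_prim a b n) (cutoff a b n x).
Proof.
have x1 : x < x + 1 by rewrite ltrDl.
have ic : mu.-integrable [set` Interval -oo%O (BRight (x + 1))]
    (EFin \o cutoff a b n).
  by apply: cutoff_integrable; exact: measurable_itv.
have cc : {for x, continuous (cutoff a b n)}.
  exact/smooth_continuous/smooth_cutoff.
have [df fE] := continuous_FTC1 x1 ic (ltNyr _) cc.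
by apply: DeriveDef; [exact: df|rewrite -derive1E fE].
Qed.

Lemma smooth_cutoff_prim a b n : smooth (cutoff_prim a b n).
Proof.
case=> [|k]; first by split=> // t; case: (is_derive_cutoff_prim a b n t).
split=> [t|]; first by case: (is_derive_cutoff_prim a b n t).
rewrite (derive1_is_derive (is_derive_cutoff_prim a b n)).
exact: smooth_cutoff.
Qed.

Lemma cutoff_prim_left a b n x : x <= a -> cutoff_prim a b n x = 0.
Proof.
move=> xa; rewrite /cutoff_prim (@eq_Rintegral_supp _ _ set0) ?Rintegral_set0//.
move=> t /=; rewrite in_itv/= => tx _; apply: cutoff_out => /andP[at_ _].
by move: tx; rewrite leNgt (le_lt_trans xa at_).
Qed.

Lemma cutoff_prim_right a b n x : b <= x ->
  cutoff_prim a b n x = cutoff_prim a b n b.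
Proof.
move=> bx; rewrite /cutoff_prim.
rewrite (@eq_Rintegral_supp _ _ `]-oo, b])//.
  by move=> t /=; rewrite !in_itv/= => /le_trans; exact.
move=> t _ /= /negP; rewrite in_itv/= => nb; apply: cutoff_out => /andP[_ tb].
by move: nb; rewrite ltW.
Qed.

(* Idea: the test function [cutoff_prim a b n t - cutoff_prim a b n (t - h)] has
   derivative [cutoff a b n - cutoff (a + h) (b + h) n], which in the limit gives
   equality of the integrals of [F + \int K] over translated intervals. *)
Lemma weak_derivative_continuous F K c d :
  {within `[c, d], continuous F} -> {within `[c, d], continuous K} ->
  (forall phi, test_function `]c, d[ phi ->
    \int[mu]_(t in `]c, d[) (derive1 phi t * F t) =
    \int[mu]_(t in `]c, d[) (phi t * K t)) ->
  forall x, c < x < d -> is_derive x 1 F (- K x).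
Proof.
move=> cF cK FK.
(* The hypothesis says that P has weak derivative 0; the aim is that P is constant on ]c, d[. *)
pose P x := F x + parameterized_integral mu c x K.
have dK x : c < x < d -> is_derive x 1 (fun x => parameterized_integral mu c x K) (K x).
  move=> /andP[cx xd].
  have iK : mu.-integrable `[c, d] (EFin \o K).
    by apply: continuous_compact_integrable => //; exact: segment_compact.
  have cKx : {for x, continuous K} by apply: (continuous_inner cK); rewrite cx.
  have [df fE] := continuous_FTC1_closed xd iK cx cKx.
  by apply: DeriveDef; [exact: df|rewrite -derive1E fE].
have [cd|dc] := ltP c d; last by move=> x; lra.
have cP : {within `[c, d], continuous P}.
  move=> x; apply: cvgD; first exact: cF.
  apply: parameterized_integral_continuous; first exact: ltW.
  by apply: continuous_compact_integrable => //; exact: segment_compact.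
have main x y e : c < x < y -> y + e < d -> 0 < e ->
  \int[mu]_(t in `]x, x + e[) P t = \int[mu]_(t in `]y, y + e[) P t.
  move=> /andP[cx xy] yd e0; pose h := y - x.
  pose phi n : R -> R := fun t => cutoff_prim x (x + e) n t - cutoff_prim x (x + e) n (t - h).
  have sphi n : smooth (phi n).
    apply: smoothB; first exact: smooth_cutoff_prim.
    have := smooth_affine 1 (- h) (smooth_cutoff_prim x (x + e) n).
    by congr smooth; apply/funext => t; rewrite mul1r.
  have dphi n t : is_derive t 1 (phi n)
      (cutoff x (x + e) n t - cutoff y (y + e) n t).
    apply: is_deriveB; first exact: is_derive_cutoff_prim.
    have := is_derive_cutoff_prim x (x + e) n (1 * t + - h).
    move=> /is_derive_affine; rewrite mul1r cutoff_shift mul1r.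
    rewrite (_ : x + h = y); last by rewrite /h; ring.
    rewrite (_ : x + e + h = y + e); last by rewrite /h; ring.
    congr (is_derive _ _ _ _).
    by apply/funext => u; rewrite mul1r.
  have dphiE n : derive1 (phi n) = (fun t => cutoff x (x + e) n t - cutoff y (y + e) n t).
    exact: derive1_is_derive (dphi n).
  (* To the right of y + e both primitives have reached the same total mass and cancel; this is why
     a difference of translates is a test function although one primitive is not. *)
  have phi0 n t : ~ (x < t < y + e) -> phi n t = 0.
    move=> /negP; rewrite negb_and -!leNgt /phi => /orP[tx|yt].
      by rewrite !cutoff_prim_left ?subrr//; rewrite /h; lra.
    by rewrite !cutoff_prim_right ?subrr// /h; lra.
  have tphi n : test_function `]c, d[ (phi n).
    split; first exact: smooth_derivable (sphi n).
    exists [set` `[x, y + e]]; split; first exact: segment_compact.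
      by move=> t /=; rewrite !in_itv/= => /andP[xt ty]; apply/andP; split; lra.
    move=> t /= nt; apply: phi0 => /andP[xt ty]; apply: nt.
    by rewrite in_itv/= !ltW.
  have iP : mu.-integrable `]c, d[ (EFin \o P) by exact: integrable_within cP _ _.
  have iF : mu.-integrable `]c, d[ (EFin \o F) by exact: integrable_within cF _ _.
  have mcut a b n : measurable_fun `]c, d[ (cutoff a b n : R -> R).
    apply: measurable_funTS; apply: continuous_measurable_fun.
    by apply: smooth_continuous; exact: smooth_cutoff.
  have icut a b n G : mu.-integrable `]c, d[ (EFin \o G) ->
      mu.-integrable `]c, d[ (EFin \o (fun t => cutoff a b n t * G t)).
    move=> iG; apply: (@integrable_bounded_mul _ _ _ _ 1) => //.
    by move=> t _; rewrite ger0_norm ?cutoff_le1 ?cutoff_ge0.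
  have xye : x < y + e by lra.
  (* The F-part of P contributes the integral of phi K by hypothesis; integration by parts turns the
     part with the primitive of K into its opposite. *)
  have eqn n : \int[mu]_(t in `]c, d[) (derive1 (phi n) t * P t) = 0.
    pose Q t := parameterized_integral mu c t K.
    have iQ : mu.-integrable `]c, d[ (EFin \o Q).
      apply: (@integrable_within _ c d) => //.
      apply: parameterized_integral_continuous; first exact: ltW.
      by apply: continuous_compact_integrable => //; exact: segment_compact.
    have iphi G : mu.-integrable `]c, d[ (EFin \o G) ->
        mu.-integrable `]c, d[ (EFin \o (fun t => derive1 (phi n) t * G t)).
      move=> iG; rewrite dphiE.
      have := integrable_lin 1 (- 1) (measurable_itv _) (icut x (x + e) n _ iG)
        (icut y (y + e) n _ iG).
      by congr (_.-integrable _ (_ \o _)); apply/funext => t; ring.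
    transitivity (\int[mu]_(t in `]c, d[) (derive1 (phi n) t * F t) +
        \int[mu]_(t in `]c, d[) (derive1 (phi n) t * Q t)).
      rewrite -RintegralD; [|exact: measurable_itv|exact: iphi|exact: iphi].
      by apply: eq_Rintegral => t _; rewrite mulrDr.
    rewrite FK//.
    have supp G : (forall t, ~ (x < t < y + e) -> G t = 0) ->
        \int[mu]_(t in `]c, d[) G t = \int[mu]_(t in `[x, y + e]) G t.
      move=> G0; apply: eq_Rintegral_supp => [t /=|t _ /= nt].
        by rewrite !in_itv/= => /andP[xt ty]; apply/andP; split; lra.
      by apply: G0 => /andP[xt ty]; apply: nt; rewrite in_itv/= !ltW.
    rewrite !supp; last 2 first.
    - move=> t nt; rewrite dphiE !cutoff_out ?subr0 ?mul0r//.
        by move=> /andP[yt ty]; apply: nt; apply/andP; split; lra.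
      by move=> /andP[yt ty]; apply: nt; apply/andP; split; lra.
    - by move=> t nt; rewrite phi0 ?mul0r.
    rewrite (@Rintegration_by_parts _ (phi n) Q (derive1 (phi n)) K x (y + e)) //.
    - rewrite !phi0; last 2 first.
      + by rewrite ltxx.
      + by rewrite ltxx andbF.
      by rewrite !mul0r subrr sub0r addNr.
    - apply: continuous_subspaceT; apply: smooth_continuous.
      exact: smooth_derive1.
    - by apply: derivable_LR => // t _; exact: smooth_der.
    - apply: continuous_subspaceW cK => t /=; rewrite !in_itv/= => /andP[xt ty].
      by apply/andP; split; lra.
    - apply: derivable_LR => // t /andP[xt ty].
      have ctd : c < t < d by apply/andP; split; lra.
      by case: (dK _ ctd).
    - move=> t; rewrite in_itv/= => /andP[xt ty]; rewrite derive1E.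
      have ctd : c < t < d by apply/andP; split; lra.
      by case: (dK _ ctd).
  have h1 : \int[mu]_(t in `]c, d[) (cutoff x (x + e) n t * P t) @[n --> \oo] -->
      \int[mu]_(t in `]x, x + e[) P t.
    apply: integral_cutoff_cvg; last by apply: (integrable_within cP); lra.
    by apply: subset_itv; rewrite bnd_simp; lra.
  have h2 : \int[mu]_(t in `]c, d[) (cutoff y (y + e) n t * P t) @[n --> \oo] -->
      \int[mu]_(t in `]y, y + e[) P t.
    apply: integral_cutoff_cvg; last by apply: (integrable_within cP); lra.
    by apply: subset_itv; rewrite bnd_simp; lra.
  apply: (cvg_unique (@Rhausdorff R) h1); apply: cvg_trans h2.
  apply: near_eq_cvg; near=> n.
  apply/eqP; rewrite eq_sym -subr_eq0 -RintegralB; last 3 first.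
  - exact: measurable_itv.
  - exact: icut.
  - exact: icut.
  rewrite -[X in _ == X](eqn n); apply/eqP/eq_Rintegral => t _.
  by rewrite dphiE mulrBl.
move=> x0 x0cd.
have Pcst x y : c < x < y -> y < d -> P x = P y.
  move=> /andP[cx xy] yd; have xcd : c < x < d by rewrite cx (lt_trans xy).
  have ycd : c < y < d by rewrite yd (lt_trans cx).
  have d0 : 0 < d - y by rewrite subr_gt0.
  apply/le_anti/andP; split.
    apply: (eq_at_of_eq_integrals cP xcd ycd d0) => e /andP[e0 ed].
    by apply: main; rewrite ?cx//; lra.
  apply: (eq_at_of_eq_integrals cP ycd xcd d0) => e /andP[e0 ed].
  by apply/esym/main; rewrite ?cx//; lra.
(* Constancy of P gives F(t) = P(x0) - (primitive of K)(t) for t near x0, which is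
   differentiable. *)
apply: (@near_eq_is_derive R R R
    (fun t => P x0 - parameterized_integral mu c t K)).
  near=> t.
  have tcd : c < t < d.
    apply/andP; split; near: t; case/andP: (x0cd) => ? ?.
      exact: lt_nbhsr.
    exact: lt_nbhsl.
  have -> : P x0 = P t.
    have [xt|tx|->//] := ltgtP x0 t.
      by apply: Pcst; [case/andP: (x0cd) => -> _|case/andP: (tcd)].
    by apply/esym/Pcst; [case/andP: (tcd) => -> _|case/andP: (x0cd)].
  by rewrite /P addrK.
rewrite -[- K x0]add0r; apply: is_deriveB; exact: dK.
Unshelve. all: by end_near. Qed.
End weak_derivative.

(** * Weak equations in terms of the real inner product *)

Section real_inner_product.
Context {R : realType} {H : hilbertSpace R}.
Implicit Types (x y z g : H) (r : R).

(** The real part carries all the information, since Im <x, y> = Re <x, i y>; it turns vector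
    identities into real integrals. *)
Definition rdot x y : R := complex.Re (hdot H x y).

Lemma rdotC x y : rdot x y = rdot y x.
Proof. by rewrite /rdot hdotC ReJ. Qed.

Lemma rdotDl x y z : rdot (x + y) z = rdot x z + rdot y z.
Proof. by rewrite /rdot hdotDl ReD. Qed.

Lemma rdotDr x y z : rdot z (x + y) = rdot z x + rdot z y.
Proof. by rewrite !(rdotC z) rdotDl. Qed.

Lemma rdotNl x y : rdot (- x) y = - rdot x y.
Proof. by rewrite /rdot hdotNl ReN. Qed.

Lemma rdotNr x y : rdot x (- y) = - rdot x y.
Proof. by rewrite !(rdotC x) rdotNl. Qed.

Lemma rdotBl x y z : rdot (x - y) z = rdot x z - rdot y z.
Proof. by rewrite rdotDl rdotNl. Qed.

Lemma rdotBr x y z : rdot z (x - y) = rdot z x - rdot z y.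
Proof. by rewrite rdotDr rdotNr. Qed.

Lemma rdotZl r x y : rdot (r%:C *: x) y = r * rdot x y.
Proof. by rewrite /rdot hdotZl ReZ. Qed.

Lemma rdotZr r x y : rdot x (r%:C *: y) = r * rdot x y.
Proof. by rewrite !(rdotC x) rdotZl. Qed.

Lemma rdot0l x : rdot 0 x = 0.
Proof. by rewrite /rdot hdot0l. Qed.

Lemma rdot0r x : rdot x 0 = 0.
Proof. by rewrite rdotC rdot0l. Qed.

Lemma rdotii x y : rdot ('i *: x) ('i *: y) = rdot x y.
Proof.
rewrite /rdot hdotZl hdotZr mulrA; congr complex.Re.
by case: (hdot H x y) => a b; apply: complex_eq => /=; ring.
Qed.

Lemma scaleii x : 'i *: ('i *: x) = - x.
Proof. by rewrite scalerA -expr2 sqr_i scaleN1r. Qed.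

Lemma rdotil x y : rdot ('i *: x) y = - rdot x ('i *: y).
Proof. by rewrite -rdotii scaleii rdotNl. Qed.

Lemma rdotxx x : rdot x x = rnorm x ^+ 2.
Proof. exact: hdot_rnorm. Qed.

Lemma rdot_le x y : `|rdot x y| <= rnorm x * rnorm y.
Proof. exact: le_trans (ler_Re_cabs _) (hdot_le _ _). Qed.

Lemma rdot_inj x y : (forall z, rdot x z = rdot y z) -> x = y.
Proof.
move=> xy; apply: hdot_inj => z; apply: complex_eq; first exact: xy.
by rewrite !Im_polarization; exact: xy.
Qed.

Lemma complex_scaleE (a : R[i]) x :
  a *: x = (complex.Re a)%:C *: x + (complex.Im a)%:C *: ('i *: x).
Proof.
rewrite scalerA -scalerDl; congr (_ *: _).
by case: a => p q; apply: complex_eq => /=; ring.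
Qed.

(** A real-linear functional m is the real part of the conjugate-linear functional x -> m(x) + i m(i
    x), to which [riesz] applies with bound 2 C. *)
Lemma rriesz (m : H -> R) (C : R) : (forall x y, m (x + y) = m x + m y) ->
  (forall r x, m (r%:C *: x) = r * m x) ->
  (forall x, `|m x| <= C * rnorm x) -> exists y, forall x, rdot y x = m x.
Proof.
move=> mD mZ mC.
have [|x|y yP] := @riesz R H (fun x => m x +i* m ('i *: x)) (C + C).
- move=> a g h; rewrite complex_scaleE !scalerDr !mD.
  rewrite !(scalerA 'i) !(mulrC 'i) -!(scalerA _ 'i) !mZ scaleii.
  have -> : m (- g) = - m g.
    by rewrite -scaleN1r (_ : -1 = (-1)%:C) ?mZ ?mulN1r// rmorphN.
  by case: a => p q; apply: complex_eq => /=; ring.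
- have := mC x; have := mC ('i *: x); rewrite rnormZc cabsi mul1r => h1 h2.
  have -> : m x +i* m ('i *: x) = (m x)%:C + 'i * (m ('i *: x))%:C.
    by apply: complex_eq => /=; ring.
  by rewrite (le_trans (cabsD _ _))// cabsM cabsi mul1r !cabsC mulrDl lerD.
by exists y => x; rewrite /rdot yP.
Qed.

End real_inner_product.

(** * Continuity and measurability of H-valued functions *)

Section hilbert_valued.
Context {R : realType} {H : hilbertSpace R}.
Local Notation mu := (@lebesgue_measure R).
Implicit Types (u v : R -> H) (t s e d : R) (x y g : H).

Definition hcont v := forall t e, 0 < e -> exists2 d, 0 < d &
  forall s, `|s - t| < d -> rnorm (v s - v t) < e.

Lemma hcont_continuous v : hcont v -> continuous v.
Proof.
move=> vc t; apply/cvgrPdist_lt => e e0.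
have eE : e = (complex.Re e)%:C by rewrite RRe_real// realE ltW.
have [|d d0 dP] := vc t (complex.Re e); first by rewrite -ltcR -eE.
apply/nbhs_ballP; exists d => // s /=; rewrite /ball/= distrC => /dP h.
by rewrite -rnormE eE ltcR rnorm_distC.
Qed.

Lemma within_hcont (A : set R) v t e : {within A, continuous v} -> A t ->
  0 < e -> exists2 d, 0 < d &
  forall s, A s -> `|s - t| < d -> rnorm (v s - v t) < e.
Proof.
move=> /subspace_continuousP /(_ t) + At e0 => /(_ At) /cvgrPdist_lt.
move=> /(_ e%:C); rewrite ltcR => /(_ e0) /nbhs_ballP[d /= d0 dP].
exists d => // s As st; rewrite rnorm_distC -ltcR rnormE.
by apply: dP => //; rewrite /ball/= distrC.
Qed.

Lemma hcontD u v : hcont u -> hcont v -> hcont (fun t => u t + v t).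
Proof.
move=> uc vc t e e0; have e2 : 0 < e / 2 by lra.
have [d d0 dP] := uc t _ e2; have [d' d'0 d'P] := vc t _ e2.
exists (Num.min d d'); first by rewrite lt_min d0.
move=> s; rewrite lt_min => /andP[/dP h1 /d'P h2].
by rewrite opprD addrACA (le_lt_trans (rnormD _ _))//; lra.
Qed.

Lemma hcont_rdot v g : hcont v -> continuous (fun t => rdot (v t) g).
Proof.
move=> vc t; apply/cvgrPdist_lt => e e0.
have g1 : 0 < rnorm g + 1 by rewrite ltr_wpDl ?rnorm_ge0.
have [|d d0 dP] := vc t (e / (rnorm g + 1)); first by rewrite divr_gt0.
apply/nbhs_ballP; exists d => // s /=; rewrite /ball/= distrC => /dP.
rewrite distrC -rdotBl ltr_pdivlMr// => h.
rewrite (le_lt_trans (rdot_le _ _))//.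
have := rnorm_ge0 (v s - v t); nra.
Qed.

Definition grid_point (n i : nat) : R := i%:R / n.+1%:R - n%:R.

Definition grid_index (n : nat) t : nat := Num.truncn ((t + n%:R) * n.+1%:R).

(** Samples v at the left endpoints of a mesh of width 1 / (n + 1) on [-n, n[, and is 0 elsewhere:
    finitely many values, convergent to v wherever v is continuous. *)
Definition grid_fun v (n : nat) t : H :=
  if (- n%:R <= t) && (t < n%:R) then v (grid_point n (grid_index n t)) else 0.

Lemma grid_indexP n t : - n%:R <= t ->
  grid_point n (grid_index n t) <= t < grid_point n (grid_index n t).+1.
Proof.
move=> nt; have n0 : (0 : R) < n.+1%:R by [].
have h : 0 <= (t + n%:R) * n.+1%:R by rewrite mulr_ge0//; lra.
rewrite /grid_point lerBlDr ltrBrDr ler_pdivrMr// ltr_pdivlMr//.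
exact: truncn_itv.
Qed.

Lemma grid_index_def n i t : grid_point n i <= t < grid_point n i.+1 ->
  grid_index n t = i.
Proof.
have n0 : (0 : R) < n.+1%:R by [].
rewrite /grid_point lerBlDr ltrBrDr ler_pdivrMr// ltr_pdivlMr// => h.
exact: truncn_def.
Qed.

Lemma grid_index_lt n t : - n%:R <= t -> t < n%:R ->
  (grid_index n t < (n + n) * n.+1)%N.
Proof.
move=> nt tn; rewrite /grid_index truncn_lt_nat; last by rewrite mulr_ge0//; lra.
by rewrite natrM ltr_pM2r// natrD ltrD2r.
Qed.

Lemma simple_grid_fun v n : simple_fun (grid_fun v n).
Proof.
split.
  apply: (@sub_finite_set _ _ ([set 0] `|`
    (v \o grid_point n) @` `I_((n + n) * n.+1))).
    move=> _ [t _ <-]; rewrite /grid_fun; case: ifPn => [/andP[nt tn]|_].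
      by right; exists (grid_index n t) => //=; exact: grid_index_lt.
    by left.
  by rewrite finite_setU; split=> //; apply: finite_image; exact: finite_II.
move=> y.
pose D : set R := [set` `[- n%:R, n%:R[].
have -> : grid_fun v n @^-1` [set y] =
   (if 0 == y then ~` D else set0) `|`
   (D `&` \bigcup_(i in [set i | v (grid_point n i) = y])
     [set` `[grid_point n i, grid_point n i.+1[]).
  apply/seteqP; split=> [t|t [|]]; rewrite /grid_fun /=.
  - case: ifPn => [/andP[nt tn] vy|ntn y0].
      right; split; first by rewrite /D/= in_itv/= nt.
      by exists (grid_index n t) => //=; rewrite in_itv/= grid_indexP.
    left; rewrite -y0 eqxx /= /D/= in_itv/=; exact/negP.
  - case: eqP => // <- /=; rewrite /D/= in_itv/= => /negP/negbTE -> //.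
  - rewrite /D/= in_itv/= => -[-> [i /= <-]]; rewrite in_itv/= => h.
    by rewrite (grid_index_def h).
apply: measurableU.
  case: ifPn => _; last exact: measurable0.
  by apply: measurableC; exact: measurable_itv.
apply: measurableI; first exact: measurable_itv.
by apply: bigcup_measurable => i _; exact: measurable_itv.
Qed.

Lemma hcont_bochner v (A : set R) : hcont v -> bochner_measurable A v.
Proof.
move=> vc; exists (grid_fun v); first exact: simple_grid_fun.
move=> t _; apply: tends_cvg => e e0; have [d d0 dP] := vc t e e0.
have [N _ NN] := near_infty_natSinv_lt (PosNum d0).
exists (N + (Num.truncn `|t|).+1)%N => n Nn.
have tn : `|t| < n%:R.
  apply: (lt_le_trans (truncnS_gt _)); rewrite ler_nat.
  exact: leq_trans (leq_addl _ _) Nn.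
have := ler_norm t; have := ler_norm (- t); rewrite normrN => h1 h2.
have nt1 : - n%:R <= t by move: tn; move: (n%:R : R) => r; lra.
have nt2 : t < n%:R by move: tn; move: (n%:R : R) => r; lra.
rewrite /grid_fun nt1 nt2 /=; apply: dP.
have /andP[g1 g2] := grid_indexP nt1.
have /= dn := NN n (leq_trans (leq_addr _ _) Nn).
rewrite ler0_norm; last by lra.
apply: le_lt_trans dn; rewrite opprB lerBlDr.
apply: (le_trans (ltW g2)); rewrite /grid_point -natr1 mulrDl mul1r.
by rewrite addrAC addrC.
Qed.

(** Replacing u by its simple approximations splits the pairing into finitely many scalar functions
    <y, G>, so weak measurability of G suffices. The map [pr] allows u to depend on one coordinate
    of a product, as needed for Fubini. *)
Lemma measurable_rdot (d : measure_display) (T : measurableType d)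
  (A : set R) (pr : T -> R) u (G : T -> H) : measurable_fun setT pr ->
  @measurable _ (measurableTypeR R) A -> bochner_measurable A u ->
  (forall y, measurable_fun setT (fun z => rdot y (G z))) ->
  measurable_fun (pr @^-1` A) (fun z => rdot (u (pr z)) (G z)).
Proof.
move=> mpr mA [s ss su] mG.
have mprA : measurable (pr @^-1` A) by rewrite -[_ @^-1` _]setTI; exact: mpr.
pose h n z := rdot (s n (pr z)) (G z).
apply: (@measurable_fun_cvg _ _ _ _ h) => [n|z Az].
  apply: measurable_funTS => _ Y mY; rewrite setTI.
  have [fs ms] := ss n.
  rewrite (_ : _ @^-1` _ = \bigcup_(y in range (s n))
    (pr @^-1` (s n @^-1` [set y]) `&` (fun z => rdot y (G z)) @^-1` Y)).
    apply: fin_bigcup_measurable => // y _; apply: measurableI.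
      by rewrite -[_ @^-1` _]setTI; apply: mpr => //; exact: ms.
    by rewrite -[_ @^-1` _]setTI; exact: mG.
  apply/seteqP; split=> z /=.
    by move=> Yz; exists (s n (pr z)); [exists (pr z)|].
  by case=> y _ [<-].
have := cvg_tends (su _ Az) => st; apply/cvgrPdist_lt => e e0.
have g1 : 0 < rnorm (G z) + 1 by rewrite ltr_wpDl ?rnorm_ge0.
have [|N NP] := st (e / (rnorm (G z) + 1)); first by rewrite divr_gt0.
exists N => // n /= /NP; rewrite ltr_pdivlMr// => lt_e.
rewrite /h distrC -rdotBl (le_lt_trans (rdot_le _ _))//.
have := rnorm_ge0 (s n (pr z) - u (pr z)); nra.
Qed.

End hilbert_valued.

Section test_functions.
Context {R : realType}.
Local Notation mu := (@lebesgue_measure R).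
Implicit Types (phi : R -> R) (I : interval R) (t s : R).

Lemma smooth_test I phi : test_function I phi -> smooth phi.
Proof.
move=> [dphi _] n; elim: n phi dphi => [|n IH] phi dphi.
  by split=> // t; exact: dphi 0%N t.
split=> [t|]; first exact: dphi 0%N t.
by apply: IH => k t; rewrite -derive1Sn; exact: dphi.
Qed.

(** The support K is closed, so phi vanishes in a neighbourhood of each point outside K, and its
    derivative vanishes there too. *)
Lemma test_support I phi : test_function I phi -> exists2 M : R, 0 < M &
  forall t, ~ [set` I] t \/ M < `|t| -> phi t = 0 /\ derive1 phi t = 0.
Proof.
move=> tphi; have sphi := smooth_test tphi; case: tphi => _ [K [cK KI phi0]].
have [M [_ KM]] := compact_bounded cK.
have M1 : M < `|M| + 1 by rewrite (le_lt_trans (ler_norm _))// ltrDl.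
exists (`|M| + 1); first by rewrite ltr_wpDl.
move=> t tout; have nK : ~ K t.
  move=> Kt; case: tout => [nI|]; first by apply: nI; exact: KI.
  by rewrite ltNge => /negP; apply; exact: KM M1 _ Kt.
split; first exact: phi0.
have oK : open (~` K).
  by apply: closed_openC; exact: (compact_closed (@Rhausdorff R) cK).
have d0 : is_derive t 1 (cst (0 : R)) (0 : R) by exact: is_derive_cst.
have near0 : \near t, cst 0 t = phi t.
  have : nbhs t (~` K) by exact: open_nbhs_nbhs.
  by apply: filterS => x /phi0 ->.
have := near_eq_is_derive near0 d0.
by move=> dp; rewrite derive1E; case: dp.
Qed.

Lemma compact_support_integrable phi (M : R) (A : set R) :
  @measurable _ (measurableTypeR R) A ->
  continuous phi -> (forall t, M < `|t| -> phi t = 0) ->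
  mu.-integrable A (EFin \o phi).
Proof.
move=> mA cphi phi0; suff : mu.-integrable setT (EFin \o phi).
  by move=> iT; exact: integrableS iT.
have -> : EFin \o phi = (EFin \o phi) \_ `[- M, M].
  apply/funext => x; rewrite patchE; case: ifPn => // /negP nx.
  rewrite /= phi0// ltNge; apply/negP => xM; apply: nx.
  by rewrite inE/= in_itv/= -ler_norml.
apply/integrable_restrict => //=; rewrite setTI.
apply: continuous_compact_integrable; first exact: segment_compact.
exact: continuous_subspaceT.
Qed.

Lemma FTC2_within (n n' : R -> R) (p q : R) : p < q -> continuous n' ->
  (forall t, is_derive t 1 n (n' t)) ->
  \int[mu]_(t in `[p, q]) n' t = n q - n p.
Proof.
move=> pq cn dn; have := @continuous_FTC2 R n' n p q pq.
rewrite /Rintegral => ->.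
- by rewrite -EFinB.
- exact: continuous_subspaceT.
- by apply: derivable_LR => // t _; case: (dn t).
- by move=> t _; rewrite derive1E; case: (dn t).
Qed.

Section compactly_supported_primitive.
Variables (n n' : R -> R) (M : R).
Hypothesis cn : continuous n'.
Hypothesis dn : forall t, is_derive t 1 n (n' t).
Hypothesis n0 : forall t, M < `|t| -> n t = 0 /\ n' t = 0.

Lemma integral_derive_left s : \int[mu]_(t in `]-oo, s[) n' t = n s.
Proof.
pose p := Num.min (- M) s - 1.
have ps : p < s.
  by rewrite /p ltrBlDr (@le_lt_trans _ _ s) ?ge_min ?lexx ?orbT// ltrDl.
have pM t : t <= p -> M < `|t|.
  move=> tp; have : t < - M.
    apply: le_lt_trans tp _.
    by rewrite /p ltrBlDr (@le_lt_trans _ _ (- M)) ?ge_min ?lexx// ltrDl.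
  by rewrite ltrNr => /lt_le_trans; apply; rewrite -normrN ler_norm.
rewrite (@eq_Rintegral_supp _ _ `]p, s[).
- rewrite Rintegral_itv_obnd_cbnd; last first.
    exact: compact_support_integrable (measurable_itv _) cn (fun t h => (n0 h).2).
  rewrite Rintegral_itv_bndo_bndc; last first.
    exact: compact_support_integrable (measurable_itv _) cn (fun t h => (n0 h).2).
  by rewrite (FTC2_within ps cn dn) (n0 (pM _ (lexx p))).1 subr0.
- by move=> t /=; rewrite !in_itv/= => /andP[].
- move=> t /=; rewrite !in_itv/= => -> /negP; rewrite andbT -leNgt => /pM.
  by move=> /n0[].
Qed.

Lemma integral_derive_right s : \int[mu]_(t in `]s, +oo[) n' t = - n s.
Proof.
pose p := Num.max M s + 1.
have ps : s < p.
  by rewrite /p (@le_lt_trans _ _ (Num.max M s)) ?le_max ?lexx ?orbT// ltrDl.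
have pM t : p <= t -> M < `|t|.
  move=> tp; apply: lt_le_trans (ler_norm _); apply: lt_le_trans tp.
  by rewrite /p (@le_lt_trans _ _ (Num.max M s)) ?le_max ?lexx// ltrDl.
rewrite (@eq_Rintegral_supp _ _ `]s, p[).
- rewrite Rintegral_itv_obnd_cbnd; last first.
    exact: compact_support_integrable (measurable_itv _) cn (fun t h => (n0 h).2).
  rewrite Rintegral_itv_bndo_bndc; last first.
    exact: compact_support_integrable (measurable_itv _) cn (fun t h => (n0 h).2).
  by rewrite (FTC2_within ps cn dn) (n0 (pM _ (lexx p))).1 sub0r.
- by move=> t /=; rewrite !in_itv/= => /andP[->].
- move=> t /=; rewrite !in_itv/= andbT => -> /negP; rewrite -leNgt => /pM.
  by move=> /n0[].
Qed.

Lemma integral_derive_total (A : set R) :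
  (forall t, ~ A t -> n' t = 0) -> \int[mu]_(t in A) n' t = 0.
Proof.
move=> A0; pose p := `|M| + 1.
have pM t : p <= `|t| -> M < `|t|.
  by apply: lt_le_trans; rewrite (le_lt_trans (ler_norm _))// ltrDl.
have p0 : - p < p by rewrite /p; have := normr_ge0 M; lra.
transitivity (\int[mu]_(t in setT) n' t).
  by apply/esym/eq_Rintegral_supp => // t _; exact: A0.
rewrite (@eq_Rintegral_supp _ _ `[- p, p])//.
  rewrite (FTC2_within p0 cn dn) !(n0 _).1 ?subrr//;
    by apply: pM; rewrite ?normrN ler_norm.
move=> t _ /= /negP; rewrite in_itv/= -ler_norml -ltNge => /ltW/pM.
by move=> /n0[].
Qed.

End compactly_supported_primitive.

End test_functions.

(** * From the distributional equation to real integrals *)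

Section weak_equation.
Context {R : realType} {H : hilbertSpace R}.
Local Notation mu := (@lebesgue_measure R).
Implicit Types (A : selfadjoint_operator H) (I : interval R) (G x y : H).

Lemma integrable_rdot I (u : preL2 H I) (w : R -> H) : hcont w ->
  mu.-integrable [set` I] (fun t => (rnorm (w t) ^+ 2)%:E) ->
  mu.-integrable [set` I] (EFin \o (fun t => rdot (u t) (w t))).
Proof.
move=> cw iw; have mI : @measurable _ (measurableTypeR R) [set` I].
  exact: measurable_itv.
have /sq_integrableP[bu iu] := valP u.
apply: (le_integrable mI) (integrableD mI iu iw).
  apply/measurable_EFinP.
  apply: (@measurable_rdot _ _ _ _ [set` I] id) => // y.
  apply: continuous_measurable_fun.
  have -> : (fun z => rdot y (w z)) = (fun z => rdot (w z) y).
    by apply/funext => z; exact: rdotC.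
  exact: hcont_rdot.
move=> t _ /=; rewrite lee_fin (le_trans (rdot_le _ _))//.
apply: le_trans (ler_norm _).
have := sqr_ge0 (rnorm (u t) - rnorm (w t)).
have := rnorm_ge0 (u t); have := rnorm_ge0 (w t).
set p := rnorm _; set q := rnorm _; nra.
Qed.

Lemma integrable_test I (u : preL2 H I) (phi : R -> R) (M : R) G :
  continuous phi -> (forall t, M < `|t| -> phi t = 0) ->
  mu.-integrable [set` I] (EFin \o (fun t => phi t * rdot (u t) G)).
Proof.
move=> cphi phi0.
have := @integrable_rdot I u (fun t => (phi t)%:C *: G).
have -> : (fun t => phi t * rdot (u t) G) =
    (fun t => rdot (u t) ((phi t)%:C *: G)).
  by apply/funext => t; rewrite rdotZr.
apply.
  move=> t e e0; have G1 : 0 < rnorm G + 1 by rewrite ltr_wpDl ?rnorm_ge0.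
  have eG : 0 < e / (rnorm G + 1) by rewrite divr_gt0.
  have /cvgrPdist_lt/(_ _ eG)/nbhs_ballP[d /= d0 dP] := cphi t.
  exists d => // s st; rewrite -scalerBl -rmorphB/= rnormZc cabsC.
  have := dP s; rewrite /ball/= distrC => /(_ st).
  rewrite distrC ltr_pdivlMr//; have := normr_ge0 (phi s - phi t).
  have := rnorm_ge0 G; nra.
have -> : (fun t => (rnorm ((phi t)%:C *: G) ^+ 2)%:E) =
    EFin \o (fun t => phi t ^+ 2 * rnorm G ^+ 2).
  apply/funext => t /=; rewrite rnormZc cabsC exprMn real_normK ?num_real//.
apply: (@compact_support_integrable _ _ M).
- exact: measurable_itv.
- move=> t; apply: cvgM; last exact: cvg_cst.
  by rewrite expr2; under eq_fun do rewrite expr2; apply: cvgM; exact: cphi.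
- by move=> t /phi0 ->; rewrite expr0n/= mul0r.
Qed.

(* Real part of [i u' + A u = f] tested against [phi *: ('i *: G)]. *)
Definition weak_eq A I (u f : R -> H) := forall (phi : R -> R) G,
  test_function I phi -> dom A G ->
  \int[mu]_(t in [set` I]) (derive1 phi t * rdot (u t) G) =
  \int[mu]_(t in [set` I])
    (phi t * (rdot (u t) ('i *: A G) - rdot (f t) ('i *: G))).

(** The real equation for G is the imaginary part of the complex one. Since D(A) is a complex
    subspace, testing with -i G yields the real part as well. *)
Lemma maximal_graph_weak A I (u f : L2 H I) :
  maximal_graph A u f <-> weak_eq A I (L2_fun u) (L2_fun f).
Proof.
have mI : @measurable _ (measurableTypeR R) [set` I] by exact: measurable_itv.
have split_int phi G G' : test_function I phi ->
    \int[mu]_(t in [set` I])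
      (phi t * (rdot (L2_fun u t) G - rdot (L2_fun f t) G')) =
    \int[mu]_(t in [set` I]) (phi t * rdot (L2_fun u t) G) -
    \int[mu]_(t in [set` I]) (phi t * rdot (L2_fun f t) G').
  move=> tphi; have [M _ phi0] := test_support tphi.
  have cphi := smooth_continuous (smooth_test tphi).
  have phi0' t : M < `|t| -> phi t = 0 by move=> h; case: (phi0 t (or_intror h)).
  rewrite -RintegralB//; [|exact: integrable_test cphi phi0'|exact: integrable_test cphi phi0'].
  by apply: eq_Rintegral => t _; rewrite mulrBr.
have Re_int (phi : R -> R) (v : R -> H) G : complex.Re (cintegral [set` I]
    (fun t => (phi t)%:C * hdot H (v t) G)) =
    \int[mu]_(t in [set` I]) (phi t * rdot (v t) G).
  by rewrite /cintegral/=; apply: eq_Rintegral => t _; rewrite ReZ.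
have Im_int (phi : R -> R) (v : R -> H) G : complex.Im (cintegral [set` I]
    (fun t => (phi t)%:C * hdot H (v t) G)) =
    \int[mu]_(t in [set` I]) (phi t * rdot (v t) ('i *: G)).
  rewrite /cintegral/=; apply: eq_Rintegral => t _.
  by rewrite ImZ Im_polarization.
have eq_opp phi G : test_function I phi ->
    \int[mu]_(t in [set` I]) (derive1 phi t * rdot (L2_fun u t) (- G)) =
    - \int[mu]_(t in [set` I]) (derive1 phi t * rdot (L2_fun u t) G).
  move=> tphi; have [M _ phi0] := test_support tphi.
  have cphi := smooth_continuous (smooth_derive1 (smooth_test tphi)).
  have phi0' t : M < `|t| -> derive1 phi t = 0.
    by move=> h; case: (phi0 t (or_intror h)).
  rewrite -mulN1r -RintegralZl//; last exact: integrable_test cphi phi0'.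
  by apply: eq_Rintegral => t _; rewrite rdotNr mulrN mulN1r.
split=> [mg phi G tphi AG|we phi G tphi AG].
  have := mg phi G tphi AG; rewrite /dist_derive /regular /=.
  move=> /(congr1 (@complex.Im R)); rewrite ImD Imi ReN !Re_int !Im_int.
  rewrite split_int// => <-; ring.
rewrite /dist_derive /regular /=; apply: complex_eq.
- have := we phi ((- 'i) *: G) tphi (domZ _ AG); rewrite split_int// opZ//.
  rewrite ReD Rei ImN opprK !Re_int Im_int !scalerA.
  rewrite mulrN -expr2 sqr_i opprK !scale1r scaleNr eq_opp// => h.
  rewrite -[X in X + _]opprK h; ring.
- have := we phi G tphi AG; rewrite split_int//.
  by rewrite ImD Imi ReN !Re_int !Im_int => ->; ring.
Qed.
End weak_equation.

(** * Absorbing the real part of the spectral parameter into the operator *)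

Section shift.
Context {R : realType} {H : hilbertSpace R} (A : selfadjoint_operator H) (x : R).

Definition shift_operator : operator H :=
  Operator (dom A) (fun u => A u - x%:C *: u).

Lemma shift_linear : linear_operator shift_operator.
Proof.
split=> [|a u v Au Av]; first exact: dom0.
split; first exact: domP.
by rewrite /= opP// scalerBr scalerDr !scalerA (mulrC x%:C) opprD addrACA.
Qed.

Lemma shift_selfadjoint : selfadjoint shift_operator.
Proof.
have [dA saA] := sa_selfadjoint A; split=> // v w.
have hx u : hdot H (x%:C *: u) v = hdot H u (x%:C *: v).
  by rewrite hdotZl hdotZr conjcR.
split=> [h|[/= Av Avw] u Au].
  have [|Av AvE] := (saA v (w + x%:C *: v)).1.
    move=> u Au; rewrite hdotDr -hx -(h u Au) /= hdotBl; ring.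
  by split=> //=; rewrite AvE addrK.
have Aw : dom A v /\ A v = w + x%:C *: v by rewrite -Avw subrK.
rewrite /= hdotBl hx ((saA _ _).2 Aw _ Au) hdotDr; ring.
Qed.

Definition shift_op := SelfadjointOperator shift_linear shift_selfadjoint.

(** Weak form of u' = (k + i B) u - i h, with the generator moved to the test vector G. *)
Definition weak_shift (B : selfadjoint_operator H) (k : R) (I : interval R)
    (u h : R -> H) := forall (phi : R -> R) G,
  test_function I phi -> dom B G ->
  \int[lebesgue_measure]_(t in [set` I]) (derive1 phi t * rdot (u t) G) =
  \int[lebesgue_measure]_(t in [set` I])
    (phi t * (rdot (u t) ('i *: B G) - k * rdot (u t) G - rdot (h t) ('i *: G))).

Lemma weak_eq_shift (k : R) (I : interval R) (u h : R -> H) :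
  weak_eq A I u (fun t => h t + (x +i* k) *: u t) <-> weak_shift shift_op k I u h.
Proof.
have key phi G : \int[lebesgue_measure]_(t in [set` I])
    (phi t * (rdot (u t) ('i *: A G) - rdot (h t + (x +i* k) *: u t) ('i *: G))) =
  \int[lebesgue_measure]_(t in [set` I])
    (phi t * (rdot (u t) ('i *: shift_op G) - k * rdot (u t) G - rdot (h t) ('i *: G))).
  apply: eq_Rintegral => t _; congr (_ * _).
  rewrite complex_scaleE/= !rdotDl !rdotZl rdotii scalerBr rdotBr.
  by rewrite (scalerA 'i) (mulrC 'i) -scalerA rdotZr; ring.
by split=> we phi G tphi AG; rewrite we// key.
Qed.

End shift.

(** * Homogeneous solutions *)

Section homogeneous.
Context {R : realType} {H : hilbertSpace R} (B : selfadjoint_operator H).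
Implicit Types (a k t s : R) (c G : H).
Local Notation mu := (@lebesgue_measure R).

Lemma hcontZ (f : R -> R) (v : R -> H) : continuous f -> hcont v ->
  hcont (fun t => (f t)%:C *: v t).
Proof.
move=> cf cv t e e0.
have f1 : 0 < `|f t| + 1 by rewrite ltr_wpDl.
have v1 : 0 < rnorm (v t) + 1 by rewrite ltr_wpDl ?rnorm_ge0.
have [|d d0 dP] := cv t (e / 2 / (`|f t| + 1)); first by rewrite !divr_gt0.
have h0 : 0 < Num.min 1 (e / 2 / (rnorm (v t) + 1)).
  by rewrite lt_min ltr01 !divr_gt0.
have /cvgrPdist_lt/(_ _ h0)/nbhs_ballP[d' /= d'0 d'P] := cf t.
exists (Num.min d d'); first by rewrite lt_min d0.
move=> s; rewrite lt_min => /andP[/dP sd sd'].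
have := d'P s; rewrite /ball/= distrC => /(_ sd'); rewrite distrC lt_min.
move=> /andP[fs1 fs2]; rewrite ltr_pdivlMr// in sd; rewrite ltr_pdivlMr// in fs2.
have -> : (f s)%:C *: v s - (f t)%:C *: v t =
    (f s)%:C *: (v s - v t) + (f s - f t)%:C *: v t.
  by rewrite rmorphB/= scalerBl scalerBr addrA subrK.
rewrite (le_lt_trans (rnormD _ _))// !rnormZc !cabsC.
have fst : `|f s| <= `|f t| + 1.
  by have := ler_normD (f s - f t) (f t); rewrite subrK; lra.
have := rnorm_ge0 (v s - v t); have := normr_ge0 (f s - f t).
have := rnorm_ge0 (v t); nra.
Qed.

Lemma grp_hcont c : hcont (fun t => grp B t c).
Proof.
move=> t e e0; have [d d0 dP] := grp_cvg B c e0; exists d => // s st.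
have -> : grp B s c - grp B t c = grp B t (grp B (s - t) c - c).
  by rewrite grpB -grpD (addrC t) subrK.
by rewrite rnorm_grp dP.
Qed.

Lemma hcont_shift (v : R -> H) a : hcont v -> hcont (fun t => v (t - a)).
Proof.
move=> cv t e e0; have [d d0 dP] := cv (t - a) e e0.
by exists d => // s st; apply: dP; rewrite opprB addrA subrK.
Qed.

Definition expflow k a c t : H := (expR (k * (t - a)))%:C *: grp B (t - a) c.

Lemma continuous_expR_affine k a : continuous (fun t : R => expR (k * (t - a))).
Proof.
move=> t; apply: continuous_comp; last exact: continuous_expR.
apply: cvgM; first exact: cvg_cst.
by apply: cvgB; [exact: cvg_id|exact: cvg_cst].
Qed.

Lemma expflow_hcont k a c : hcont (expflow k a c).
Proof.
apply: hcontZ; first exact: continuous_expR_affine.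
exact: (hcont_shift a (grp_hcont c)).
Qed.

Lemma expflow_start k a c : expflow k a c a = c.
Proof. by rewrite /expflow subrr mulr0 expR0 grp0 scale1r. Qed.

Lemma rnorm_expflow k a c t : rnorm (expflow k a c t) = expR (k * (t - a)) * rnorm c.
Proof. by rewrite rnormZc cabsC ger0_norm ?expR_ge0// rnorm_grp. Qed.

Lemma rdot_grp t c G : rdot (grp B t c) G = rdot c (grp B (- t) G).
Proof. by rewrite /rdot grp_adj. Qed.

Lemma rdot_expflow k a c t G :
  rdot (expflow k a c t) G = expR (k * (t - a)) * rdot c (grp B (a - t) G).
Proof. by rewrite /expflow rdotZl rdot_grp opprB. Qed.

(** The vector c is arbitrary, so t -> U(t) c need not be differentiable. Differentiability comes
    from G, because <U(h) c, G> = <c, U(-h) G> and G lies in D(B). *)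
Lemma is_derive_rdot_grp c G t : dom B G ->
  is_derive t 1 (fun t => rdot (grp B t c) G) (- rdot (grp B t c) ('i *: B G)).
Proof.
move=> BG; apply: is_derive_eps => e e0.
have c1 : 0 < rnorm c + 1 by rewrite ltr_wpDl ?rnorm_ge0.
have ec : 0 < e / (rnorm c + 1) by rewrite divr_gt0.
have [d d0 dP] := grp_taylor BG ec; exists d => // h hd.
have := dP (- h); rewrite normrN => /(_ hd) {}dP.
have -> : rdot (grp B (t + h) c) G - rdot (grp B t c) G -
    h * - rdot (grp B t c) ('i *: B G) =
    rdot (grp B t c) (grp B (- h) G - G - ((- h)%:C * 'i) *: B G).
  rewrite (addrC t) grpD (rdot_grp h) !rdotBr -scalerA rdotZr; ring.
rewrite (le_trans (rdot_le _ _))// rnorm_grp.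
move: dP; rewrite mulrAC ler_pdivlMr//.
have := rnorm_ge0 (grp B (- h) G - G - ((- h)%:C * 'i) *: B G).
have := rnorm_ge0 c; nra.
Qed.

Lemma is_derive_rdot_expflow k a c G t : dom B G ->
  is_derive t 1 (fun t => rdot (expflow k a c t) G)
    (k * rdot (expflow k a c t) G - rdot (expflow k a c t) ('i *: B G)).
Proof.
move=> BG.
have h1 : is_derive t 1 (fun t => expR (k * (t - a))) (k * expR (k * (t - a))).
  have := @is_derive_affine R expR k (- (k * a)) t _ (is_derive_expR _).
  by rewrite -mulrBr; congr (is_derive _ _ _ _); apply/funext => u;
    rewrite -mulrBr.
have h2 : is_derive t 1 (fun t => rdot (grp B (t - a) c) G)
    (- rdot (grp B (t - a) c) ('i *: B G)).
  have := is_derive_rdot_grp c (1 * t + - a) BG.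
  move=> /is_derive_affine; rewrite !mul1r; congr (is_derive _ _ _ _).
  by apply/funext => u; rewrite mul1r.
have := is_deriveM h1 h2.
rewrite (_ : _ * _ = (fun t => rdot (expflow k a c t) G)); last first.
  by apply/funext => u; rewrite /expflow rdotZl.
move=> /is_derive_eq; apply; rewrite /expflow !rdotZl /GRing.scale/=; ring.
Qed.

(** Here n' is the derivative of phi(t) <v(t), G> along the flow v, and equals the difference of the
    two sides of the weak homogeneous equation. It serves both for homogeneous solutions, where it
    integrates to 0, and for the Duhamel integral, where integrating it up to an endpoint leaves a
    boundary term. *)
Lemma test_mul_expflow I k a c G phi : test_function I phi -> dom B G ->
  let n' t := derive1 phi t * rdot (expflow k a c t) G +
    phi t * (k * rdot (expflow k a c t) G - rdot (expflow k a c t) ('i *: B G)) in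
  [/\ continuous n',
    forall t, is_derive t 1 (fun t => phi t * rdot (expflow k a c t) G) (n' t) &
    exists M : R, forall t, M < `|t| ->
      phi t * rdot (expflow k a c t) G = 0 /\ n' t = 0].
Proof.
move=> tphi BG n'; have sphi := smooth_test tphi.
have cphi := smooth_continuous sphi.
have cphi' := smooth_continuous (smooth_derive1 sphi).
have cr g : continuous (fun t => rdot (expflow k a c t) g).
  exact/hcont_rdot/expflow_hcont.
split.
- move=> t; apply: cvgD; first by apply: cvgM; [exact: cphi'|exact: cr].
  apply: cvgM; first exact: cphi.
  by apply: cvgB; [apply: cvgM; [exact: cvg_cst|exact: cr]|exact: cr].
- move=> t.
  have := is_deriveM (derivable_is_derive1 (smooth_der sphi))
    (is_derive_rdot_expflow k a c t BG).
  by move=> /is_derive_eq; apply; rewrite /n' /GRing.scale/=; ring.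
- have [M _ MP] := test_support tphi; exists M => t Mt.
  by have [p0 p1] := MP t (or_intror Mt); rewrite /n' p0 p1 !mul0r addr0.
Qed.

Lemma weak_shift_expflow I k a c : weak_shift B k I (expflow k a c) (fun=> 0).
Proof.
move=> phi G tphi BG; have mI : @measurable _ (measurableTypeR R) [set` I].
  exact: measurable_itv.
have [cn dn [M n0]] := test_mul_expflow k a c tphi BG.
have [M' _ MP] := test_support tphi.
have sphi := smooth_test tphi.
have cr g : continuous (fun t => rdot (expflow k a c t) g).
  exact/hcont_rdot/expflow_hcont.
have i1 : mu.-integrable [set` I]
    (EFin \o (fun t => derive1 phi t * rdot (expflow k a c t) G)).
  apply: (@compact_support_integrable _ _ M') => // [t|t /or_intror/MP[_ ->]].
    by apply: cvgM; [exact: smooth_continuous (smooth_derive1 sphi) t|exact: cr].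
  by rewrite mul0r.
have i2 : mu.-integrable [set` I] (EFin \o (fun t =>
    phi t * (rdot (expflow k a c t) ('i *: B G) - k * rdot (expflow k a c t) G -
    rdot 0 ('i *: G)))).
  apply: (@compact_support_integrable _ _ M') => // [t|t /or_intror/MP[-> _]].
    apply: cvgM; first exact: smooth_continuous sphi t.
    apply: cvgB; last exact: cvg_cst.
    by apply: cvgB; [exact: cr|apply: cvgM; [exact: cvg_cst|exact: cr]].
  by rewrite mul0r.
apply/eqP; rewrite -subr_eq0 -RintegralB//.
rewrite -[X in _ == X](integral_derive_total cn dn n0 (A := [set` I])).
  apply/eqP/eq_Rintegral => t _; rewrite rdot0l; ring.
by move=> t /or_introl/MP[-> ->]; rewrite !mul0r addr0.
Qed.

End homogeneous.

(** * The Duhamel integral *)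

Section kernel.
Context {R : realType}.
Local Notation mu := (@lebesgue_measure R).
Implicit Types (k t s : R).

(** The exponential propagator from s to t, restricted to s > t for k > 0 and to s < t for k < 0, so
    that its exponent is always negative. Its integral in either variable is 1/|k|. *)
Definition decay k t s : R := if 0 < k * (s - t) then expR (k * (t - s)) else 0.

Lemma decay_ge0 k t s : 0 <= decay k t s.
Proof. by rewrite /decay; case: ifP => // _; exact: expR_ge0. Qed.

Lemma decay_le1 k t s : decay k t s <= 1.
Proof.
rewrite /decay; case: ifPn => // h.
by rewrite -expR0 ler_expR -[t - s]opprB mulrN oppr_le0 ltW.
Qed.

Lemma decay_sym k t s : decay k t s = decay (- k) s t.
Proof.
rewrite /decay (_ : - k * (t - s) = k * (s - t)); last by ring.
by rewrite (_ : - k * (s - t) = k * (t - s)); last by ring.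
Qed.

Lemma measurable_decay k :
  measurable_fun setT (fun z : measurableTypeR R * measurableTypeR R =>
    decay k z.1 z.2).
Proof.
have mfst : measurable_fun setT (fst : measurableTypeR R * measurableTypeR R -> measurableTypeR R).
  exact: measurable_fst.
have msnd : measurable_fun setT (snd : measurableTypeR R * measurableTypeR R -> measurableTypeR R).
  exact: measurable_snd.
have mk : measurable_fun setT (fun z : measurableTypeR R * measurableTypeR R =>
    k * (z.2 - z.1)).
  by apply: measurable_funM => //; exact: measurable_funB.
have mk' : measurable_fun setT (fun z : measurableTypeR R * measurableTypeR R =>
    k * (z.1 - z.2)).
  by apply: measurable_funM => //; exact: measurable_funB.
apply: measurable_fun_ifT => //.
  exact: measurable_fun_ltr.
by apply: measurableT_comp => //; exact: measurable_expR.
Qed.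

Lemma measurable_decayr k t : measurable_fun setT (decay k t).
Proof.
apply: (@measurableT_comp _ _ _ _ _ _ (fun z : measurableTypeR R * measurableTypeR R =>
    decay k z.1 z.2) _ (fun s => (t, s))).
  exact: measurable_decay.
exact: measurable_pair1.
Qed.

Lemma continuous_expR_affine_opp k t :
  continuous (fun s : R => expR (k * (t - s))).
Proof.
rewrite (_ : (fun s => _) = (fun s => expR (- k * (s - t)))).
  exact: continuous_expR_affine.
by apply/funext => s; congr expR; ring.
Qed.

Lemma integral_exp_right k t : 0 < k ->
  (\int[mu]_(s in `]t, +oo[) (expR (k * (t - s)))%:E = (k^-1)%:E)%E.
Proof.
move=> k0.
have ce : continuous (fun s => expR (k * (t - s))).
  exact: continuous_expR_affine_opp.
have dF s : is_derive s 1 (fun s => - (k^-1 * expR (k * (t - s))))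
    (expR (k * (t - s))).
  have h1 : is_derive s 1 (fun s => expR (k * (t - s))) (- k * expR (k * (t - s))).
    have := @is_derive_affine R expR (- k) (k * t) s _ (is_derive_expR _).
    have -> : - k * s + k * t = k * (t - s) by ring.
    by congr (is_derive _ _ _ _); apply/funext => u; congr expR; ring.
  have h2 := is_deriveN (is_deriveZ k^-1 h1).
  move: h2 => /is_derive_eq; apply.
  by rewrite /GRing.scale/= mulNr mulrN opprK mulrA mulVf ?mul1r// gt_eqF.
rewrite integral_itv_obnd_cbnd; last first.
  apply/measurable_EFinP; apply: measurable_funTS.
  exact: continuous_measurable_fun.
rewrite (@ge0_continuous_FTC2y _ _ (fun s => - (k^-1 * expR (k * (t - s)))) _ 0).
- by rewrite subrr mulr0 expR0 mulr1 EFinN oppeK add0e.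
- by move=> s _; exact: expR_ge0.
- exact: continuous_subspaceT.
- rewrite -[X in _ --> X]oppr0 -(mulr0 k^-1); apply: cvgN.
  apply: cvgM; first exact: cvg_cst.
  have -> : (fun s => expR (k * (t - s))) =
      (fun z => expR (- z)) \o (fun s => k * s - k * t).
    by apply/funext => s /=; congr expR; ring.
  apply: (@cvg_comp _ _ _ _ _ _ (pinfty_nbhs R)); last exact: cvgr_expR.
  apply: (@cvg_comp _ _ _ (fun s => k * s) (fun s => s - k * t) _ (pinfty_nbhs R)).
    exact: gt0_cvgMry.
  exact: cvg_addrr.
- by move=> s _; case: (dF s).
- apply: cvg_at_right_filter.
  have : derivable (fun s => - (k^-1 * expR (k * (t - s)))) t 1 by case: (dF t).
  by move=> /derivable1_diffP/differentiable_continuous; exact.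
- by move=> s _; rewrite derive1E; case: (dF s).
Qed.

Lemma integral_decay k t : k != 0 ->
  (\int[mu]_s (decay k t s)%:E = (`|k|^-1)%:E)%E.
Proof.
move=> k0; have [kneg|kpos|k00] := ltgtP k 0; last by rewrite k00 eqxx in k0.
  have -> : (\int[mu]_s (decay k t s)%:E =
      \int[mu]_(s in `]-oo, t[) (expR (k * (t - s)))%:E)%E.
    rewrite [RHS]integral_mkcond; apply: eq_integral => s _.
    rewrite patchE /decay nmulr_rgt0// subr_lt0 mem_setE in_itv/=.
    by case: ifP.
  rewrite integral_itv_bndo_bndc; last first.
    apply/measurable_EFinP; apply: measurable_funTS.
    apply: continuous_measurable_fun.
    exact: continuous_expR_affine_opp.
  have := @ge0_integration_by_substitutionNy R (fun s => expR (k * (t - s))) (- t).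
  rewrite opprK => ->.
  - rewrite -integral_itv_obnd_cbnd; last first.
      apply/measurable_EFinP; apply: measurable_funTS.
      apply: continuous_measurable_fun.
      rewrite (_ : _ \o _ = (fun s => expR (- k * (- t - s)))).
        exact: continuous_expR_affine_opp.
      by apply/funext => s /=; congr expR; ring.
    rewrite ltr0_norm// -(@integral_exp_right (- k) (- t)) ?oppr_gt0//.
    by apply: eq_integral => s _ /=; congr (expR _)%:E; ring.
  - apply: continuous_subspaceT.
    exact: continuous_expR_affine_opp.
  - by move=> s _; exact: expR_ge0.
rewrite gtr0_norm// -(@integral_exp_right k t)// [RHS]integral_mkcond.
apply: eq_integral => s _.
rewrite patchE /decay pmulr_rgt0// subr_gt0 mem_setE in_itv/= andbT.
by case: ifP.
Qed.

Lemma integral_decay_left k s : k != 0 ->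
  (\int[mu]_t (decay k t s)%:E = (`|k|^-1)%:E)%E.
Proof.
move=> k0; under eq_integral do rewrite decay_sym.
by rewrite integral_decay ?normrN// oppr_eq0.
Qed.

Lemma integrable_decay k t : k != 0 -> mu.-integrable setT (EFin \o decay k t).
Proof.
move=> k0; apply/integrableP; split.
  by apply/measurable_EFinP; exact: measurable_decayr.
under eq_integral do rewrite /= ger0_norm ?decay_ge0//.
by rewrite integral_decay// ltry.
Qed.

End kernel.

(** * The Duhamel integral: definition and pointwise bounds *)

Section convolution.
Context {R : realType} {H : hilbertSpace R} (B : selfadjoint_operator H).
Local Notation mu := (@lebesgue_measure R).
Variables (k : R) (F : R -> H).
Hypothesis k0 : k != 0.
Hypothesis bF : bochner_measurable setT F.
Hypothesis iF : mu.-integrable setT (EFin \o (fun s => rnorm (F s) ^+ 2)).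
Implicit Types (t s M C : R) (p q : R -> R) (G y : H).

Let mT : @measurable _ (measurableTypeR R) setT. Proof. exact: measurableT. Qed.

Lemma Rintegral_eq0 (f : R -> R) : (forall s, f s = 0) -> \int[mu]_s f s = 0.
Proof. by move=> f0; rewrite /Rintegral integral0_eq// => x _; rewrite f0. Qed.

Lemma measurable_rdot_hcont (V : R -> H) : hcont V ->
  measurable_fun setT (fun s => rdot (F s) (V s)).
Proof.
move=> cV.
have := @measurable_rdot R H _ (measurableTypeR R) setT id F V.
rewrite preimage_setT; apply => // y; apply: continuous_measurable_fun.
have -> : (fun z => rdot y (V z)) = (fun z => rdot (V z) y).
  by apply/funext => z; exact: rdotC.
exact: hcont_rdot.
Qed.

Lemma integrable_weight p C : measurable_fun setT p ->
  (forall s, 0 <= p s <= C) ->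
  mu.-integrable setT (EFin \o (fun s => p s * rnorm (F s) ^+ 2)).
Proof.
move=> mp pC; apply: (@integrable_bounded_mul _ _ _ _ C) => // s _.
by have /andP[p0 p1] := pC s; rewrite ger0_norm.
Qed.

(** Young's inequality f r <= M f^2 / 2 + r^2 / (2 M) with f = |F s|; the parameter M is kept free
    for the absorption argument in [weak_bound]. *)
Lemma weight_bound (V : R -> H) (p q : R -> R) r M s : 0 < M -> 0 <= r ->
  rnorm (V s) = r -> `|q s| <= p s ->
  `|q s * rdot (F s) (V s)| <= M / 2 * (p s * rnorm (F s) ^+ 2) +
    r ^+ 2 / (2 * M) * p s.
Proof.
move=> M0 r0 Vr qp; rewrite normrM.
have := rdot_le (F s) (V s); rewrite Vr => h.
have p0 : 0 <= p s by exact: le_trans (normr_ge0 _) qp.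
apply: (@le_trans _ _ (p s * (rnorm (F s) * r))); first exact: ler_pM.
rewrite (_ : _ + _ = p s * (M / 2 * rnorm (F s) ^+ 2 + r ^+ 2 / (2 * M))).
  rewrite ler_wpM2l//; set f := rnorm (F s).
  have := sqr_ge0 (M * f - r); rewrite -subr_ge0.
  rewrite (_ : _ - _ * r = (M * f - r) ^+ 2 / (2 * M)).
    by rewrite divr_ge0 ?sqr_ge0//; lra.
  by field; rewrite gt_eqF.
by ring.
Qed.

Lemma integrable_weight_rdot (V : R -> H) p q r C : hcont V ->
  measurable_fun setT p -> measurable_fun setT q ->
  mu.-integrable setT (EFin \o p) -> (forall s, p s <= C) ->
  (forall s, rnorm (V s) = r) -> (forall s, `|q s| <= p s) ->
  mu.-integrable setT (EFin \o (fun s => q s * rdot (F s) (V s))).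
Proof.
move=> cV mp mq ip pC Vr qp.
have p0 s : 0 <= p s <= C by rewrite pC andbT (le_trans (normr_ge0 (q s))).
have r0 : 0 <= r by rewrite -(Vr 0) rnorm_ge0.
have i1 := integrable_lin (1 / 2) (r ^+ 2 / (2 * 1)) mT (integrable_weight mp p0) ip.
apply: (le_integrable mT) i1.
  apply/measurable_EFinP; apply: measurable_funM => //.
  exact: measurable_rdot_hcont.
move=> s _ /=; rewrite lee_fin (le_trans (weight_bound ltr01 r0 (Vr s) (qp s)))//.
exact: ler_norm.
Qed.

(** A Cauchy-Schwarz estimate for a vector y defined by its pairings. In Young's inequality the
    second term is |y|^2 / (2 M) times the integral of p, at most |y|^2 / 2, and is absorbed on the
    left. *)
Lemma weak_bound (V : R -> H) p q y C M : hcont V ->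
  measurable_fun setT p -> measurable_fun setT q ->
  mu.-integrable setT (EFin \o p) -> (forall s, p s <= C) ->
  (forall s, rnorm (V s) = rnorm y) -> (forall s, `|q s| <= p s) ->
  0 < M -> \int[mu]_s p s <= M ->
  rnorm y ^+ 2 = \int[mu]_s (q s * rdot (F s) (V s)) ->
  rnorm y ^+ 2 <= M * \int[mu]_s (p s * rnorm (F s) ^+ 2).
Proof.
move=> cV mp mq ip pC Vr qp M0 pM yE.
have p0 s : 0 <= p s <= C by rewrite pC andbT (le_trans (normr_ge0 (q s))).
have iw := integrable_weight mp p0.
have h : rnorm y ^+ 2 <= M / 2 * \int[mu]_s (p s * rnorm (F s) ^+ 2) +
    rnorm y ^+ 2 / (2 * M) * \int[mu]_s p s.
  rewrite -Rintegral_lin// [leLHS]yE; apply: le_Rintegral => //.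
  - exact: integrable_weight_rdot cV mp mq ip pC Vr qp.
  - exact: integrable_lin.
  - move=> s _; apply: le_trans (ler_norm _) _.
    by apply: weight_bound => //; exact: rnorm_ge0.
have : rnorm y ^+ 2 / (2 * M) * \int[mu]_s p s <= rnorm y ^+ 2 / 2.
  rewrite (_ : _ / 2 = rnorm y ^+ 2 / (2 * M) * M); last by field; rewrite gt_eqF.
  by rewrite ler_wpM2l// divr_ge0 ?sqr_ge0//; lra.
move: h; set Q := \int[mu]_s (p s * _); set P := _ * \int[mu]_s p s.
move: (rnorm y ^+ 2) => n; lra.
Qed.

Lemma integral_decayR t : \int[mu]_s decay k t s = `|k|^-1.
Proof. by rewrite /Rintegral integral_decay. Qed.

Lemma hcont_grp_from t G : hcont (fun s => grp B (s - t) G).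
Proof. exact: (hcont_shift t (grp_hcont B G)). Qed.

Lemma integrable_decay_rdot t G :
  mu.-integrable setT (EFin \o (fun s => decay k t s * rdot (F s) (grp B (s - t) G))).
Proof.
apply: (@integrable_weight_rdot _ (decay k t) _ (rnorm G) 1).
- exact: hcont_grp_from.
- exact: measurable_decayr.
- exact: measurable_decayr.
- exact: integrable_decay.
- by move=> s; exact: decay_le1.
- by move=> s; rewrite rnorm_grp.
- by move=> s; rewrite ger0_norm ?decay_ge0.
Qed.

(** The right-hand side is a real-linear functional of G, so only boundedness has to be checked
    before applying [rriesz]. *)
Lemma duhamel_ex t : exists y, forall G,
  rdot y G = \int[mu]_s (decay k t s * rdot (F s) (grp B (s - t) G)).
Proof.
pose C := 1 / 2 * (\int[mu]_s (decay k t s * rnorm (F s) ^+ 2)) +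
    1 / (2 * 1) * \int[mu]_s decay k t s.
have dd s : 0 <= decay k t s <= 1 by rewrite decay_ge0 decay_le1.
have iw := integrable_weight (measurable_decayr k t) dd.
have mZ r G : \int[mu]_s (decay k t s * rdot (F s) (grp B (s - t) (r%:C *: G))) =
    r * \int[mu]_s (decay k t s * rdot (F s) (grp B (s - t) G)).
  rewrite -RintegralZl//; last exact: integrable_decay_rdot.
  by apply: eq_Rintegral => s _; rewrite grpZ rdotZr mulrCA.
apply: (@rriesz _ _ _ C) => // [G G'|G].
  rewrite -RintegralD//; [|exact: integrable_decay_rdot..].
  apply: eq_Rintegral => s _.
  by rewrite -[G in LHS]scale1r grp_lin scale1r rdotDr mulrDr.
(* Young's inequality is not homogeneous in G, so the bound C, obtained with M = 1 and r = 1, is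
   proved for unit vectors and then rescaled. *)
have unit_bound G1 : rnorm G1 = 1 ->
    `|\int[mu]_s (decay k t s * rdot (F s) (grp B (s - t) G1))| <= C.
  move=> G1n; apply: le_trans (le_normr_Rintegral _ (integrable_decay_rdot t G1)) _.
    exact: mT.
  rewrite /C -Rintegral_lin//; last exact: integrable_decay.
  apply: le_Rintegral => //.
  - exact: (integrable_norm (integrable_decay_rdot t G1)).
  - by apply: integrable_lin => //; exact: integrable_decay.
  - move=> s _.
    have := @weight_bound (fun s => grp B (s - t) G1) (decay k t) (decay k t) 1 1 s.
    rewrite expr1n; apply => //; first by rewrite rnorm_grp.
    by rewrite ger0_norm ?decay_ge0.
have [->|Gn] := eqVneq G 0.
  rewrite rnorm0 mulr0 Rintegral_eq0 ?normr0// => s.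
  by rewrite grp_0 rdot0r mulr0.
have n0 : 0 < rnorm G by rewrite lt0r rnorm_eq0 Gn rnorm_ge0.
pose G1 := (rnorm G)^-1%:C *: G.
have GE : (rnorm G)%:C *: G1 = G.
  by rewrite scalerA -rmorphM/= divff ?gt_eqF// scale1r.
have -> : \int[mu]_s (decay k t s * rdot (F s) (grp B (s - t) G)) =
    rnorm G * \int[mu]_s (decay k t s * rdot (F s) (grp B (s - t) G1)).
  by rewrite -mZ GE.
rewrite normrM ger0_norm ?rnorm_ge0// mulrC ler_pM2r// unit_bound//.
by rewrite rnormZc cabsC ger0_norm ?invr_ge0 ?rnorm_ge0// mulVf// gt_eqF.
Qed.

(* The integral of [decay k t s *: grp B (t - s) (F s)] over s, obtained from its
   inner products by the Riesz theorem as Bochner integrals are not available. *)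
Definition duhamel t : H := sval (cid (duhamel_ex t)).

Lemma duhamelP t G :
  rdot (duhamel t) G = \int[mu]_s (decay k t s * rdot (F s) (grp B (s - t) G)).
Proof. by rewrite /duhamel; case: cid. Qed.

(** The vector is paired with itself in [weak_bound]; M is the integral 1/|k| of the kernel. *)
Lemma duhamel_le t :
  rnorm (duhamel t) ^+ 2 <= `|k|^-1 * \int[mu]_s (decay k t s * rnorm (F s) ^+ 2).
Proof.
apply: (@weak_bound (fun s => grp B (s - t) (duhamel t)) (decay k t) (decay k t) _ 1).
- exact: hcont_grp_from.
- exact: measurable_decayr.
- exact: measurable_decayr.
- exact: integrable_decay.
- by move=> s; exact: decay_le1.
- by move=> s; rewrite rnorm_grp.
- by move=> s; rewrite ger0_norm ?decay_ge0.
- by rewrite invr_gt0 normr_gt0.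
- by rewrite integral_decayR.
- by rewrite -rdotxx duhamelP.
Qed.

Lemma duhamel_sup t : rnorm (duhamel t) ^+ 2 <= `|k|^-1 * \int[mu]_s (rnorm (F s) ^+ 2).
Proof.
apply: le_trans (duhamel_le t) _; rewrite ler_wpM2l ?invr_ge0//.
apply: le_Rintegral => //.
- apply: (@integrable_weight _ 1); first exact: measurable_decayr.
  by move=> s; rewrite decay_ge0 decay_le1.
- by move=> s _; rewrite ler_piMl ?sqr_ge0 ?decay_le1.
Qed.

Lemma duhamel_eq0 t : (forall s, 0 < k * (s - t) -> F s = 0) -> duhamel t = 0.
Proof.
move=> F0; apply/eqP; rewrite -rnorm_eq0 -sqrf_eq0 -rdotxx duhamelP.
rewrite Rintegral_eq0// => s; rewrite /decay; case: ifPn => [/F0 ->|_]; last by rewrite mul0r.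
by rewrite rdot0l mulr0.
Qed.

End convolution.

(** * The Duhamel integral: continuity and square integrability *)

Section convolution_regularity.
Context {R : realType} {H : hilbertSpace R} (B : selfadjoint_operator H).
Local Notation mu := (@lebesgue_measure R).
Variables (k : R) (F : R -> H).
Hypothesis k0 : k != 0.
Hypothesis bF : bochner_measurable setT F.
Hypothesis iF : mu.-integrable setT (EFin \o (fun s => rnorm (F s) ^+ 2)).
Implicit Types (t s M C : R) (p q : R -> R) (G y : H).

Let mT : @measurable _ (measurableTypeR R) setT. Proof. exact: measurableT. Qed.

Local Notation Y := (duhamel B k0 bF iF).

(** After multiplication by e^{k (t' - t)} the kernel at t has the same exponential as the one at
    t'. They can differ only for s between t and t', where |t' - s| <= 1 bounds the exponential by
    e^{|k|}. *)
Lemma decay_transport t t' s : `|t' - t| <= 1 ->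
  `|decay k t' s - expR (k * (t' - t)) * decay k t s| <=
  ((fun=> expR `|k|) \_ [set` `[t - `|t' - t|, t + `|t' - t|]]) s.
Proof.
move=> tt.
have key : `|decay k t' s - expR (k * (t' - t)) * decay k t s| != 0 ->
    `|s - t| <= `|t' - t| /\ `|t' - s| <= `|t' - t|.
  have e : expR (k * (t' - t)) * expR (k * (t - s)) = expR (k * (t' - s)).
    by rewrite -expRD; congr expR; ring.
  rewrite /decay; case: ifPn => h1; case: ifPn => h2.
  - by rewrite e subrr normr0 eqxx.
  - move=> _; move: h1 h2; rewrite -leNgt.
    have [kn|kp|kz] := ltgtP k 0; last by move: k0; rewrite kz eqxx.
      rewrite nmulr_rgt0// nmulr_rle0// => ? ?.
      by rewrite !ler_norml; have := ler_norm (t' - t); have := ler_norm (- (t' - t));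
        rewrite normrN => ? ?; split; apply/andP; split; lra.
    rewrite pmulr_rgt0// pmulr_rle0// => ? ?.
    by rewrite !ler_norml; have := ler_norm (t' - t); have := ler_norm (- (t' - t));
      rewrite normrN => ? ?; split; apply/andP; split; lra.
  - move=> _; move: h1 h2; rewrite -leNgt.
    have [kn|kp|kz] := ltgtP k 0; last by move: k0; rewrite kz eqxx.
      rewrite nmulr_rgt0// nmulr_rle0// => ? ?.
      by rewrite !ler_norml; have := ler_norm (t' - t); have := ler_norm (- (t' - t));
        rewrite normrN => ? ?; split; apply/andP; split; lra.
    rewrite pmulr_rgt0// pmulr_rle0// => ? ?.
    by rewrite !ler_norml; have := ler_norm (t' - t); have := ler_norm (- (t' - t));
      rewrite normrN => ? ?; split; apply/andP; split; lra.
  - by rewrite mulr0 subrr normr0 eqxx.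
have [->|nz] := eqVneq `|decay k t' s - expR (k * (t' - t)) * decay k t s| 0.
  by rewrite patchE; case: ifP => // _; exact: expR_ge0.
have [h1 h2] := key nz.
have st : s \in [set` `[t - `|t' - t|, t + `|t' - t|]].
  by rewrite mem_setE in_itv/= -ler_distl.
rewrite patchE st.
have e : expR (k * (t' - t)) * expR (k * (t - s)) = expR (k * (t' - s)).
  by rewrite -expRD; congr expR; ring.
have bd : expR (k * (t' - s)) <= expR `|k|.
  rewrite ler_expR (le_trans (ler_norm _))// normrM ler_piMr//.
  exact: le_trans h2 tt.
rewrite /decay; case: ifPn => _; case: ifPn => _.
- by rewrite e subrr normr0 expR_ge0.
- by rewrite mulr0 subr0 ger0_norm ?expR_ge0.
- by rewrite e sub0r normrN ger0_norm ?expR_ge0.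
- by rewrite mulr0 subr0 normr0 expR_ge0.
Qed.

(** The value at t' minus the value at t carried along the flow is an integral over times between t
    and t' only. [weak_bound] applies with M equal to the integral of the bounding weight, of order
    |t' - t|; this gives continuity. *)
Lemma duhamel_transport t t' : `|t' - t| <= 1 -> t' != t ->
  rnorm (Y t' - expflow B k t (Y t) t') ^+ 2 <=
  2 * expR `|k| ^+ 2 * `|t' - t| * \int[mu]_s (rnorm (F s) ^+ 2).
Proof.
move=> tt nt; set d := Y t' - _.
have dt0 : 0 < `|t' - t| by rewrite normr_gt0 subr_eq0.
have dt2 : 0 < 2 * `|t' - t| by rewrite mulr_gt0.
pose J := [set` `[t - `|t' - t|, t + `|t' - t|]].
have mJ : @measurable _ (measurableTypeR R) J by exact: measurable_itv.
pose p : R -> R := (fun=> expR `|k|) \_ J.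
pose q s := decay k t' s - expR (k * (t' - t)) * decay k t s.
have mp : measurable_fun setT p.
  have := (measurable_restrictT (fun=> expR `|k|) mJ).1; apply.
  exact: measurable_cst.
have mq : measurable_fun setT q.
  apply: measurable_funB; first exact: measurable_decayr.
  by apply: measurable_funM => //; exact: measurable_decayr.
have muJ : mu J = (2 * `|t' - t|)%:E.
  rewrite /J lebesgue_measure_itv/= lte_fin ifT; last by lra.
  by rewrite -EFinD; congr EFin; ring.
have ip : mu.-integrable setT (EFin \o p).
  rewrite -restrict_EFin; apply/integrable_restrict => //=; rewrite setTI.
  apply: continuous_compact_integrable; first exact: segment_compact.
  by apply: continuous_subspaceT; exact: cst_continuous.
have intp : \int[mu]_s p s = expR `|k| * (2 * `|t' - t|).
  rewrite -Rintegral_mkcond Rintegral_cst//; congr (_ * _).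
  exact: (congr1 fine muJ).
have pC s : p s <= expR `|k|.
  by rewrite /p patchE; case: ifP => // _; exact: expR_ge0.
have qp s : `|q s| <= p s by exact: decay_transport.
have dE G : rdot d G = \int[mu]_s (q s * rdot (F s) (grp B (s - t') G)).
  rewrite /d rdotBl (duhamelP B k0 bF iF t' G) rdot_expflow (duhamelP B k0 bF iF t).
  rewrite -RintegralZl//; last exact: integrable_decay_rdot.
  rewrite -RintegralB//; last 2 first.
  - exact: integrable_decay_rdot.
  - exact: (integrableZl mT (expR (k * (t' - t)))
      (integrable_decay_rdot B k0 bF iF t (grp B (t - t') G))).
  apply: eq_Rintegral => s _; rewrite -grpD addrA subrK /q; ring.
have := @weak_bound _ _ F bF iF (fun s => grp B (s - t') d) p q d (expR `|k|)
  (expR `|k| * (2 * `|t' - t|)).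
move=> h; apply: le_trans (h _ _ _ _ _ _ _ _ _ _) _ => //.
- exact: hcont_grp_from.
- by move=> s; rewrite rnorm_grp.
- by rewrite mulr_gt0 ?expR_gt0.
- by rewrite intp.
- by rewrite -dE rdotxx.
have : \int[mu]_s (p s * rnorm (F s) ^+ 2) <=
    expR `|k| * \int[mu]_s (rnorm (F s) ^+ 2).
  rewrite -RintegralZl//; apply: le_Rintegral => //.
  - apply: (integrable_weight (C := expR `|k|) iF mp) => s; rewrite pC andbT.
    exact: le_trans (normr_ge0 _) (qp s).
  - exact: (integrableZl mT _ iF).
  - by move=> s _; rewrite ler_wpM2r ?sqr_ge0.
set Q := \int[mu]_s (p s * _); set N := \int[mu]_s (_ ^+ 2) => QN.
rewrite (_ : 2 * _ * _ * N = expR `|k| * (2 * `|t' - t|) * (expR `|k| * N)).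
  by rewrite ler_wpM2l// mulr_ge0 ?expR_ge0// ltW.
by ring.
Qed.

Lemma duhamel_hcont : hcont Y.
Proof.
move=> t e e0; have e2 : 0 < e / 2 by lra.
have [d d0 dP] := expflow_hcont B k t (Y t) t e2.
pose N := 2 * expR `|k| ^+ 2 * \int[mu]_s (rnorm (F s) ^+ 2).
have N0 : 0 <= N.
  rewrite mulr_ge0 ?mulr_ge0 ?sqr_ge0 ?expR_ge0//.
  by apply: Rintegral_ge0 => s _; exact: sqr_ge0.
pose d' := (e / 2) ^+ 2 / (N + 1).
have d'0 : 0 < d' by rewrite divr_gt0 ?exprn_gt0//; lra.
exists (Num.min (Num.min d d') 1); first by rewrite !lt_min d0 d'0 ltr01.
move=> s; rewrite !lt_min => /andP[/andP[sd sd'] s1].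
have [->|st] := eqVneq s t; first by rewrite subrr rnorm0.
have := duhamel_transport (ltW s1) st; have := dP s sd; rewrite expflow_start => h1 h2.
have h3 : rnorm (Y s - expflow B k t (Y t) s) < e / 2.
  rewrite -(@ltr_pXn2r _ 2) ?nnegrE ?rnorm_ge0 ?ltW//.
  apply: le_lt_trans h2 _; rewrite mulrAC -/N.
  move: sd'; rewrite /d' ltr_pdivlMr; last by lra.
  have := normr_ge0 (s - t); nra.
have := rnorm_triangle (expflow B k t (Y t) s) (Y s) (Y t); lra.
Qed.

Lemma tonelli_decay (a : R -> R) : measurable_fun setT a -> (forall s, 0 <= a s) ->
  (\int[mu]_t \int[mu]_s (decay k t s * a s)%:E =
   `|k|^-1%:E * \int[mu]_s (a s)%:E)%E.
Proof.
move=> ma a0.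
rewrite (@fubini_tonelli _ _ (measurableTypeR R) (measurableTypeR R) R mu mu
  (fun z => (decay k z.1 z.2 * a z.2)%:E)).
- transitivity (\int[mu]_s (`|k|^-1%:E * (a s)%:E))%E.
    apply: eq_integral => s _ /=.
    transitivity (\int[mu]_t ((a s)%:E * (decay k t s)%:E))%E.
      by apply: eq_integral => t _; rewrite mulrC EFinM.
    rewrite ge0_integralZl//.
    + by rewrite integral_decay_left// muleC.
    + apply/measurable_EFinP; have := measurable_decayr (- k) s.
      rewrite (_ : decay (- k) s = (fun t => decay k t s))//.
      by apply/funext => t; rewrite -decay_sym.
    + by move=> t _; rewrite lee_fin decay_ge0.
    + by rewrite lee_fin.
  rewrite ge0_integralZl//.
  + exact/measurable_EFinP.
  + by move=> s _; rewrite lee_fin.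
- apply/measurable_EFinP; apply: measurable_funM; first exact: measurable_decay.
  by apply: measurableT_comp => //; exact: measurable_snd.
- by move=> z; rewrite lee_fin mulr_ge0 ?decay_ge0.
Qed.

Lemma measurable_sqrF : measurable_fun setT (fun s => rnorm (F s) ^+ 2).
Proof. by apply/measurable_EFinP; exact: (measurable_int mu iF). Qed.

Lemma continuous_rnorm (v : R -> H) : hcont v -> continuous (fun t => rnorm (v t)).
Proof.
move=> cv t; apply/cvgrPdist_lt => e e0; have [d d0 dP] := cv t e e0.
apply/nbhs_ballP; exists d => // s /=; rewrite /ball/= distrC => /dP.
by apply: le_lt_trans; rewrite distrC; exact: rnorm_dist.
Qed.

Lemma measurable_sqr_hcont (v : R -> H) : hcont v ->
  measurable_fun setT (fun t => rnorm (v t) ^+ 2).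
Proof.
move=> cv; apply: measurable_funX; apply: continuous_measurable_fun.
exact: continuous_rnorm.
Qed.

(** One factor 1/|k| comes from the pointwise bound [duhamel_le], the other from integrating the
    kernel over t after exchanging the integrals. *)
Lemma duhamel_L2 : mu.-integrable setT (EFin \o (fun t => rnorm (Y t) ^+ 2)) /\
  \int[mu]_t (rnorm (Y t) ^+ 2) <= `|k|^-1 ^+ 2 * \int[mu]_s (rnorm (F s) ^+ 2).
Proof.
have mY := measurable_sqr_hcont duhamel_hcont.
have main : (\int[mu]_t (rnorm (Y t) ^+ 2)%:E <=
    (`|k|^-1 ^+ 2 * \int[mu]_s (rnorm (F s) ^+ 2))%:E)%E.
  have -> : ((`|k|^-1 ^+ 2 * \int[mu]_s (rnorm (F s) ^+ 2))%:E =
      `|k|^-1%:E * (\int[mu]_t \int[mu]_s (decay k t s * rnorm (F s) ^+ 2)%:E))%E.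
    rewrite tonelli_decay; [|exact: measurable_sqrF|by move=> s; exact: sqr_ge0].
    rewrite muleA -EFinM -expr2 EFinM; congr (_ * _)%E.
    by rewrite /Rintegral fineK//; exact: (integrable_fin_num mT iF).
  have mtF : measurable_fun setT (fun t => (\int[mu]_s (decay k t s * rnorm (F s) ^+ 2)%:E)%E).
    apply: (measurable_fun_fubini_tonelli_F (m2 := mu)
      (fun z : measurableTypeR R * measurableTypeR R =>
        (decay k z.1 z.2 * rnorm (F z.2) ^+ 2)%:E)).
    - apply/measurable_EFinP; apply: measurable_funM; first exact: measurable_decay.
      by apply: (measurableT_comp measurable_sqrF); exact: measurable_snd.
    - by move=> z; rewrite lee_fin mulr_ge0 ?decay_ge0 ?sqr_ge0.
  have inner0 t : (0 <= \int[mu]_s (decay k t s * rnorm (F s) ^+ 2)%:E)%E.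
    by apply: integral_ge0 => s _; rewrite lee_fin mulr_ge0 ?decay_ge0 ?sqr_ge0.
  have c0 : (0 <= `|k|^-1%:E)%E by rewrite lee_fin invr_ge0.
  rewrite -(@ge0_integralZl _ _ _ mu _ mT _ mtF _ (fun t _ => inner0 t) c0).
  apply: ge0_le_integral => //.
  - by move=> t _; rewrite lee_fin sqr_ge0.
  - exact/measurable_EFinP.
  - by apply: measurable_funeM.
  move=> t _; have := duhamel_le B k0 bF iF t; rewrite -lee_fin => /le_trans; apply.
  rewrite EFinM /Rintegral fineK//; apply: (integrable_fin_num mT).
  apply: (integrable_weight (C := 1) iF (measurable_decayr k t)) => s.
  by rewrite decay_ge0 decay_le1.
have iY : mu.-integrable setT (EFin \o (fun t => rnorm (Y t) ^+ 2)).
  apply/integrableP; split; first exact/measurable_EFinP.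
  under eq_integral do rewrite /= ger0_norm ?sqr_ge0//.
  by apply: le_lt_trans main _; rewrite ltry.
split=> //; rewrite -lee_fin; apply: le_trans main.
by rewrite /Rintegral fineK//; exact: (integrable_fin_num mT iY).
Qed.

End convolution_regularity.

(** * The Duhamel integral solves the inhomogeneous weak equation *)

Section duhamel_weak.
Context {R : realType} {H : hilbertSpace R} (B : selfadjoint_operator H).
Local Notation mu := (@lebesgue_measure R).
Variables (k : R) (F : R -> H).
Hypothesis k0 : k != 0.
Hypothesis bF : bochner_measurable setT F.
Hypothesis iF : mu.-integrable setT (EFin \o (fun s => rnorm (F s) ^+ 2)).
Implicit Types (t s M C : R) (p q : R -> R) (G y : H).

Let mT : @measurable _ (measurableTypeR R) setT. Proof. exact: measurableT. Qed.
Local Notation Y := (duhamel B k0 bF iF).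

Lemma hcont_cst y : hcont (fun=> y).
Proof. by move=> t e e0; exists 1 => // s _; rewrite subrr rnorm0. Qed.

Lemma EFin_Rintegral (f : R -> R) : mu.-integrable setT (EFin \o f) ->
  (\int[mu]_s f s)%:E = (\int[mu]_s (f s)%:E)%E.
Proof. by move=> fi; rewrite /Rintegral fineK; last exact: integrable_fin_num. Qed.

Section test.
Variables (phi phi' : R -> R) (G1 G2 : H) (M : R).
Hypothesis cphi : continuous phi.
Hypothesis cphi' : continuous phi'.
Hypothesis phi0 : forall t, M < `|t| -> phi t = 0 /\ phi' t = 0.

Let X t : H := (phi' t)%:C *: G1 + (phi t)%:C *: G2.

Lemma hcont_test : hcont X.
Proof. by apply: hcontD; apply: hcontZ => //; exact: hcont_cst. Qed.

Let W t s : R := decay k t s * rdot (F s) (grp B (s - t) (X t)).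

Lemma measurable_kernel :
  measurable_fun setT (fun z : measurableTypeR R * measurableTypeR R => W z.1 z.2).
Proof.
apply: measurable_funM; first exact: measurable_decay.
have mfst : measurable_fun setT (fst : measurableTypeR R * measurableTypeR R -> measurableTypeR R).
  exact: measurable_fst.
have msnd : measurable_fun setT (snd : measurableTypeR R * measurableTypeR R -> measurableTypeR R).
  exact: measurable_snd.
have := @measurable_rdot R H _ (measurableTypeR R * measurableTypeR R)%type setT
  snd F (fun z => grp B (z.2 - z.1) (X z.1)) msnd mT bF.
rewrite preimage_setT; apply => y.
have mg g : measurable_fun setT
    (fun z : measurableTypeR R * measurableTypeR R => rdot y (grp B (z.2 - z.1) g)).
  apply: (@measurableT_comp _ _ _ _ _ _ (fun t => rdot y (grp B t g)) _
    (fun z : measurableTypeR R * measurableTypeR R => z.2 - z.1)).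
    apply: continuous_measurable_fun.
    have -> : (fun t => rdot y (grp B t g)) = (fun t => rdot (grp B t g) y).
      by apply/funext => z; exact: rdotC.
    exact/hcont_rdot/grp_hcont.
  exact: measurable_funB.
have -> : (fun z : measurableTypeR R * measurableTypeR R =>
    rdot y (grp B (z.2 - z.1) (X z.1))) =
  (fun z : measurableTypeR R * measurableTypeR R =>
    phi' z.1 * rdot y (grp B (z.2 - z.1) G1) +
    phi z.1 * rdot y (grp B (z.2 - z.1) G2)).
  apply/funext => z; rewrite /X grp_lin grpZ rdotDr !rdotZr //.
apply: measurable_funD; apply: measurable_funM => //.
  by apply: measurableT_comp => //; exact: continuous_measurable_fun.
by apply: measurableT_comp => //; exact: continuous_measurable_fun.
Qed.

Lemma integrable_sqr_test : mu.-integrable setT (EFin \o (fun t => rnorm (X t) ^+ 2)).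
Proof.
apply: (@compact_support_integrable _ _ M) => //.
  move=> t; have ct := continuous_rnorm hcont_test.
  have -> : (fun t => rnorm (X t) ^+ 2) = (fun t => rnorm (X t) * rnorm (X t)).
    by apply/funext => u; rewrite expr2.
  by apply: cvgM; exact: ct.
move=> t /phi0[p0 p1]; rewrite /X p0 p1 !scale0r addr0 rnorm0 expr0n //.
Qed.

(** The kernel is dominated by decay(t, s) (|X t|^2 + |F s|^2). Each summand depends on one variable
    apart from [decay], which integrates to 1/|k| in the other. *)
Lemma integrable_kernel : (mu \x mu)%E.-integrable setT
  (EFin \o (fun z : measurableTypeR R * measurableTypeR R => W z.1 z.2)).
Proof.
have mX := measurable_sqr_hcont hcont_test.
have mF := measurable_sqrF iF.
pose g (z : measurableTypeR R * measurableTypeR R) := decay k z.1 z.2 * rnorm (X z.1) ^+ 2.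
pose h (z : measurableTypeR R * measurableTypeR R) := decay k z.1 z.2 * rnorm (F z.2) ^+ 2.
have ig : (mu \x mu)%E.-integrable setT (EFin \o g).
  apply/integrable12ltyP.
    apply/measurable_EFinP; apply: measurable_funM; first exact: measurable_decay.
    by apply: (measurableT_comp mX); exact: measurable_fst.
  have -> : (\int[mu]_x \int[mu]_y `|(EFin \o g) (x, y)| =
      \int[mu]_x (`|k|^-1%:E * (rnorm (X x) ^+ 2)%:E))%E.
    apply: eq_integral => x _.
    transitivity (\int[mu]_y ((rnorm (X x) ^+ 2)%:E * (decay k x y)%:E))%E.
      apply: eq_integral => y _; rewrite /g /= ger0_norm ?mulr_ge0 ?decay_ge0 ?rnorm_ge0//.
      by rewrite mulrC EFinM.
    rewrite ge0_integralZl//.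
    + by rewrite integral_decay// muleC.
    + apply/measurable_EFinP; exact: measurable_decayr.
    + by move=> t _; rewrite lee_fin decay_ge0.
    + by rewrite lee_fin sqr_ge0.
  have /integrableP[_] := integrableZl mT `|k|^-1 integrable_sqr_test.
  apply: le_lt_trans; apply: ge0_le_integral => //.
  - by move=> x _; rewrite -EFinM lee_fin mulr_ge0 ?invr_ge0 ?sqr_ge0.
  - by apply/measurable_EFinP; exact: measurable_funM.
  - apply: measurableT_comp => //; apply/measurable_EFinP; exact: measurable_funM.
  - by move=> x _; exact: lee_abs.
have ih : (mu \x mu)%E.-integrable setT (EFin \o h).
  apply/integrable12ltyP.
    apply/measurable_EFinP; apply: measurable_funM; first exact: measurable_decay.
    by apply: (measurableT_comp mF); exact: measurable_snd.
  have -> : (\int[mu]_x \int[mu]_y `|(EFin \o h) (x, y)| =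
      `|k|^-1%:E * \int[mu]_y (rnorm (F y) ^+ 2)%:E)%E.
    rewrite -tonelli_decay//; last by move=> s; exact: sqr_ge0.
    apply: eq_integral => x _; apply: eq_integral => y _.
    by rewrite /h /= ger0_norm ?mulr_ge0 ?decay_ge0 ?rnorm_ge0.
  rewrite -[X in (_ * X)%E]fineK; last exact: (integrable_fin_num mT iF).
  by rewrite -EFinM ltry.
apply: (le_integrable measurableT _ _ (integrableD measurableT ig ih)).
  by apply/measurable_EFinP; exact: measurable_kernel.
move=> [t s] _ /=; rewrite lee_fin /W /g /h /=.
rewrite [leRHS]ger0_norm; last by rewrite addr_ge0 ?mulr_ge0 ?decay_ge0 ?rnorm_ge0.
rewrite normrM ger0_norm ?decay_ge0// -mulrDr ler_wpM2l ?decay_ge0//.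
rewrite (le_trans (rdot_le _ _))// rnorm_grp.
have := sqr_ge0 (rnorm (F s) - rnorm (X t)).
have := rnorm_ge0 (F s); have := rnorm_ge0 (X t).
set a := rnorm _; set b := rnorm _; nra.
Qed.

(** Fubini exchanges the defining integral over s with that over t, so that for fixed s only a
    single trajectory is paired with the test vector. *)
Lemma integral_duhamel_test (c : R -> R) :
  (forall s, mu.-integrable setT (EFin \o (fun t => W t s)) /\
    \int[mu]_t W t s = c s) ->
  \int[mu]_t rdot (Y t) (X t) = \int[mu]_s c s.
Proof.
move=> Wc.
transitivity (fine (\int[mu]_t \int[mu]_s (W t s)%:E)%E).
  congr fine; apply: eq_integral => t _.
  rewrite -(EFin_Rintegral (integrable_decay_rdot B k0 bF iF t (X t))).
  by congr EFin; exact: duhamelP.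
have := @Fubini _ _ (measurableTypeR R) (measurableTypeR R) R mu mu _ integrable_kernel.
rewrite /= => ->; congr fine; apply: eq_integral => s _.
by have [iW <-] := Wc s; rewrite EFin_Rintegral.
Qed.

End test.

(** For fixed s the integrand in t is, on the side k (s - t) > 0, the derivative of phi(t) <v(t), i
    G> along the flow v with v(s) = F s. Integrating up to t = s leaves the source term phi(s) <F s,
    i G>, with the sign of k; hence the factor [Num.sg k]. *)
Lemma duhamel_weak I : weak_shift B k I
  (fun t => (Num.sg k)%:C *: ('i *: Y t)) F.
Proof.
pose y : R -> H := fun t => (Num.sg k)%:C *: ('i *: Y t).
suff : weak_shift B k I y F by [].
move=> phi G tphi BG.
have sphi := smooth_test tphi.
have cphi := smooth_continuous sphi.
have cphi' := smooth_continuous (smooth_derive1 sphi).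
have [M _ MP] := test_support tphi.
have phi0 t : M < `|t| -> phi t = 0 /\ derive1 phi t = 0.
  by move=> h; exact: MP (or_intror h).
pose G1 : H := 'i *: G; have BG1 : dom B G1 by exact: domZ.
(* Chosen so that pairing a trajectory of the flow with X = phi' G1 + phi G2 gives exactly the
   derivative of phi <v, G1>. *)
pose G2 : H := k%:C *: G1 - 'i *: B G1.
pose X t : H := (derive1 phi t)%:C *: G1 + (phi t)%:C *: G2.
have sg2 : Num.sg k * Num.sg k = 1 by rewrite -expr2 sqr_sg k0.
have key : \int[mu]_t rdot (Y t) (X t) =
    \int[mu]_s (Num.sg k * (phi s * rdot (F s) G1)).
  apply: (@integral_duhamel_test phi (derive1 phi) G1 G2 M cphi cphi' phi0) => s.
  have [cn dn [M' n0]] := test_mul_expflow k s (F s) tphi BG1.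
  set n' := (fun t => _) in cn dn n0.
  pose S := [set t : R | 0 < k * (s - t)].
  have WE : (fun t => decay k t s * rdot (F s) (grp B (s - t) (X t))) =
      n' \_ S.
    apply/funext => t; rewrite patchE /decay.
    have -> : (t \in S) = (0 < k * (s - t)) by apply/idP/idP; rewrite inE.
    case: ifPn => _; last by rewrite mul0r.
    rewrite -[s - t]opprB -rdot_grp /n' /expflow !rdotZl /X /G2.
    by rewrite !(rdotDr, rdotBr, rdotZr); ring.
  have [kn|kp|kz] := ltgtP k 0; last by move: k0; rewrite kz eqxx.
    have SE : S = `]s, +oo[%classic.
      by apply/seteqP; split=> t; rewrite /S /= in_itv/= nmulr_rgt0// subr_lt0 andbT.
    rewrite WE SE -Rintegral_mkcond (integral_derive_right cn dn n0) expflow_start.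
    split; last by rewrite ltr0_sg// mulN1r.
    rewrite -restrict_EFin; apply/integrable_restrict => //=; rewrite setTI.
    by apply: (compact_support_integrable _ cn (fun t h => (n0 t h).2)); exact: measurable_itv.
  have SE : S = `]-oo, s[%classic.
    by apply/seteqP; split=> t; rewrite /S /= in_itv/= pmulr_rgt0// subr_gt0.
  rewrite WE SE -Rintegral_mkcond (integral_derive_left cn dn n0) expflow_start.
  split; last by rewrite gtr0_sg// mul1r.
  rewrite -restrict_EFin; apply/integrable_restrict => //=; rewrite setTI.
  by apply: (compact_support_integrable _ cn (fun t h => (n0 t h).2)); exact: measurable_itv.
have iFG : mu.-integrable setT (EFin \o (fun s => phi s * rdot (F s) G1)).
  have hF : F \in sq_integrable `]-oo, +oo[.
    by apply/sq_integrableP; rewrite set_itvE.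
  have := @integrable_test R H _ (PreL2 hF) phi M G1 cphi (fun t h => (phi0 t h).1).
  by rewrite set_itvE.
rewrite RintegralZl// in key.
have supp (f : R -> R) : (forall t, ~ [set` I] t -> f t = 0) ->
    \int[mu]_(t in [set` I]) f t = \int[mu]_t f t.
  by move=> f0; apply/esym/eq_Rintegral_supp => // t _; exact: f0.
rewrite !supp; last 2 first.
- by move=> t /or_introl/MP[-> _]; rewrite mul0r.
- by move=> t /or_introl/MP[_ ->]; rewrite mul0r.
have cY := duhamel_hcont B k0 bF iF.
have cy g : continuous (fun t => rdot (y t) g).
  apply: hcont_rdot.
  apply: (@hcontZ _ _ (fun=> Num.sg k) (fun t => 'i *: Y t)).
    exact: cst_continuous.
  move=> t e /(cY t)[d d0 dP]; exists d => // s /dP.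
  by rewrite -scalerBr rnormZc cabsi mul1r.
have i1 : mu.-integrable setT (EFin \o (fun t => derive1 phi t * rdot (y t) G)).
  apply: (@compact_support_integrable _ _ M) => // [t|t /phi0[_ ->]].
    by apply: cvgM; [exact: cphi'|exact: cy].
  by rewrite mul0r.
have i2 : mu.-integrable setT (EFin \o (fun t =>
    phi t * (rdot (y t) ('i *: B G) - k * rdot (y t) G))).
  apply: (@compact_support_integrable _ _ M) => // [t|t /phi0[-> _]].
    apply: cvgM; first exact: cphi.
    by apply: cvgB; [exact: cy|apply: cvgM; [exact: cvg_cst|exact: cy]].
  by rewrite mul0r.
have -> : \int[mu]_t (phi t * (rdot (y t) ('i *: B G) - k * rdot (y t) G - rdot (F t) ('i *: G)))
   = \int[mu]_t (phi t * (rdot (y t) ('i *: B G) - k * rdot (y t) G)) -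
     \int[mu]_t (phi t * rdot (F t) G1).
  rewrite -RintegralB//; apply: eq_Rintegral => t _; rewrite /G1; ring.
suff h : \int[mu]_t (derive1 phi t * rdot (y t) G) -
    \int[mu]_t (phi t * (rdot (y t) ('i *: B G) - k * rdot (y t) G)) =
    - Num.sg k * \int[mu]_t rdot (Y t) (X t).
  rewrite key mulNr mulrA sg2 mul1r in h.
  by apply/eqP; rewrite addrC -subr_eq; apply/eqP.
rewrite -RintegralB// -RintegralZl//; last first.
  apply: (@compact_support_integrable _ _ M) => // [t|t /phi0[p0 p1]].
    have -> : (fun t => rdot (Y t) (X t)) = (fun t =>
        derive1 phi t * rdot (Y t) G1 + phi t * rdot (Y t) G2).
      by apply/funext => u; rewrite /X rdotDr !rdotZr.
    by apply: cvgD; apply: cvgM; [exact: cphi'|exact: (hcont_rdot cY)|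
      exact: cphi|exact: (hcont_rdot cY)].
  by rewrite /X p0 p1 !scale0r addr0 rdot0r.
apply: eq_Rintegral => t _; rewrite /y /X /G2 /G1 opZ//.
rewrite !(rdotZl, rdotil, rdotDr, rdotBr, rdotNr, rdotZr) scaleii; ring.
Qed.

End duhamel_weak.

(** * Uniqueness of weak solutions *)

Lemma is_derive_epsP (R : realType) (f : R -> R) (x l e : R) :
  is_derive x 1 f l -> 0 < e -> exists2 d, 0 < d &
  forall h, `|h| < d -> `|f (x + h) - f x - h * l| <= e * `|h|.
Proof.
move=> fl e0.
have dl : (fun h => h^-1 *: (f (h *: 1 + x) - f x)) @ 0^' --> l.
  by case: fl => /[swap] <-; exact.
have /cvgrPdist_le/(_ _ e0) := dl.
move=> /nbhs_ballP[d /= d0 dP]; exists d => // h hd.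
have [->|h0] := eqVneq h 0.
  by rewrite addr0 subrr mul0r subrr !normr0 mulr0.
have := dP h; rewrite /ball/= sub0r normrN => /(_ hd h0).
rewrite /GRing.scale/= mulr1 (addrC h) -(@ler_pM2r _ `|h|) ?normr_gt0//.
apply: le_trans; rewrite -normrM -normrN le_eqVlt; apply/orP; left.
by apply/eqP; congr `|_|; field.
Qed.

Section uniqueness.
Context {R : realType} {H : hilbertSpace R} (B : selfadjoint_operator H).
Local Notation mu := (@lebesgue_measure R).
Implicit Types (k t s c d : R) (G g : H).

Lemma expflow_add k s (r : R) (c : H) t : expflow B k r (expflow B k s c r) t = expflow B k s c t.
Proof.
rewrite /expflow grpZ scalerA -grpD -rmorphM/= -expRD.
by congr ((expR _)%:C *: grp _ _ _); ring.
Qed.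

Lemma test_functionS (I J : interval R) phi : [set` J] `<=` [set` I] ->
  test_function J phi -> test_function I phi.
Proof.
move=> JI [dphi [K [cK KJ K0]]]; split=> //; exists K; split=> //.
exact: subset_trans JI.
Qed.

Lemma within_rdot (A : set R) (v : R -> H) g : {within A, continuous v} ->
  {within A, continuous (fun t => rdot (v t) g)}.
Proof.
move=> cv; apply/subspace_continuousP => t At; apply/cvgrPdist_lt => e e0.
have g1 : 0 < rnorm g + 1 by rewrite ltr_wpDl ?rnorm_ge0.
have [|d d0 dP] := within_hcont cv At (e := e / (rnorm g + 1)).
  by rewrite divr_gt0.
apply/nbhs_ballP; exists d => // s /=; rewrite /ball/= distrC => st As.
have := dP s As st; rewrite distrC -rdotBl ltr_pdivlMr// => h.
rewrite (le_lt_trans (rdot_le _ _))//.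
have := rnorm_ge0 (v s - v t); nra.
Qed.

Lemma eq_Rintegral_ae (D : set R) (f g : R -> R) :
  @measurable _ (measurableTypeR R) D ->
  mu.-integrable D (EFin \o f) -> mu.-integrable D (EFin \o g) ->
  (\forall t \ae mu, D t -> f t = g t) ->
  \int[mu]_(t in D) f t = \int[mu]_(t in D) g t.
Proof.
move=> mD fi gi fg; rewrite /Rintegral; congr fine; apply: ae_eq_integral => //.
- exact: measurable_int fi.
- exact: measurable_int gi.
- by apply: filterS fg => t fg Dt /=; rewrite fg.
Qed.

Section solution.
Variables (I : interval R) (u : preL2 H I) (v : R -> H) (k : R).
Hypothesis oI : open [set` I].
Hypothesis uv : \forall t \ae mu, [set` I] t -> v t = u t.
Hypothesis cv : {within closure [set` I], continuous v}.
Hypothesis wu : weak_shift B k I u (fun=> 0).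

(** On a segment around t inside I, the scalar function <v, G> is continuous with a continuous weak
    derivative, so [weak_derivative_continuous] applies. *)
Lemma is_derive_weak_solution G t : dom B G -> [set` I] t ->
  is_derive t 1 (fun t => rdot (v t) G) (k * rdot (v t) G - rdot (v t) ('i *: B G)).
Proof.
move=> BG It.
have /nbhs_ballP[e /= e0 eI] := open_nbhs_nbhs (conj oI It).
pose c := t - e / 2; pose d := t + e / 2.
have sub : `[c, d] `<=` [set` I].
  move=> s; rewrite /= in_itv/= => /andP[cs sd]; apply: eI.
  by rewrite ball_itv/= in_itv/=; apply/andP; rewrite /c /d in cs sd; split; lra.
have cvd : {within `[c, d], continuous v}.
  by apply: continuous_subspaceW cv => s /sub; exact: subset_closure.
pose Kf s := rdot (v s) ('i *: B G) - k * rdot (v s) G.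
have cF := @within_rdot _ _ G cvd.
have cK : {within `[c, d], continuous Kf}.
  move=> s; apply: cvgB; first exact: (@within_rdot _ _ ('i *: B G) cvd).
  by apply: cvgM; [exact: cvg_cst|exact: cF].
have sub' : [set` `]c, d[] `<=` [set` I].
  by apply: subset_trans sub; apply: subset_itv; rewrite bnd_simp.
have mcd : @measurable _ (measurableTypeR R) [set` `]c, d[] by exact: measurable_itv.
have tcd : c < t < d by rewrite /c /d; apply/andP; split; lra.
rewrite -[X in is_derive _ _ _ X]opprK opprB.
apply: (weak_derivative_continuous cF cK _ tcd) => phi tphi.
have tphiI := test_functionS sub' tphi.
have sphi := smooth_test tphi.
have cphi := smooth_continuous sphi.
have cphi' := smooth_continuous (smooth_derive1 sphi).
have [M _ MP] := test_support tphi.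
have phi0 s : M < `|s| -> phi s = 0 by move=> h; case: (MP s (or_intror h)).
have phi1 s : M < `|s| -> derive1 phi s = 0 by move=> h; case: (MP s (or_intror h)).
have iv (f psi : R -> R) : continuous psi -> {within `[c, d], continuous f} ->
    mu.-integrable `]c, d[ (EFin \o (fun s => psi s * f s)).
  move=> cpsi cf; apply: (@integrable_within _ (fun s => psi s * f s) c d) => //.
  move=> s; apply: cvgM; last exact: cf.
  exact: (continuous_subspaceT cpsi).
have iu (psi : R -> R) G' : continuous psi -> (forall s, M < `|s| -> psi s = 0) ->
    mu.-integrable `]c, d[ (EFin \o (fun s => psi s * rdot (u s) G')).
  move=> cpsi psi0; have := @integrable_test R H I u psi M G' cpsi psi0.
  by apply: integrableS => //; exact: measurable_itv.
have uvc : \forall t \ae mu, [set` `]c, d[] t -> v t = u t.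
  by apply: filterS uv => s h /sub'.
have restr (f : R -> R) : (forall s, ~ [set` `]c, d[] s -> f s = 0) ->
    \int[mu]_(s in [set` I]) f s = \int[mu]_(s in `]c, d[) f s.
  by move=> f0; apply: eq_Rintegral_supp => // s _; exact: f0.
have := wu tphiI BG; rewrite !restr; last 2 first.
- by move=> s /or_introl/MP[-> _]; rewrite mul0r.
- by move=> s /or_introl/MP[_ ->]; rewrite mul0r.
move=> wuE; transitivity (\int[mu]_(s in `]c, d[) (derive1 phi s * rdot (u s) G)).
  apply: eq_Rintegral_ae => //; [exact: iv|exact: iu|].
  by apply: filterS uvc => s h Is /=; rewrite (h Is).
rewrite wuE; apply: eq_Rintegral_ae => //; last 2 first.
- exact: iv.
- by apply: filterS uvc => s h Is /=; rewrite /Kf (h Is) rdot0l subr0.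
have := integrable_lin 1 (- k) mcd (iu phi ('i *: B G) cphi phi0) (iu phi G cphi phi0).
by congr (_.-integrable _ (_ \o _)); apply/funext => s; rewrite rdot0l; ring.
Qed.

(** The second factor is the adjoint of the inverse flow applied to g, so the pairing is that of g
    with v transported back to time 0. The derivatives of the two factors contribute opposite terms
    <v, w1>. *)
Lemma rdot_transported_derive g t : dom B g -> [set` I] t ->
  is_derive t 1 (fun t => rdot (v t) (expflow B (- k) 0 g t)) 0.
Proof.
move=> Bg It.
pose w := expflow B (- k) 0 g.
pose g1 := k%:C *: g - 'i *: B g.
pose w1 := expflow B (- k) 0 g1.
have Bw s : dom B (w s) by apply: domZ; case: (grp_dom (s - 0) Bg).
have w1E s : k%:C *: w s - 'i *: B (w s) = w1 s.
  have [dg ge] := grp_dom (s - 0) Bg.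
  rewrite /w /w1 /expflow opZ// ge /g1 grpB !grpZ !scalerBr !scalerA.
  by rewrite (mulrC k%:C) (mulrC 'i).
have dv G s : dom B G -> [set` I] s ->
    is_derive s 1 (fun t => rdot (v t) G) (rdot (v s) (k%:C *: G - 'i *: B G)).
  move=> BG Is; have := is_derive_weak_solution BG Is.
  by rewrite rdotBr rdotZr.
(* Moving the flow onto the fixed vector v(t) writes this as the pairing of g with an [expflow] at
   time -s; the affine substitution gives the sign. *)
have dw : is_derive t 1 (fun s => rdot (v t) (w s)) (- rdot (v t) (w1 t)).
  have h := is_derive_rdot_expflow k 0 (v t) (-1 * t + 0) Bg.
  have := is_derive_affine h.
  have e1 s G : rdot (expflow B k 0 (v t) (-1 * s + 0)) G =
      rdot (v t) (expflow B (- k) 0 G s).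
    rewrite /expflow rdotZl rdotZr rdot_grp.
    rewrite (_ : - (-1 * s + 0 - 0) = s - 0); last by ring.
    by rewrite (_ : k * (-1 * s + 0 - 0) = - k * (s - 0)); last by ring.
  rewrite !e1 mulN1r -rdotZr -rdotBr.
  move=> hd; have : - rdot (v t) (k%:C *: expflow B (- k) 0 g t -
      expflow B (- k) 0 ('i *: B g) t) = - rdot (v t) (w1 t).
    congr (- rdot _ _); rewrite -w1E; congr (_ - _).
    have [dg ge] := grp_dom (t - 0) Bg.
    by rewrite /w /expflow (opZ _ dg) ge grpZ !scalerA mulrC.
  move=> <-; move: hd; congr (is_derive _ _ _ _).
  by apply/funext => s; rewrite e1.
have /nbhs_ballP[r /= r0 rI] := open_nbhs_nbhs (conj oI It).
have Icl : [set` I] `<=` closure [set` I] by exact: subset_closure.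
apply: is_derive_eps => e e0; have e3 : 0 < e / 3 by lra.
have [d1 d10 d1P] := is_derive_epsP dw e3.
have V1 : 0 < rnorm (v t) + 1 by rewrite ltr_wpDl ?rnorm_ge0.
have W1 : 0 < rnorm (w1 t) + 1 by rewrite ltr_wpDl ?rnorm_ge0.
have h2 : 0 < Num.min 1 (e / 3 / (rnorm (v t) + 1)).
  by rewrite lt_min ltr01 divr_gt0.
have [d2 d20 d2P] := expflow_hcont B (- k) 0 g1 t h2.
have [d3 d30 d3P] := within_hcont cv (Icl _ It) (divr_gt0 e3 W1).
exists (Num.min (Num.min d1 d2) (Num.min d3 r)); first by rewrite !lt_min d10 d20 d30.
move=> h; rewrite !lt_min => /andP[/andP[hd1 hd2] /andP[hd3 hr]].
(* The derivative of v is available only against fixed vectors, while w(t + h) moves with h. The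
   mean value theorem, applied with w(t + h) fixed, avoids a remainder depending on it; continuity
   of v and w1 then controls the value at t + xi. *)
have [xi [xih xiE]] : exists xi, `|xi| <= `|h| /\
    rdot (v (t + h)) (w (t + h)) - rdot (v t) (w (t + h)) =
    h * rdot (v (t + xi)) (w1 (t + h)).
  have Ib s : `|s| <= `|h| -> [set` I] (t + s).
    move=> sh; apply: rI; rewrite /ball/= opprD addrA subrr sub0r normrN.
    exact: le_lt_trans sh hr.
  pose a := Num.min 0 h; pose b := Num.max 0 h.
  have ab : t + a <= t + b by rewrite lerD2l ge_min le_max lexx.
  have inab s : t + a <= s <= t + b -> `|s - t| <= `|h|.
    rewrite /a /b; have [h0|h0] := leP 0 h => /andP[? ?].
      by rewrite ger0_norm ?(ger0_norm h0); lra.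
    by rewrite ler0_norm ?(ltr0_norm h0); lra.
  have dvs s : t + a <= s <= t + b ->
      is_derive s 1 (fun r => rdot (v r) (w (t + h))) (rdot (v s) (w1 (t + h))).
    move=> sab; have Is : [set` I] s.
      by have := Ib (s - t) (inab _ sab); rewrite (addrC t) subrK.
    by have := dv _ _ (Bw (t + h)) Is; rewrite w1E.
  have cw : {within `[t + a, t + b], continuous (fun s => rdot (v s) (w (t + h)))}.
    apply: within_rdot; apply: continuous_subspaceW cv => s /=.
    rewrite in_itv/= => sab; apply: Icl.
    by have := Ib (s - t) (inab _ sab); rewrite (addrC t) subrK.
  have [|xi] := @MVT_segment R (fun s => rdot (v s) (w (t + h)))
    (fun s => rdot (v s) (w1 (t + h))) _ _ ab _ cw.
    by move=> s; rewrite in_itv/= => /andP[? ?]; apply: dvs; rewrite !ltW.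
  rewrite in_itv/= => xiab xiE; exists (xi - t).
  split; first exact: inab.
  rewrite (addrC t (xi - t)) subrK; move: xiE; rewrite /a /b.
  have [h0|h0] := leP 0 h; rewrite addr0 => e1.
    by rewrite e1; ring.
  by rewrite -[LHS]opprB e1; ring.
rewrite mulr0 subr0.
have -> : rdot (v (t + h)) (w (t + h)) - rdot (v t) (w t) =
    (rdot (v t) (w (t + h)) - rdot (v t) (w t) - h * - rdot (v t) (w1 t)) +
    h * (rdot (v (t + xi) - v t) (w1 (t + h)) +
         rdot (v t) (w1 (t + h) - w1 t)).
  by rewrite rdotBl rdotBr mulrDr !mulrBr -xiE; ring.
rewrite (le_trans (ler_normD _ _))// normrM.
have b1 := d1P h hd1.
have tK x : t + x - t = x by rewrite addrC addKr.
have b2 : `|rdot (v (t + xi) - v t) (w1 (t + h)) + rdot (v t) (w1 (t + h) - w1 t)|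
    <= e / 3 + e / 3.
  rewrite (le_trans (ler_normD _ _))// lerD//.
    rewrite (le_trans (rdot_le _ _))//.
    have Ixi : closure [set` I] (t + xi).
      by apply/Icl/rI; rewrite /ball/= opprD addrA subrr sub0r normrN (le_lt_trans xih).
    have := d3P _ Ixi; rewrite tK => /(_ (le_lt_trans xih hd3)).
    have := d2P (t + h); rewrite tK => /(_ hd2); rewrite lt_min => /andP[w11 _].
    rewrite ltr_pdivlMr// => vxi.
    have : rnorm (w1 (t + h)) <= rnorm (w1 t) + 1.
      by have := rnormD (w1 (t + h) - w1 t) (w1 t); rewrite subrK; move: w11; lra.
    have := rnorm_ge0 (v (t + xi) - v t); nra.
  rewrite (le_trans (rdot_le _ _))//.
  have := d2P (t + h); rewrite tK => /(_ hd2); rewrite lt_min => /andP[_].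
  rewrite ltr_pdivlMr// => wh.
  have := rnorm_ge0 (w1 (t + h) - w1 t); nra.
have := normr_ge0 h; nra.
Qed.

Lemma rdot_transported_cst g s t : dom B g -> [set` I] s -> [set` I] t ->
  rdot (v s) (expflow B (- k) 0 g s) = rdot (v t) (expflow B (- k) 0 g t).
Proof.
move=> Bg; wlog st : s t / s <= t.
  move=> h Is It; have [st|/ltW ts] := leP s t; first exact: h.
  by apply/esym/h.
move=> Is It; pose p t := rdot (v t) (expflow B (- k) 0 g t).
have dp r : s <= r <= t -> is_derive r 1 p 0.
  move=> srt; apply: rdot_transported_derive => //.
  exact: (@interval_is_interval R I s t).
have cp : {within `[s, t], continuous p}.
  apply/subspace_continuousP => r /=; rewrite in_itv/= => srt.
  apply: cvg_within_filter; apply: differentiable_continuous.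
  by apply/derivable1_diffP; case: (dp _ srt).
have [|r _] := @MVT_segment R p (fun=> 0) s t st _ cp.
  by move=> r; rewrite in_itv/= => /andP[? ?]; apply: dp; rewrite !ltW.
by rewrite mul0r => /eqP; rewrite subr_eq0 eq_sym => /eqP.
Qed.

(** The solution transported back to time 0, called z, has constant pairings with all g in D(B);
    density makes z constant, and flowing forward again gives the formula. *)
Lemma weak_solution_expflow_open s t : [set` I] s -> [set` I] t ->
  v t = expflow B k s (v s) t.
Proof.
move=> Is It.
pose z r := expflow B k 0 (v r) (- r).
have zE r g : rdot (z r) g = rdot (v r) (expflow B (- k) 0 g r).
  rewrite /z /expflow rdotZl rdotZr rdot_grp.
  rewrite (_ : - (- r - 0) = r - 0); last by ring.
  by rewrite (_ : k * (- r - 0) = - k * (r - 0)); last by ring.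
have zz : z s = z t.
  apply: rdot_inj => g; apply/eqP; rewrite -subr_eq0 -rdotBl -normr_eq0.
  rewrite eq_le normr_ge0 andbT; apply/ler_addgt0Pr => e e0; rewrite add0r.
  have n1 : 0 < rnorm (z s - z t) + 1 by rewrite ltr_wpDl ?rnorm_ge0.
  have [g' Bg' gg'] := dom_approx B g (divr_gt0 e0 n1).
  have : rdot (z s - z t) g' = 0.
    by rewrite rdotBl !zE (rdot_transported_cst Bg' Is It) subrr.
  move=> z0; rewrite -[rdot _ g]subr0 -z0 -rdotBr (le_trans (rdot_le _ _))//.
  move: gg'; rewrite ltr_pdivlMr//.
  have := rnorm_ge0 (g - g'); have := rnorm_ge0 (z s - z t); nra.
have vz r : v r = expflow B k 0 (z r) r.
  rewrite /z /expflow grpZ scalerA -grpD -rmorphM/= -expRD.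
  rewrite (_ : r - 0 + (- r - 0) = 0); last by ring.
  rewrite (_ : _ + _ = 0); last by ring.
  by rewrite expR0 scale1r grp0.
rewrite [LHS]vz -zz (vz s).
rewrite /expflow grpZ scalerA -grpD -rmorphM/= -expRD.
by congr ((expR _)%:C *: grp _ _ _); ring.
Qed.

Lemma weak_solution_expflow s t : [set` I] s -> closure [set` I] t ->
  v t = expflow B k s (v s) t.
Proof.
move=> Is clt; apply/eqP; rewrite -subr_eq0 -rnorm_eq0 eq_le rnorm_ge0 andbT.
apply/ler_addgt0Pr => e e0; rewrite add0r; have e2 : 0 < e / 2 by lra.
have [d d0 dP] := within_hcont cv clt e2.
have [d' d'0 d'P] := expflow_hcont B k s (v s) t e2.
have m0 : 0 < Num.min d d' by rewrite lt_min d0.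
have [|r [Ir /= tr]] := clt (ball t (Num.min d d')).
  exact: nbhsx_ballx.
move: tr; rewrite /ball/= distrC lt_min => /andP[rd rd'].
have := dP r (@subset_closure _ _ _ Ir) rd; have := d'P r rd'.
rewrite -(weak_solution_expflow_open Is Ir) => h1 h2.
have := rnorm_triangle (v r) (v t) (expflow B k s (v s) t).
rewrite (rnorm_distC (v t) (v r)); lra.
Qed.

End solution.
End uniqueness.

(** * The maximal operators *)

Section maximal_graphs.
Context {R : realType} {H : hilbertSpace R} (I : interval R).
Local Notation mu := (@lebesgue_measure R).
Implicit Types (A : selfadjoint_operator H) (G : H) (phi : R -> R).

Let mI : @measurable _ (measurableTypeR R) [set` I]. Proof. exact: measurable_itv. Qed.

Lemma weak_eq_split A (u f : preL2 H I) phi G : test_function I phi ->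
  \int[mu]_(t in [set` I])
    (phi t * (rdot (u t) ('i *: A G) - rdot (f t) ('i *: G))) =
  \int[mu]_(t in [set` I]) (phi t * rdot (u t) ('i *: A G)) -
  \int[mu]_(t in [set` I]) (phi t * rdot (f t) ('i *: G)).
Proof.
move=> tphi; have [M _ phi0] := test_support tphi.
have cphi := smooth_continuous (smooth_test tphi).
have phi0' t : M < `|t| -> phi t = 0 by move=> h; case: (phi0 t (or_intror h)).
rewrite -RintegralB//; [|exact: integrable_test cphi phi0'|exact: integrable_test cphi phi0'].
by apply: eq_Rintegral => t _; rewrite mulrBr.
Qed.

Lemma test_ae (u u' : preL2 H I) phi G M : continuous phi ->
  (forall t, M < `|t| -> phi t = 0) ->
  (\forall t \ae mu, [set` I] t -> u t = u' t) ->
  \int[mu]_(t in [set` I]) (phi t * rdot (u t) G) =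
  \int[mu]_(t in [set` I]) (phi t * rdot (u' t) G).
Proof.
move=> cphi phi0 uu'; apply: eq_Rintegral_ae => //.
- exact: integrable_test cphi phi0.
- exact: integrable_test cphi phi0.
- by apply: filterS uu' => t h It; rewrite (h It).
Qed.

Lemma weak_eq_ae A (u u' f f' : preL2 H I) :
  (\forall t \ae mu, [set` I] t -> u t = u' t) ->
  (\forall t \ae mu, [set` I] t -> f t = f' t) ->
  weak_eq A I u f -> weak_eq A I u' f'.
Proof.
move=> uu' ff' we phi G tphi AG.
have [M _ MP] := test_support tphi.
have sphi := smooth_test tphi.
have cphi := smooth_continuous sphi.
have cphi' := smooth_continuous (smooth_derive1 sphi).
have phi0 s : M < `|s| -> phi s = 0 by move=> h; case: (MP s (or_intror h)).
have phi1 s : M < `|s| -> derive1 phi s = 0 by move=> h; case: (MP s (or_intror h)).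
rewrite weak_eq_split// -(test_ae _ cphi' phi1 uu') -(test_ae _ cphi phi0 uu').
by rewrite -(test_ae _ cphi phi0 ff') -weak_eq_split// we.
Qed.

Lemma weak_eq_lin A (r : R) (u u' f f' : preL2 H I) :
  weak_eq A I u f -> weak_eq A I u' f' ->
  weak_eq A I (r%:C *: u + u' : preL2 H I) (r%:C *: f + f' : preL2 H I).
Proof.
move=> we we' phi G tphi AG.
have [M _ MP] := test_support tphi.
have sphi := smooth_test tphi.
have cphi := smooth_continuous sphi.
have cphi' := smooth_continuous (smooth_derive1 sphi).
have phi0 s : M < `|s| -> phi s = 0 by move=> h; case: (MP s (or_intror h)).
have phi1 s : M < `|s| -> derive1 phi s = 0 by move=> h; case: (MP s (or_intror h)).
have lin (psi : R -> R) (w w' : preL2 H I) G' : continuous psi ->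
    (forall s, M < `|s| -> psi s = 0) ->
    \int[mu]_(t in [set` I]) (psi t * rdot ((r%:C *: w + w' : preL2 H I) t) G') =
    r * \int[mu]_(t in [set` I]) (psi t * rdot (w t) G') +
    1 * \int[mu]_(t in [set` I]) (psi t * rdot (w' t) G').
  move=> cpsi psi0; rewrite -Rintegral_lin//; last 2 first.
  - exact: integrable_test cpsi psi0.
  - exact: integrable_test cpsi psi0.
  apply: eq_Rintegral => t _.
  rewrite [X in rdot X _](_ : _ = r%:C *: w t + w' t)//.
  rewrite rdotDl rdotZl; ring.
rewrite weak_eq_split// !lin//.
have := we phi G tphi AG; have := we' phi G tphi AG.
by rewrite !weak_eq_split// => -> ->; ring.
Qed.

Lemma L2_fun0 : \forall t \ae mu, [set` I] t -> L2_fun (0 : L2 H I) t = 0.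
Proof.
have := L2_funP 0 (0 : L2 H I) 0; rewrite scale0r addr0.
have := L2_funP (-1) (0 : L2 H I) 0; rewrite scaleN1r oppr0 addr0.
by apply: filterS2 => t h1 h2 It; rewrite h1// scaleN1r addNr.
Qed.

Lemma maximal_graph_lin A (r : R) (u u' f f' : L2 H I) :
  maximal_graph A u f -> maximal_graph A u' f' ->
  maximal_graph A (r%:C *: u + u') (r%:C *: f + f').
Proof.
move=> /maximal_graph_weak we /maximal_graph_weak we'.
apply/maximal_graph_weak; apply: weak_eq_ae (weak_eq_lin r we we').
- by have := L2_funP r%:C u u'; apply: filterS => t h It; rewrite h.
- by have := L2_funP r%:C f f'; apply: filterS => t h It; rewrite h.
Qed.

Lemma maximal_graph_shift A (x k : R) (u f : L2 H I) (v h : preL2 H I) :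
  (\forall t \ae mu, [set` I] t -> v t = L2_fun u t) ->
  (\forall t \ae mu, [set` I] t -> h t = L2_fun f t) ->
  weak_shift (shift_op A x) k I v h ->
  maximal_graph A u (f + (x +i* k) *: u).
Proof.
move=> vu hf /weak_eq_shift ws; apply/maximal_graph_weak.
pose g : preL2 H I := h + (x +i* k) *: v.
have : weak_eq A I v g by exact: ws.
apply: weak_eq_ae => //; rewrite addrC.
have := L2_funP (x +i* k) u f; apply: filterS3 vu hf => t e1 e2 e3 It.
by rewrite e3// [LHS](_ : _ = h t + (x +i* k) *: v t)// e1// e2// addrC.
Qed.

Lemma weak_shift_maximal_graph A (x k : R) (u : L2 H I) :
  maximal_graph A u ((x +i* k) *: u) ->
  weak_shift (shift_op A x) k I (L2_fun u) (fun=> 0).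
Proof.
move=> /maximal_graph_weak we; apply/weak_eq_shift.
have -> : (fun t => 0 + (x +i* k) *: L2_fun u t) =
    ((x +i* k) *: L2_fun u : preL2 H I).
  by apply/funext => t; rewrite add0r.
apply: weak_eq_ae we; first exact: aeW.
have := L2_funP (x +i* k) u 0; have := L2_fun0.
by apply: filterS2 => t h0 h It; rewrite -[X in L2_fun X]addr0 h// h0// addr0.
Qed.

(** The exceptional null set depends on G. Approximating a countable dense set S by vectors of D(A)
    to every accuracy 1 / (m + 1) leaves countably many G; off one null set d(t) is then orthogonal
    to vectors arbitrarily close to itself, hence zero. *)
Lemma ae_zero_of_pairing (sepH : separable H) (A : selfadjoint_operator H)
  (d : preL2 H I) :
  (forall G, dom A G -> \forall t \ae mu, [set` I] t -> rdot (d t) G = 0) ->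
  \forall t \ae mu, [set` I] t -> d t = 0.
Proof.
move=> d0; have [S cS dS] := sepH.
have /choice[g gP] (z : H * nat) : exists y, dom A y /\
    rnorm (z.1 - y) < z.2.+1%:R^-1.
  have [|y Ay zy] := @dom_approx R H A z.1 z.2.+1%:R^-1; first by rewrite invr_gt0.
  by exists y.
have [i iP] : exists i : H -> nat, {in S &, injective i}.
  exact/countable_injP.
(* S is indexed through an injection into nat, so codes attained by no element of S give vacuous
   conditions. *)
pose P n t := forall y, S y -> i y = n -> forall m, [set` I] t ->
  rdot (d t) (g (y, m)) = 0.
have : forall n, \forall t \ae mu, P n t.
  move=> n; have [[y [Sy iy]]|nex] := pselect (exists y, S y /\ i y = n).
    have : forall m, \forall t \ae mu, [set` I] t -> rdot (d t) (g (y, m)) = 0.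
      by move=> m; apply: d0; case: (gP (y, m)).
    move=> /ae_foralln; apply: filterS => t h y' Sy' iy' m It.
    by rewrite (_ : y' = y) ?h//; apply: iP; rewrite ?inE// iy'.
  by apply: aeW => t y Sy iy; exfalso; apply: nex; exists y.
move=> /ae_foralln; apply: filterS => t h It.
apply/eqP; rewrite -rnorm_eq0 eq_le rnorm_ge0 andbT.
apply/ler_addgt0Pr => e e0; rewrite add0r.
have e2 : 0 < e / 2 by lra.
have ec : 0 < (e / 2)%:C by rewrite ltcR.
have [|y [/= ty Sy]] := dS (ball (d t) (e / 2)%:C) _ (ball_open (d t) _).
  by exists (d t); exact: ballxx.
move: ty; rewrite -ball_normE/= -rnormE ltcR => ty.
have [N _ /(_ N (leqnn _)) /= NN] := near_infty_natSinv_lt (PosNum e2).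
have [_ /= gy] := gP (y, N).
have gd := h _ y Sy erefl N It.
have dg : rnorm (d t - g (y, N)) <= e.
  rewrite (le_trans (rnorm_triangle y _ _))// [leRHS]splitr.
  by rewrite lerD// ltW// (lt_trans gy).
have : rnorm (d t) ^+ 2 <= rnorm (d t) * e.
  rewrite -rdotxx -[X in X <= _]subr0 -gd -rdotBr.
  rewrite (le_trans (ler_norm _))// (le_trans (rdot_le _ _))//.
  by rewrite ler_wpM2l ?rnorm_ge0.
have [->|dt0] := eqVneq (rnorm (d t)) 0; first by move=> _; exact: ltW.
by rewrite expr2 ler_pM2l// lt0r dt0 rnorm_ge0.
Qed.

(** Subtracting reduces this to u = 0, where the equation says that f - f' has zero pairing with
    every test function and every vector of D(A). *)
Lemma maximal_graph_inj (sepH : separable H) (oI : open [set` I]) A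
  (u f f' : L2 H I) : maximal_graph A u f -> maximal_graph A u f' -> f = f'.
Proof.
move=> mf mf'; have := maximal_graph_lin (-1) mf mf'.
have -> : (-1)%:C = -1 :> R[i] by rewrite rmorphN.
rewrite !scaleN1r addNr => /maximal_graph_weak we.
set d := - f + f' in we; suff d0 : d = 0.
  by apply/esym/eqP; rewrite -subr_eq0 addrC -/d d0.
rewrite -[LHS]L2_funK -[RHS]L2_funK; apply/L2_class_eq.
have zero : weak_eq A I (0 : preL2 H I) (L2_fun d).
  by apply: weak_eq_ae we; [exact: L2_fun0|exact: aeW].
suff : \forall t \ae mu, [set` I] t -> L2_fun d t = 0.
  by have := L2_fun0; apply: filterS2 => t h0 hd It; rewrite h0// hd.
apply: (@ae_zero_of_pairing sepH A) => G AG.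
have iG a b : `[a, b] `<=` [set` I] ->
    mu.-integrable `]a, b[ (EFin \o (fun t => rdot (L2_fun d t) G)).
  move=> abI; have := @integrable_rdot R H `]a, b[.
  have sab : [set` `]a, b[] `<=` [set` I].
    by apply: subset_trans abI; apply: subset_itv; rewrite bnd_simp.
  have hd : (L2_fun d : R -> H) \in @sq_integrable _ H `]a, b[.
    have /sq_integrableP[[s ss sd] id] := valP (L2_fun d).
    apply/sq_integrableP; split.
      by exists s => // t tab; apply: sd; exact: sab.
    by apply: integrableS id => //; exact: measurable_itv.
  move=> /(_ (PreL2 hd) (fun=> G) (hcont_cst G)); apply.
  apply: (integrable_within (c := a) (d := b)) => //.
  by apply: continuous_subspaceT; exact: cst_continuous.
apply: ae_eq0_open => // a b abI.
apply: (@integral_eq0_cutoff _ I) => //; first exact: (iG).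
(* Testing with -i G cancels the factor i in the source term of [weak_eq] and leaves <d, G>. *)
move=> phi tphi; have AG' : dom A ((- 'i) *: G) by exact: domZ.
have z0 : \int[mu]_(t in [set` I])
    (derive1 phi t * rdot ((0 : preL2 H I) t) (- 'i *: G)) = 0.
  rewrite /Rintegral integral0_eq// => t _.
  by rewrite [X in rdot X _](_ : _ = 0)// rdot0l mulr0.
have := zero phi _ tphi AG'; rewrite z0.
move=> /esym; rewrite (_ : (fun t => _) = fun t => -1 * (phi t * rdot (L2_fun d t) G)).
  move=> h; suff : -1 * \int[mu]_(t in [set` I]) (phi t * rdot (L2_fun d t) G) = 0.
    by move=> /eqP; rewrite mulN1r oppr_eq0 => /eqP.
  rewrite -RintegralZl//.
  have [M _ MP] := test_support tphi.
  apply: integrable_test (smooth_continuous (smooth_test tphi)) _ => s Ms.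
  by case: (MP s (or_intror Ms)).
apply/funext => t; rewrite [X in rdot X _ - _](_ : _ = 0)// rdot0l sub0r.
rewrite scaleNr scalerN scaleii opprK; ring.
Qed.

End maximal_graphs.

Lemma Rintegral_subset (R : realType) (A B : set R) (g : R -> R) :
  @measurable _ (measurableTypeR R) A -> @measurable _ (measurableTypeR R) B ->
  A `<=` B -> (forall t, 0 <= g t) ->
  (@lebesgue_measure R).-integrable B (EFin \o g) ->
  \int[lebesgue_measure]_(t in A) g t <= \int[lebesgue_measure]_(t in B) g t.
Proof.
move=> mA mB AB g0 ig; rewrite /Rintegral fine_le//.
- by apply: integrable_fin_num => //; exact: integrableS ig.
- exact: integrable_fin_num.
- apply: ge0_subset_integral => //; first exact: (measurable_int _ ig).
  by move=> t _; rewrite lee_fin.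
Qed.

(** * Solvability and norm bounds on one interval *)

Section solutions.
Context {R : realType} {H : hilbertSpace R} (I : interval R).
Local Notation mu := (@lebesgue_measure R).
Implicit Types (A : selfadjoint_operator H) (u f : L2 H I) (v : R -> H) (x k e t : R) (c : H).

Let mI : @measurable _ (measurableTypeR R) [set` I]. Proof. exact: measurable_itv. Qed.
Let mT : @measurable _ (measurableTypeR R) setT. Proof. exact: measurableT. Qed.

Definition sq_norm u : R := \int[mu]_(t in [set` I]) (rnorm (L2_fun u t) ^+ 2).

Definition represents v u :=
  hcont v /\ \forall t \ae mu, [set` I] t -> v t = L2_fun u t.

Lemma integrable_sq u :
  mu.-integrable [set` I] (EFin \o (fun t => rnorm (L2_fun u t) ^+ 2)).
Proof. by have /sq_integrableP[_] := valP (L2_fun u). Qed.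

Lemma sq_norm_ge0 u : 0 <= sq_norm u.
Proof. by apply: Rintegral_ge0 => t _; exact: sqr_ge0. Qed.

Lemma boundary_value_represents v u t : represents v u -> boundary_value u t (v t).
Proof.
move=> [cv vu]; exists v; split=> //.
by apply: continuous_subspaceT; exact: hcont_continuous.
Qed.

Lemma representsD v v' u u' : represents v u -> represents v' u' ->
  represents (fun t => v t + v' t) (u + u').
Proof.
move=> [cv vu] [cv' vu']; split; first exact: hcontD.
have := L2_funP 1 u u'; rewrite scale1r; apply: filterS3 vu vu' => t e1 e2 e3 It.
by rewrite e3// scale1r e1// e2.
Qed.

Lemma represents_exists v : hcont v ->
  mu.-integrable [set` I] (EFin \o (fun t => rnorm (v t) ^+ 2)) ->
  exists u, represents v u.
Proof.
move=> cv iv; have vI : v \in @sq_integrable R H I.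
  by apply/sq_integrableP; split=> //; exact: hcont_bochner.
exists (L2_class (PreL2 vI)); split=> //.
by have := L2_classK (PreL2 vI); apply: filterS => t h It; rewrite h.
Qed.

Lemma sq_norm_represents v u : represents v u ->
  mu.-integrable [set` I] (EFin \o (fun t => rnorm (v t) ^+ 2)) ->
  sq_norm u = \int[mu]_(t in [set` I]) (rnorm (v t) ^+ 2).
Proof.
move=> [cv vu] iv; apply: eq_Rintegral_ae => //; first exact: integrable_sq.
by apply: filterS vu => t h It; rewrite h.
Qed.

Lemma sq_normD u u' : sq_norm (u + u') <= 2 * sq_norm u + 2 * sq_norm u'.
Proof.
rewrite /sq_norm -Rintegral_lin//; [|exact: integrable_sq..].
pose w : preL2 H I := L2_fun u + L2_fun u'.
have /sq_integrableP[_ iw] := valP w.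
have -> : \int[mu]_(t in [set` I]) (rnorm (L2_fun (u + u') t) ^+ 2) =
    \int[mu]_(t in [set` I]) (rnorm (w t) ^+ 2).
  apply: eq_Rintegral_ae => //; first exact: integrable_sq.
  have := L2_funP 1 u u'; rewrite scale1r; apply: filterS => t h It.
  by rewrite h// scale1r.
apply: le_Rintegral => //.
  by apply: integrable_lin => //; exact: integrable_sq.
move=> t _; rewrite [w t](_ : _ = L2_fun u t + L2_fun u' t)//.
have := parallelogram (L2_fun u t) (L2_fun u' t).
have := sqr_ge0 (rnorm (L2_fun u t - L2_fun u' t)); lra.
Qed.

Lemma maximal_graph_represents A x k u f v (h : preL2 H I) :
  represents v u -> mu.-integrable [set` I] (EFin \o (fun t => rnorm (v t) ^+ 2)) ->
  (\forall t \ae mu, [set` I] t -> h t = L2_fun f t) ->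
  weak_shift (shift_op A x) k I v h ->
  maximal_graph A u (f + (x +i* k) *: u).
Proof.
move=> [cv vu] iv hf ws; have vI : v \in @sq_integrable R H I.
  by apply/sq_integrableP; split=> //; exact: hcont_bochner.
exact: (@maximal_graph_shift _ _ _ _ _ _ _ _ (PreL2 vI) h).
Qed.

(** Values outside I of a representative are arbitrary; the Duhamel integral runs over the whole
    line and must not see them. *)
Let extend0 v t : H := if t \in I then v t else 0.

Lemma bochner_extend0 v : bochner_measurable [set` I] v ->
  bochner_measurable setT (extend0 v).
Proof.
move=> [s ss sv]; exists (fun n => extend0 (s n)) => [n|t _].
  have [fs ms] := ss n; split.
    apply: (@sub_finite_set _ _ ([set 0] `|` range (s n))).
      move=> _ [t _ <-]; rewrite /extend0; case: ifPn => _; last by left.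
      by right; exists t.
    by rewrite finite_setU; split.
  move=> y; rewrite (_ : _ @^-1` _ = ([set` I] `&` s n @^-1` [set y]) `|`
      (~` [set` I] `&` [set t | 0 = y])).
    apply: measurableU; first by apply: measurableI => //; exact: ms.
    have [<-|y0] := eqVneq 0 y.
      rewrite (_ : [set t : R | 0 = 0 :> H] = setT) ?setIT; last by apply/seteqP; split.
      exact: measurableC.
    rewrite (_ : [set t : R | 0 = y] = set0) ?setI0//; apply/seteqP; split=> // t /= h.
    by move: y0; rewrite h eqxx.
  apply/seteqP; split=> t /=; rewrite /extend0.
    by case: ifPn => [It h|/negP It h]; [left|right]; split.
  by move=> [[-> //]|[/negP/negbTE-> //]].
rewrite /extend0; case: ifPn => It; first by apply: sv.
exact: cvg_cst.
Qed.

(** This is the Duhamel integral of f extended by zero. The last clause records that it vanishes at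
    t when no part of I lies on the side of t from which the kernel collects; at such an endpoint a
    boundary value can be prescribed freely. *)
Lemma solve_particular A x k f : k != 0 -> exists u v,
  [/\ represents v u, maximal_graph A u (f + (x +i* k) *: u),
    sq_norm u <= `|k|^-1 ^+ 2 * sq_norm f,
    forall t, rnorm (v t) ^+ 2 <= `|k|^-1 * sq_norm f &
    forall t, (forall s, [set` I] s -> k * (s - t) <= 0) -> v t = 0].
Proof.
move=> k0; pose F := extend0 (L2_fun f).
have /sq_integrableP[bf iff] := valP (L2_fun f).
have bF : bochner_measurable setT F by exact: bochner_extend0.
have FE : (EFin \o (fun t => rnorm (F t) ^+ 2)) =
    (EFin \o (fun t => rnorm (L2_fun f t) ^+ 2)) \_ [set` I].
  apply/funext => t /=; rewrite /F /extend0 patchE mem_setE; case: ifPn => // _.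
  by rewrite rnorm0 expr0n.
have iF : mu.-integrable setT (EFin \o (fun t => rnorm (F t) ^+ 2)).
  by rewrite FE -(integrable_mkcond _ mI).
have nF : \int[mu]_t (rnorm (F t) ^+ 2) = sq_norm f.
  by rewrite /Rintegral /sq_norm /Rintegral [in RHS]integral_mkcond -FE.
pose B := shift_op A x; pose Y := duhamel B k0 bF iF.
pose y t : H := (Num.sg k)%:C *: ('i *: Y t).
have yY t : rnorm (y t) = rnorm (Y t).
  by rewrite rnormZc rnormZc cabsi mul1r cabsC normr_sg k0 mul1r.
have cy : hcont y.
  apply: (@hcontZ _ _ (fun=> Num.sg k) (fun t => 'i *: Y t)).
    exact: cst_continuous.
  move=> t e /(duhamel_hcont B k0 bF iF t)[d d0 dP]; exists d => // s /dP.
  by rewrite -scalerBr rnormZc cabsi mul1r.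
have [iY leY] := duhamel_L2 B k0 bF iF.
have iyT : mu.-integrable setT (EFin \o (fun t => rnorm (y t) ^+ 2)).
  by apply: eq_integrable iY => // t _ /=; rewrite yY.
have iy : mu.-integrable [set` I] (EFin \o (fun t => rnorm (y t) ^+ 2)).
  exact: integrableS iyT.
have [u yu] := represents_exists cy iy.
exists u, y; split=> //.
- apply: (maximal_graph_represents yu iy); first exact: aeW.
  move=> phi G tphi BG; rewrite [LHS](@duhamel_weak _ _ B _ _ k0 bF iF I phi G tphi BG).
  by apply: eq_Rintegral => t; rewrite inE => It; rewrite /F /extend0 ifT.
- rewrite (sq_norm_represents yu iy) -nF (le_trans _ leY)//.
  rewrite [leRHS](_ : _ = \int[mu]_t (rnorm (y t) ^+ 2)); last first.
    by apply: eq_Rintegral => t _; rewrite yY.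
  by apply: Rintegral_subset => // t; exact: sqr_ge0.
- by move=> t; rewrite yY -nF; exact: duhamel_sup.
- move=> t h; rewrite /y /Y duhamel_eq0 ?scaler0// => s ks.
  rewrite /F /extend0 ifF//; apply/negP => /h.
  by rewrite leNgt ks.
Qed.

(** The squared norm of the flow is |c|^2 times the kernel [decay (2 * k) t e], of integral 1/|2k|;
    equality holds when I is the whole half-line on the decaying side of e. *)
Lemma integral_expflow (B : selfadjoint_operator H) k e c : k != 0 ->
  (forall t, [set` I] t -> 0 < k * (e - t)) ->
  [/\ mu.-integrable [set` I] (EFin \o (fun t => rnorm (expflow B k e c t) ^+ 2)),
   \int[mu]_(t in [set` I]) (rnorm (expflow B k e c t) ^+ 2) <= `|2 * k|^-1 * rnorm c ^+ 2 &
   (forall t, 0 < k * (e - t) -> [set` I] t) ->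
   \int[mu]_(t in [set` I]) (rnorm (expflow B k e c t) ^+ 2) = `|2 * k|^-1 * rnorm c ^+ 2].
Proof.
move=> k0 eI; have k20 : 2 * k != 0 by rewrite mulf_neq0.
pose d t := decay (2 * k) t e.
have dE t : d t = decay (- (2 * k)) e t by rewrite /d decay_sym.
have id : mu.-integrable setT (EFin \o d).
  have := @integrable_decay R (- (2 * k)) e; rewrite oppr_eq0 => /(_ k20).
  by apply: eq_integrable => // t _ /=; rewrite dE.
have idI : mu.-integrable [set` I] (EFin \o d) by exact: integrableS id.
have Ed : \int[mu]_t d t = `|2 * k|^-1.
  by rewrite /Rintegral integral_decay_left.
have expE t : [set` I] t -> rnorm (expflow B k e c t) ^+ 2 = rnorm c ^+ 2 * d t.
  move=> It; rewrite rnorm_expflow /d /decay ifT; last first.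
    by rewrite -mulrA mulr_gt0// eI.
  rewrite exprMn mulrC; congr (_ * _); rewrite expr2 -expRD; congr expR; ring.
have ic : mu.-integrable [set` I] (EFin \o (fun t => rnorm c ^+ 2 * d t)).
  exact: (integrableZl mI _ idI).
have E : \int[mu]_(t in [set` I]) (rnorm (expflow B k e c t) ^+ 2) =
    \int[mu]_(t in [set` I]) (rnorm c ^+ 2 * d t).
  by apply: eq_Rintegral => t; rewrite inE => It; rewrite expE.
split.
- by apply: eq_integrable ic => // t; rewrite inE => It /=; rewrite expE.
- rewrite E RintegralZl// mulrC ler_wpM2r ?sqr_ge0// -Ed.
  by apply: Rintegral_subset => // t; exact: decay_ge0.
- move=> Ie; rewrite E RintegralZl// mulrC -Ed; congr (_ * _).
  apply/esym/eq_Rintegral_supp => // t _ nIt; rewrite /d /decay ifF//.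
  by apply/negP; rewrite -mulrA pmulr_rgt0// => /Ie.
Qed.

Lemma solve_homogeneous A x k e c : k != 0 ->
  (forall t, [set` I] t -> 0 < k * (e - t)) -> exists u,
  [/\ represents (expflow (shift_op A x) k e c) u, maximal_graph A u ((x +i* k) *: u) &
    sq_norm u <= `|2 * k|^-1 * rnorm c ^+ 2 /\
    ((forall t, 0 < k * (e - t) -> [set` I] t) -> sq_norm u = `|2 * k|^-1 * rnorm c ^+ 2)].
Proof.
move=> k0 eI; have [ie le eq] := integral_expflow (shift_op A x) c k0 eI.
have [u ru] := represents_exists (expflow_hcont _ _ _ _) ie.
exists u; rewrite (sq_norm_represents ru ie); split=> //.
rewrite -[_ *: _]add0r.
apply: (@maximal_graph_represents _ _ _ _ _ _ (0 : preL2 H I) ru ie).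
  by have := @L2_fun0 R H I; apply: filterS => t h It; rewrite h.
exact: weak_shift_expflow.
Qed.

Lemma solve A x k f e c : k != 0 -> (forall t, [set` I] t -> 0 < k * (e - t)) ->
  exists u v, [/\ represents v u, maximal_graph A u (f + (x +i* k) *: u),
    sq_norm u <= 2 * `|k|^-1 ^+ 2 * sq_norm f + `|k|^-1 * rnorm c ^+ 2,
    v e = c &
    forall t, rnorm (v t - expflow (shift_op A x) k e c t) ^+ 2 <= `|k|^-1 * sq_norm f].
Proof.
move=> k0 eI.
have [u1 [v1 [r1 m1 n1 b1 z1]]] := solve_particular A x f k0.
have [u2 [r2 m2 [n2 _]]] := solve_homogeneous A x c k0 eI.
exists (u1 + u2), (fun t => v1 t + expflow (shift_op A x) k e c t); split.
- exact: representsD.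
- have := maximal_graph_lin 1 m1 m2; rewrite !scale1r.
  by rewrite -addrA -scalerDr.
- rewrite (le_trans (sq_normD _ _))// lerD//.
    by rewrite -mulrA ler_pM2l.
  rewrite (le_trans (_ : _ <= 2 * (`|2 * k|^-1 * rnorm c ^+ 2)))//.
    by rewrite ler_pM2l.
  by rewrite normrM invfM !mulrA normr_nat divff// mul1r.
- rewrite expflow_start z1 ?add0r// => s /eI; rewrite -[s - e]opprB mulrN oppr_le0.
  exact: ltW.
- by move=> t; rewrite addrK.
Qed.

End solutions.

(** Banach iteration from 0. The ball of radius D = |L 0| / (1 - q) is invariant because |L y| <= (1
    - q) D + q |y|, so distances between iterates are at most q^n D. *)
Lemma contraction_fixed (R : realType) (H : hilbertSpace R) (L : H -> H) (q : R) :
  0 <= q < 1 -> (forall x y, rnorm (L x - L y) <= q * rnorm (x - y)) ->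
  exists2 c, c = L c & (1 - q) * rnorm c <= rnorm (L 0).
Proof.
move=> /andP[q0 q1] Lq; have q1' : 0 < 1 - q by rewrite subr_gt0.
pose x n := iter n L 0; pose D := rnorm (L 0) / (1 - q).
have D0 : 0 <= D by rewrite divr_ge0 ?rnorm_ge0 ?ltW.
have DE : rnorm (L 0) = (1 - q) * D by rewrite mulrC divfK ?gt_eqF.
have leL y : rnorm (L y) <= rnorm (L 0) + q * rnorm y.
  have := Lq y 0; rewrite subr0 => h.
  by have := rnorm_triangle (L 0) (L y) 0; rewrite !subr0; lra.
have xD n : rnorm (x n) <= D.
  elim: n => [|n ih]; first by rewrite /x/= rnorm0.
  by rewrite (le_trans (leL _))// DE; have := ler_wpM2l q0 ih; lra.
have xq n m : rnorm (x (n + m)%N - x n) <= q ^+ n * D.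
  elim: n => [|n ih]; first by rewrite add0n expr0 mul1r /x/= subr0; exact: xD.
  by rewrite (le_trans (Lq _ _))// exprS -mulrA ler_wpM2l.
have qD e : 0 < e -> exists N, q ^+ N * D < e.
  move=> e0; have D1 : 0 < D + 1 by rewrite ltr_wpDl.
  have : (fun n => q ^+ n) @ \oo --> (0 : R) by apply: cvg_expr; rewrite ger0_norm.
  move=> /cvgrPdist_lt /(_ (e / (D + 1))) []; first by rewrite divr_gt0.
  move=> N _ /(_ N (leqnn _)) /=; rewrite sub0r normrN ger0_norm ?exprn_ge0//.
  rewrite ltr_pdivlMr// => h; exists N; apply: le_lt_trans h.
  by rewrite ler_wpM2l ?exprn_ge0// lerDl.
have [l xl] : exists l, tends x l.
  apply: complete_tends => e e0; have [|N NP] := qD (e / 2); first by rewrite divr_gt0.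
  exists N => n m Nn Nm.
  have := xq N (n - N)%N; have := xq N (m - N)%N; rewrite !subnKC// => h1 h2.
  by have := rnorm_triangle (x N) (x n) (x m); rewrite (rnorm_distC (x N)); lra.
have lL : l = L l.
  apply/eqP; rewrite -subr_eq0 -rnorm_eq0 eq_le rnorm_ge0 andbT.
  apply/ler_addgt0Pr => e e0; rewrite add0r.
  have [|N NP] := xl (e / 2); first by rewrite divr_gt0.
  have h1 := NP _ (leqnSn N); have h2 := NP _ (leqnn N).
  have h3 := Lq (x N) l.
  have h4 : q * rnorm (x N - l) <= rnorm (x N - l).
    by rewrite ler_piMl ?rnorm_ge0 ?ltW.
  have := rnorm_triangle (L (x N)) l (L l).
  by move: h1; rewrite [x N.+1]/= (rnorm_distC l (L (x N))); lra.
exists l => //; have := leL l; rewrite -lL; lra.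
Qed.

(** * Boundary values of homogeneous solutions *)

Section intervals.
Context {R : realType} {H : hilbertSpace R} (I : interval R).
Local Notation mu := (@lebesgue_measure R).
Implicit Types (A : selfadjoint_operator H) (u f : L2 H I) (v : R -> H) (x k e t : R) (c h : H).

Let mI : @measurable _ (measurableTypeR R) [set` I]. Proof. exact: measurable_itv. Qed.

Lemma ae_exists (P : R -> Prop) a b : a < b -> `]a, b[ `<=` [set` I] ->
  (\forall t \ae mu, [set` I] t -> P t) -> exists2 t, [set` I] t & P t.
Proof.
move=> ab abI aeP; apply: contrapT => nex.
have : mu.-negligible `]a, b[%classic.
  move: aeP; apply: negligibleS => t abt /= It; apply: nex; exists t.
    exact: abI.
  by apply: It; exact: abI.
move=> [N [mN N0 abN]].
have : (mu `]a, b[%classic <= mu N)%E by apply: le_measure; rewrite ?inE.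
rewrite N0 lebesgue_measure_itv/= lte_fin ab -EFinB lee_fin; lra.
Qed.

(** Flowing from an interior time to the endpoint and back again recovers the solution from its
    boundary value. *)
Lemma boundary_value_expflow A x k u e h : open [set` I] -> closure [set` I] e ->
  maximal_graph A u ((x +i* k) *: u) -> boundary_value u e h ->
  represents (expflow (shift_op A x) k e h) u.
Proof.
move=> oI cle /weak_shift_maximal_graph ws [v [vu cv ve]].
split; first exact: expflow_hcont.
apply: filterS (vu) => t vut It; rewrite -vut// -ve.
by rewrite (weak_solution_expflow oI vu cv ws It cle) expflow_add expflow_start.
Qed.

(** The flows started from the two boundary values agree almost everywhere, hence at some t of I;
    transporting from t to e' compares them there. *)
Lemma boundary_values_expflow A x k u a b e e' h h' : a < b -> `]a, b[ `<=` [set` I] ->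
  open [set` I] -> closure [set` I] e -> closure [set` I] e' ->
  maximal_graph A u ((x +i* k) *: u) -> boundary_value u e h ->
  boundary_value u e' h' -> h' = expflow (shift_op A x) k e h e'.
Proof.
move=> ab abI oI cle cle' mu_ bh bh'.
have [_ r] := boundary_value_expflow oI cle mu_ bh.
have [_ r'] := boundary_value_expflow oI cle' mu_ bh'.
have : \forall t \ae mu, [set` I] t ->
    expflow (shift_op A x) k e h t = expflow (shift_op A x) k e' h' t.
  by apply: filterS2 r r' => t h1 h2 It; rewrite h1// h2.
move=> /(ae_exists ab abI)[t It eqt].
by rewrite -(expflow_add _ _ _ t) eqt expflow_add expflow_start.
Qed.

Lemma represents0 u v : represents v u -> (forall t, v t = 0) -> u = 0.
Proof.
move=> [_ vu] v0; rewrite -[LHS]L2_funK -[RHS]L2_funK; apply/L2_class_eq.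
have := @L2_fun0 R H I; apply: filterS2 vu => t h1 h2 It.
by rewrite -h1// v0 h2.
Qed.

Lemma expflow0 (B : selfadjoint_operator H) k e t : expflow B k e 0 t = 0.
Proof. by apply/eqP; rewrite -rnorm_eq0 rnorm_expflow rnorm0 mulr0. Qed.

(** On the growing side the norm stays at least |h|, and I contains intervals of every length n, so
    n |h|^2 is bounded by the squared norm of u. *)
Lemma expflow_not_L2 (B : selfadjoint_operator H) k e h u :
  represents (expflow B k e h) u -> (forall t, [set` I] t -> 0 <= k * (t - e)) ->
  (forall n : nat, exists a : R, `]a, a + n%:R[ `<=` [set` I]) -> h = 0.
Proof.
move=> [cv vu] kI nI; apply/eqP; rewrite -rnorm_eq0 -[_ == 0]sqrf_eq0 eq_le sqr_ge0 andbT.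
have key n : n%:R * rnorm h ^+ 2 <= sq_norm u.
  have [a aI] := nI n.
  have iu := integrable_sq u.
  have iuc : mu.-integrable `]a, a + n%:R[ (EFin \o (fun t => rnorm (L2_fun u t) ^+ 2)).
    by apply: integrableS iu => //; exact: measurable_itv.
  have iv : mu.-integrable `]a, a + n%:R[ (EFin \o (fun t => rnorm (expflow B k e h t) ^+ 2)).
    apply: (@integrable_within _ _ a (a + n%:R)) => //.
    apply: continuous_subspaceT => t; under eq_fun do rewrite expr2.
    by apply: cvgM; exact: continuous_rnorm.
  have le1 := Rintegral_subset (measurable_itv _) mI aI (fun t => sqr_ge0 _) iu.
  apply: le_trans le1.
  rewrite (@eq_Rintegral_ae _ _ _ (fun t => rnorm (expflow B k e h t) ^+ 2))//; last first.
    by apply: filterS vu => t e1 ct; rewrite e1//; exact: aI.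
  have [->|n0] := eqVneq n 0%N; first by rewrite mul0r Rintegral_ge0// => t _; exact: sqr_ge0.
  have n1 : a < a + n%:R by rewrite ltrDl ltr0n lt0n.
  have mJ : @measurable _ (measurableTypeR R) `]a, a + n%:R[ by exact: measurable_itv.
  have E : \int[mu]_(t in `]a, a + n%:R[) (rnorm h ^+ 2) = n%:R * rnorm h ^+ 2.
    transitivity (rnorm h ^+ 2 * fine (mu `]a, a + n%:R[)).
      exact: (Rintegral_cst _ mJ).
    rewrite lebesgue_measure_itv/= lte_fin n1 -EFinB/= mulrC.
    by congr (_ * _); rewrite addrAC subrr add0r.
  rewrite -E.
  apply: le_Rintegral => //.
  - apply: (@integrable_within _ _ a (a + n%:R)) => //.
    by apply: continuous_subspaceT; exact: cst_continuous.
  - move=> t /aI It; rewrite rnorm_expflow; apply: lerXn2r; rewrite ?nnegrE ?rnorm_ge0//.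
      by rewrite mulr_ge0 ?expR_ge0 ?rnorm_ge0.
    by rewrite ler_peMl ?rnorm_ge0// -expR0 ler_expR kI.
rewrite leNgt; apply/negP => h0.
have := archi_boundP (divr_ge0 (sq_norm_ge0 u) (ltW h0)).
by rewrite ltr_pdivrMr// ltNge key.
Qed.

End intervals.

(** * Boundary conditions *)

Section existence.
Context {R : realType} {H : hilbertSpace R}.
Implicit Types (A : selfadjoint_operator H) (x k e t : R) (c h : H).

Lemma unitary_rnorm (W : {linear H -> H}) c : unitary W -> rnorm (W c) = rnorm c.
Proof.
move=> [Wdot _]; apply/eqP; rewrite -(@eqrXn2 _ 2)// ?rnorm_ge0//.
by rewrite -!hdot_rnorm Wdot.
Qed.

Lemma expflowB (B : selfadjoint_operator H) k e c d t :
  expflow B k e c t - expflow B k e d t = expflow B k e (c - d) t.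
Proof. by rewrite /expflow grpB scalerBr. Qed.

(** V carries the value at the far end e' to the end e where the particular solution vanishes. It is
    only assumed isometric with V 0 = 0, so that both W_2 and its inverse qualify, according to the
    sign of k. *)
Lemma solve_periodic (I : interval R) A x k e e' (V : H -> H) : k != 0 ->
  (forall t, [set` I] t -> 0 < k * (e - t)) -> k * (e' - e) < 0 ->
  (forall c d, rnorm (V c - V d) = rnorm (c - d)) -> V 0 = 0 ->
  exists K, forall f : L2 H I, exists u v, [/\ represents v u,
    maximal_graph A u (f + (x +i* k) *: u), V (v e') = v e &
    sq_norm u <= K * sq_norm f].
Proof.
move=> k0 eI ee' VB V0; pose q := expR (k * (e' - e)).
have q1 : q < 1 by rewrite -expR0 ltr_expR.
have q1' : 0 < 1 - q by rewrite subr_gt0.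
(* The first term bounds the particular solution. The second bounds the homogeneous one through |c|
   <= |y(e')| / (1 - q) and |y(e')|^2 <= |f|^2 / |k|. *)
exists (2 * `|k|^-1 ^+ 2 + `|k|^-1 * ((1 - q)^-1 ^+ 2 * `|k|^-1)) => f.
have [u0 [y [r0 m0 n0 b0 z0]]] := solve_particular A x f k0.
set B := shift_op A x.
have [||c cE cle] := @contraction_fixed _ H (fun c => V (y e' + expflow B k e c e')) q.
- by rewrite expR_ge0.
- by move=> c d; rewrite VB opprD addrACA subrr add0r expflowB rnorm_expflow.
have [u1 [r1 m1 [n1 _]]] := solve_homogeneous A x c k0 eI.
exists (u0 + u1), (fun t => y t + expflow B k e c t); split.
- exact: representsD.
- have := maximal_graph_lin 1 m0 m1; rewrite !scale1r.
  by rewrite -addrA -scalerDr.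
- rewrite -cE expflow_start z0 ?add0r// => s /eI.
  by rewrite -[s - e]opprB mulrN oppr_le0; exact: ltW.
have c2 : rnorm c ^+ 2 <= (1 - q)^-1 ^+ 2 * `|k|^-1 * sq_norm f.
  have : rnorm c <= (1 - q)^-1 * rnorm (y e').
    rewrite mulrC ler_pdivlMr// mulrC (le_trans cle)//.
    have := VB (y e' + expflow B k e 0 e') 0.
    by rewrite V0 !subr0 expflow0 addr0 => ->.
  move=> /(lerXn2r 2); rewrite !nnegrE => /(_ (rnorm_ge0 _)).
  rewrite mulr_ge0 ?rnorm_ge0 ?invr_ge0 ?(ltW q1')// => /(_ isT) h.
  by rewrite (le_trans h)// exprMn -mulrA ler_wpM2l ?sqr_ge0.
rewrite (le_trans (sq_normD _ _))// [leRHS]mulrDl lerD//.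
  by rewrite -mulrA ler_pM2l.
rewrite (le_trans (_ : _ <= 2 * (`|2 * k|^-1 * rnorm c ^+ 2)))//.
  by rewrite ler_pM2l.
rewrite normrM invfM !mulrA normr_nat divff// mul1r -!mulrA ler_wpM2l//.
by move: c2; rewrite !expr2 !mulrA.
Qed.

Section coupled_half_lines.
Variables (a1 a3 : R) (A1 A3 : selfadjoint_operator H) (W : {linear H -> H}).
Hypothesis uW : unitary W.
Local Notation I1 := `]-oo, a1[.
Local Notation I3 := `]a3, +oo[.

Lemma solve_half_lines x k (f1 : L2 H I1) (f3 : L2 H I3) : k != 0 ->
  exists u1 u3 h, [/\ maximal_graph A1 u1 (f1 + (x +i* k) *: u1),
    maximal_graph A3 u3 (f3 + (x +i* k) *: u3),
    boundary_value u1 a1 h, boundary_value u3 a3 (W h) &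
    sq_norm u1 + sq_norm u3 <= 2 * `|k|^-1 ^+ 2 * (sq_norm f1 + sq_norm f3)].
Proof.
move=> k0; have ki : 0 <= `|k|^-1 by rewrite invr_ge0.
have [kneg|kpos|k00] := ltgtP k 0; last by rewrite k00 eqxx in k0.
- have [u1 [v1 [r1 m1 n1 b1 _]]] := solve_particular A1 x f1 k0.
  have [|u3 [v3 [r3 m3 n3 b3 _]]] := solve A3 x f3 (W (v1 a1)) k0 (e := a3).
    move=> t /=; rewrite in_itv/= andbT => ta.
    by rewrite nmulr_rgt0// subr_lt0.
  exists u1, u3, (v1 a1); split=> //.
  + exact: boundary_value_represents.
  + by rewrite -b3; exact: boundary_value_represents.
  (* The boundary value contributes |v1(a1)|^2 / |k| <= |f1|^2 / k^2; with the 1 / k^2 of [n1] this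
     makes the coefficient of |f1|^2 equal to the 2 / k^2 of |f3|^2. *)
  + move: n3; rewrite unitary_rnorm// => n3.
    have b1' : `|k|^-1 * rnorm (v1 a1) ^+ 2 <= `|k|^-1 ^+ 2 * sq_norm f1.
      by rewrite [`|k|^-1 ^+ 2]expr2 -mulrA ler_wpM2l.
    by have := sq_norm_ge0 f1; move: n1 n3 b1'; set z := `|k|^-1 ^+ 2; lra.
- have [u3 [v3 [r3 m3 n3 b3 _]]] := solve_particular A3 x f3 k0.
  have [h Wh] := uW.2 (v3 a3).
  have [|u1 [v1 [r1 m1 n1 b1 _]]] := solve A1 x f1 h k0 (e := a1).
    move=> t /=; rewrite in_itv/= => ta.
    by rewrite mulr_gt0// subr_gt0.
  exists u1, u3, h; split=> //.
  + by rewrite -b1; exact: boundary_value_represents.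
  + by rewrite Wh; exact: boundary_value_represents.
  + have b3' : `|k|^-1 * rnorm h ^+ 2 <= `|k|^-1 ^+ 2 * sq_norm f3.
      by rewrite [`|k|^-1 ^+ 2]expr2 -mulrA ler_wpM2l// -(unitary_rnorm h uW) Wh.
    by have := sq_norm_ge0 f3; move: n1 n3 b3'; set z := `|k|^-1 ^+ 2; lra.
Qed.

End coupled_half_lines.
End existence.

Lemma closure_within (R : realType) (D : set R) a :
  (forall e, 0 < e -> exists2 t, D t & `|t - a| < e) -> closure D a.
Proof.
move=> Da B /nbhs_ballP[e /= e0 eB]; have [t Dt ta] := Da e e0.
by exists t; split=> //; apply: eB; rewrite /ball/= distrC.
Qed.

Lemma closure_endpoints (R : realType) (a b : R) : a < b ->
  closure [set` `]a, b[] a /\ closure [set` `]a, b[] b.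
Proof.
move=> ab; have ba : 0 < b - a by rewrite subr_gt0.
split; apply: closure_within => e e0.
- have [m me mb] : exists2 m, 0 < m <= e & m <= b - a.
    by exists (Num.min e (b - a)); rewrite ?lt_min ?e0 ?ba ge_min lexx ?orbT.
  by exists (a + m / 2) => /=; [rewrite in_itv/=; lra|rewrite addrAC subrr add0r gtr0_norm; lra].
- have [m me mb] : exists2 m, 0 < m <= e & m <= b - a.
    by exists (Num.min e (b - a)); rewrite ?lt_min ?e0 ?ba ge_min lexx ?orbT.
  exists (b - m / 2) => /=; first by rewrite in_itv/=; lra.
  by rewrite addrAC subrr add0r normrN gtr0_norm; lra.
Qed.

Section uniqueness.
Context {R : realType} {H : hilbertSpace R}.
Implicit Types (A : selfadjoint_operator H) (x k e t : R) (c h : H).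

Section half_lines.
Variables (a1 a3 : R) (A1 A3 : selfadjoint_operator H) (W : {linear H -> H}).
Hypothesis uW : unitary W.
Local Notation I1 := `]-oo, a1[.
Local Notation I3 := `]a3, +oo[.

Lemma half_lines_unique x k (u1 : L2 H I1) (u3 : L2 H I3) h : k != 0 ->
  maximal_graph A1 u1 ((x +i* k) *: u1) -> maximal_graph A3 u3 ((x +i* k) *: u3) ->
  boundary_value u1 a1 h -> boundary_value u3 a3 (W h) -> u1 = 0 /\ u3 = 0.
Proof.
move=> k0 m1 m3 b1 b3.
have c1 : closure [set` I1] a1.
  apply: closure_within => e e0; exists (a1 - e / 2) => /=.
    by rewrite in_itv/= ltrBlDr ltrDl divr_gt0.
  by rewrite addrAC subrr add0r normrN gtr0_norm ?divr_gt0// ltr_pdivrMr// ltr_pMr// ltr1n.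
have c3 : closure [set` I3] a3.
  apply: closure_within => e e0; exists (a3 + e / 2) => /=.
    by rewrite in_itv/= ltrDl divr_gt0.
  by rewrite addrAC subrr add0r gtr0_norm ?divr_gt0// ltr_pdivrMr// ltr_pMr// ltr1n.
have o1 : open [set` I1] by exact: interval_open.
have o3 : open [set` I3] by exact: interval_open.
have r1 := boundary_value_expflow o1 c1 m1 b1.
have r3 := boundary_value_expflow o3 c3 m3 b3.
suff h0 : h = 0.
  split; first by apply: (represents0 r1) => t; rewrite h0 expflow0.
  by apply: (represents0 r3) => t; rewrite h0 linear0 expflow0.
(* For k < 0 growth takes place towards -oo on I_1. For k > 0 it is on I_3, whose boundary value is
   W h, and the isometry W sends only 0 to 0. *)
have [kneg|kpos|k00] := ltgtP k 0; last by rewrite k00 eqxx in k0.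
- apply: expflow_not_L2 r1 _ _ => [t /=|n].
    by rewrite in_itv/= => ta; rewrite nmulr_rge0// subr_le0 ltW.
  exists (a1 - n%:R) => t /=; rewrite !in_itv/= subrK.
  by case/andP.
- apply/eqP; rewrite -rnorm_eq0 -(unitary_rnorm h uW) rnorm_eq0; apply/eqP.
  apply: expflow_not_L2 r3 _ _ => [t /=|n].
    by rewrite in_itv/= andbT => ta; rewrite mulr_ge0 ?ltW// subr_gt0.
  by exists a3 => t /=; rewrite !in_itv/= andbT; case/andP.
Qed.

End half_lines.

Lemma periodic_unique A a b (W : {linear H -> H}) x k (u : L2 H `]a, b[) h :
  unitary W -> a < b -> k != 0 -> maximal_graph A u ((x +i* k) *: u) ->
  boundary_value u a h -> boundary_value u b (W h) -> u = 0.
Proof.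
move=> uW ab k0 m ba bb.
have [ca cb] := closure_endpoints ab.
have oI : open [set` `]a, b[] by exact: interval_open.
have E := boundary_values_expflow ab (@subset_refl _ _) oI ca cb m ba bb.
have r := boundary_value_expflow oI ca m ba.
suff h0 : h = 0 by apply: (represents0 r) => t; rewrite h0 expflow0.
apply/eqP; rewrite -rnorm_eq0; apply: contraT => h0.
have := congr1 rnorm E; rewrite rnorm_expflow unitary_rnorm// -[LHS]mul1r.
move=> /(mulIf h0)/esym/eqP; rewrite -expR0 (inj_eq (@expR_inj R)).
by rewrite mulf_eq0 (negbTE k0) subr_eq0 gt_eqF.
Qed.

End uniqueness.

(** * The spectrum *)

Section assembly.
Context {R : realType} {H : hilbertSpace R}.
Local Notation mu := (@lebesgue_measure R).

Lemma sq_normZ (I : interval R) (z : R[i]) (u : L2 H I) :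
  sq_norm (z *: u) = cabs z ^+ 2 * sq_norm u.
Proof.
have mI : @measurable _ (measurableTypeR R) [set` I] by exact: measurable_itv.
have iu := integrable_sq u.
have izu : mu.-integrable [set` I] (EFin \o (fun t => cabs z ^+ 2 * rnorm (L2_fun u t) ^+ 2)).
  exact: (integrableZl mI _ iu).
rewrite /sq_norm -RintegralZl//; apply: eq_Rintegral_ae => //; first exact: integrable_sq.
have := L2_funP z u 0; have := @L2_fun0 R H I.
apply: filterS2 => t h0 h It; have := h It; rewrite addr0 h0// addr0 => ->.
by rewrite rnormZc exprMn.
Qed.

Lemma represents_cst0 (I : interval R) : represents (fun=> 0) (0 : L2 H I).
Proof.
split; first exact: hcont_cst.
by have := @L2_fun0 R H I; apply: filterS => t h It; rewrite h.
Qed.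

(** Some pair in the graph is supplied by [solve_particular]; subtracting it from itself gives the
    zero pair. *)
Lemma maximal_graph0 (I : interval R) (A : selfadjoint_operator H) :
  maximal_graph A (0 : L2 H I) 0.
Proof.
have [u [v [_ m _ _ _]]] := @solve_particular R H I A 0 1 0 (oner_neq0 _).
have := maximal_graph_lin (-1) m m.
by rewrite rmorphN1 !scaleN1r !addNr.
Qed.

Hypothesis sepH : separable H.

(** The value chosen by [xget] is the only possible one by [maximal_graph_inj]; from here on the
    operator can be treated as its graph. *)
Lemma maximal_operatorP (I : interval R) (A : selfadjoint_operator H) u f :
  open [set` I] -> maximal_graph A u f <->
  dom (maximal_operator A I) u /\ maximal_operator A I u = f.
Proof.
move=> oI; split=> [m|[[g m] <-]].
  split; first by exists f.
  apply: (maximal_graph_inj sepH oI _ m).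
  by apply: (@xgetPex _ 0 [set f | maximal_graph A u f]); exists f.
by apply: (@xgetPex _ 0 [set f | maximal_graph A u f]); exists g.
Qed.

Variables (a1 a2 b2 a3 : R) (A1 A2 A3 : selfadjoint_operator H).
Variables W1 W2 : {linear H -> H}.
Hypotheses (ab2 : a2 < b2) (uW1 : unitary W1) (uW2 : unitary W2).

Local Notation T := (L_W1W2 a1 a2 b2 a3 A1 A2 A3 W1 W2).
Local Notation E := (L2sum (H := H) a1 a2 b2 a3).
Local Notation d := (L2sum_dot (H := H) a1 a2 b2 a3).

Lemma L_W1W2P (u f : E) : (dom T u /\ T u = f) <->
  [/\ maximal_graph A1 u.1.1 f.1.1, maximal_graph A2 u.1.2 f.1.2,
    maximal_graph A3 u.2 f.2,
    (exists2 h, boundary_value u.1.1 a1 h & boundary_value u.2 a3 (W1 h)) &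
    (exists2 h, boundary_value u.1.2 a2 h & boundary_value u.1.2 b2 (W2 h))].
Proof.
have o1 : open [set` `]-oo, a1[] by exact: interval_open.
have o2 : open [set` `]a2, b2[] by exact: interval_open.
have o3 : open [set` `]a3, +oo[] by exact: interval_open.
case: u f => [[u1 u2] u3] [[f1 f2] f3] /=.
split=> [[[[[d1 d2] d3] [bc1 bc2]] [e1 e2 e3]]|[]].
  by split=> //; apply/maximal_operatorP.
move=> /(maximal_operatorP _ _ _ o1)[d1 e1] /(maximal_operatorP _ _ _ o2)[d2 e2].
move=> /(maximal_operatorP _ _ _ o3)[d3 e3] bc1 bc2.
by rewrite -e1 -e2 -e3.
Qed.

Lemma dot_normE (u : E) :
  dot_norm d u = Num.sqrt (sq_norm u.1.1 + sq_norm u.1.2 + sq_norm u.2).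
Proof.
rewrite /dot_norm (_ : d u u =
  L2_dot u.1.1 u.1.1 + L2_dot u.1.2 u.1.2 + L2_dot u.2 u.2)//.
by rewrite !ReD !L2_dotE.
Qed.

Lemma nonreal_injective x k (u u' : E) : k != 0 -> dom T u -> dom T u' ->
  T u - (x +i* k) *: u = T u' - (x +i* k) *: u' -> u = u'.
Proof.
move=> k0 Du Du' eT; set l := x +i* k.
have /L_W1W2P[m1 m2 m3 [h bh1 bh3] [g bg2 bg3]] : dom T u /\ T u = T u by [].
have /L_W1W2P[m1' m2' m3' [h' bh1' bh3'] [g' bg2' bg3']] : dom T u' /\ T u' = T u' by [].
have eT' : T u' = T u - l *: u + l *: u' by rewrite eT subrK.
(* Differences are written -w + w' to match [maximal_graph_lin] with coefficient -1; each component
   difference solves the homogeneous equation. *)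
have diff (I : interval R) (A : selfadjoint_operator H) (w w' f f' : L2 H I) :
    maximal_graph A w f -> maximal_graph A w' f' -> f - l *: w = f' - l *: w' ->
    maximal_graph A (- w + w') (l *: (- w + w')).
  move=> m m' e; have := maximal_graph_lin (-1) m m'.
  suff -> : (-1)%:C *: f + f' = l *: (- w + w') by rewrite rmorphN1 scaleN1r.
  have -> : f = f' - l *: w' + l *: w by rewrite -e subrK.
  rewrite rmorphN1 scaleN1r scalerDr scalerN !opprD opprK.
  by rewrite addrC !addrA subrr add0r addrC.
have bdiff (I : interval R) (w w' : L2 H I) t b b' : boundary_value w t b ->
    boundary_value w' t b' -> boundary_value (- w + w') t (- b + b').
  move=> [v [vw cv <-]] [v' [vw' cv' <-]]; exists (fun t => - v t + v' t); split=> //.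
    have := L2_funP (-1) w w'; rewrite scaleN1r.
    by apply: filterS3 vw vw' => s e1 e2 e3 Is; rewrite e3// scaleN1r e1// e2.
  by move=> s; apply: cvgD; [apply: cvgN; exact: cv|exact: cv'].
have eqs : [/\ (T u).1.1 - l *: u.1.1 = (T u').1.1 - l *: u'.1.1,
    (T u).1.2 - l *: u.1.2 = (T u').1.2 - l *: u'.1.2 &
    (T u).2 - l *: u.2 = (T u').2 - l *: u'.2].
  split; [exact: (congr1 (fun w : E => w.1.1) eT)|exact: (congr1 (fun w : E => w.1.2) eT)|
    exact: (congr1 (fun w : E => w.2) eT)].
have [q1 q2 q3] := eqs.
have [||e1 e3] := half_lines_unique uW1 k0 (diff _ _ _ _ _ _ m1 m1' q1)
    (diff _ _ _ _ _ _ m3 m3' q3) (h := - h + h').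
- exact: bdiff.
- by rewrite linearD linearN; exact: bdiff.
have e2 : - u.1.2 + u'.1.2 = 0.
  apply: (periodic_unique uW2 ab2 k0 (diff _ _ _ _ _ _ m2 m2' q2) (h := - g + g')).
    exact: bdiff.
  by rewrite linearD linearN; exact: bdiff.
have sub0 (I : interval R) (w w' : L2 H I) : - w + w' = 0 -> w = w'.
  by move=> /eqP; rewrite addrC subr_eq0 => /eqP.
apply: injective_projections; last exact: sub0 e3.
by apply: injective_projections; [exact: sub0 e1|exact: sub0 e2].
Qed.

Lemma nonreal_solution x k : k != 0 -> exists K, forall f : E, exists u,
  [/\ dom T u, T u - (x +i* k) *: u = f & dot_norm d u <= K * dot_norm d f].
Proof.
move=> k0; set l := x +i* k.
have [K KP] : exists K, forall f : L2 H `]a2, b2[, exists u,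
    [/\ maximal_graph A2 u (f + l *: u), (exists2 h, boundary_value u a2 h &
      boundary_value u b2 (W2 h)) & sq_norm u <= K * sq_norm f].
  have [kneg|kpos|k00] := ltgtP k 0; last by rewrite k00 eqxx in k0.
  (* For k < 0 solutions decay from a2 towards b2, so the value at a2 must be recovered from that at
     b2: the boundary map is the inverse of W_2, here a right inverse obtained by choice. *)
  - have /choice[V WV] := uW2.2.
    have VB c c' : rnorm (V c - V c') = rnorm (c - c').
      by rewrite -(unitary_rnorm _ uW2) linearB !WV.
    have V0 : V 0 = 0.
      by apply/eqP; rewrite -rnorm_eq0 -(unitary_rnorm _ uW2) WV rnorm0.
    have [||K KP] := @solve_periodic R H `]a2, b2[ A2 x k a2 b2 V k0 _ _ VB V0.
    + by move=> t /=; rewrite in_itv/= => /andP[t1 _]; rewrite nmulr_rgt0// subr_lt0.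
    + by rewrite nmulr_rlt0// subr_gt0.
    exists K => f; have [u [v [r m vE n]]] := KP f; exists u; split=> //.
    exists (v a2); first exact: boundary_value_represents.
    by rewrite -vE WV; exact: boundary_value_represents.
  - have VB c c' : rnorm (W2 c - W2 c') = rnorm (c - c').
      by rewrite -linearB unitary_rnorm.
    have [||K KP] := @solve_periodic R H `]a2, b2[ A2 x k b2 a2 W2 k0 _ _ VB (linear0 _).
    + by move=> t /=; rewrite in_itv/= => /andP[_ t1]; rewrite mulr_gt0// subr_gt0.
    + by rewrite pmulr_rlt0// subr_lt0.
    exists K => f; have [u [v [r m vE n]]] := KP f; exists u; split=> //.
    exists (v a2); first exact: boundary_value_represents.
    by rewrite vE; exact: boundary_value_represents.
pose M := Num.max (2 * `|k|^-1 ^+ 2) K.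
have M0 : 0 <= M by rewrite le_max mulr_ge0// sqr_ge0.
exists (Num.sqrt M) => -[[f1 f2] f3].
have [u1 [u3 [h [m1 m3 b1 b3 n13]]]] := solve_half_lines A1 A3 uW1 x f1 f3 k0.
have [u2 [m2 b2' n2]] := KP f2.
have [|Du Tu] := (L_W1W2P (u1, u2, u3) (f1 + l *: u1, f2 + l *: u2, f3 + l *: u3)).2.
  by split=> //; exists h.
exists (u1, u2, u3); split=> //.
  by rewrite Tu; apply: injective_projections; [apply: injective_projections|];
    rewrite /= addrK.
rewrite !dot_normE/= -sqrtrM// ler_wsqrtr//.
have := sq_norm_ge0 f1; have := sq_norm_ge0 f2; have := sq_norm_ge0 f3.
have l1 : 2 * `|k|^-1 ^+ 2 <= M by rewrite le_max lexx.
have l2 : K <= M by rewrite le_max lexx orbT.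
move=> p3 p2 p1.
have := ler_wpM2r p2 l2; have := ler_wpM2r (addr_ge0 p1 p3) l1.
rewrite !mulrDr; lra.
Qed.

Lemma nonreal_resolvent x k : k != 0 -> resolvent_set d T (x +i* k).
Proof.
move=> k0; have [K KP] := nonreal_solution x k0; split.
  split=> //.
  - move=> u u' /set_mem Du /set_mem Du' e; exact: nonreal_injective Du Du' e.
  - by move=> f _; have [u [Du uf _]] := KP f; exists u.
exists K => u Du; have [u' [Du' uf' n]] := KP (T u - (x +i* k) *: u).
by move: n; rewrite -(nonreal_injective k0 Du Du' (esym uf')).
Qed.

Hypothesis dimH : exists x : H, x != 0.

Lemma real_spectrum x : ~ resolvent_set d T x%:C.
Proof.
move=> [_ [c cP]]; have [y y0] := dimH.
(* This makes c del < 1, contradicting the alleged resolvent bound |u| <= c |(T - x) u| = c del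
   |u|. *)
pose del := (`|c| + 1)^-1.
have c1 : 0 < `|c| + 1 by rewrite ltr_wpDl.
have del0 : 0 < del by rewrite invr_gt0.
have dn0 : del != 0 by rewrite gt_eqF.
have mdn0 : - del != 0 by rewrite oppr_eq0.
have [|u1 [r1 m1 [_ n1]]] := @solve_homogeneous R H `]-oo, a1[ A1 x del a1 y dn0.
  by move=> t /=; rewrite in_itv/= => ta; rewrite mulr_gt0// subr_gt0.
have [|u3 [r3 m3 [_ n3]]] := @solve_homogeneous R H `]a3, +oo[ A3 x (- del) a3 (W1 y) mdn0.
  move=> t /=; rewrite in_itv/= andbT => ta.
  by rewrite nmulr_rgt0 ?oppr_lt0// subr_lt0.
pose S := sq_norm u1 + sq_norm u3.
(* I_1 is the whole half-line to the left of a1, so the exact norm formula applies and gives |y|^2 /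
   |2 del| > 0. *)
have S0 : 0 < S.
  rewrite /S n1; last first.
    by move=> t; rewrite pmulr_rgt0// subr_gt0 /= in_itv.
  rewrite ltr_wpDr ?sq_norm_ge0// mulr_gt0//.
    by rewrite invr_gt0 normr_gt0 mulf_neq0.
  by rewrite exprn_gt0// lt0r rnorm_eq0 y0 rnorm_ge0.
(* The outer components solve homogeneous equations with parameters x + i del and x - i del, so (T -
   x) u = (i del u1, 0, - i del u3). *)
have [|Du Tu] := (L_W1W2P (u1, 0, u3) ((x +i* del) *: u1, 0, (x +i* - del) *: u3)).2.
  split=> //=.
  - exact: maximal_graph0.
  - exists y; first by rewrite -(expflow_start (shift_op A1 x) del a1 y);
      exact: boundary_value_represents.
    by rewrite -[W1 y](expflow_start (shift_op A3 x) (- del) a3);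
      exact: boundary_value_represents.
  - exists 0; first exact: (boundary_value_represents a2 (represents_cst0 _)).
    by rewrite linear0; exact: (boundary_value_represents b2 (represents_cst0 _)).
have := cP _ Du; rewrite Tu !dot_normE/=.
have dif (I : interval R) (k : R) (u : L2 H I) :
    sq_norm ((x +i* k) *: u - x%:C *: u) = k ^+ 2 * sq_norm u.
  rewrite -scalerBl sq_normZ; congr (_ * _).
  by rewrite sqr_cabs/= subrr expr0n/= add0r subr0.
have z0 : sq_norm (0 : L2 H `]a2, b2[) = 0.
  by rewrite -(scale0r (0 : L2 H _)) sq_normZ cabsC normr0 expr0n mul0r.
rewrite !dif sqrrN scaler0 subr0 z0 !addr0 -mulrDr -/S sqrtrM ?sqr_ge0// sqrtr_sqr.
rewrite gtr0_norm// mulrA -[leLHS]mul1r ler_pM2r ?sqrtr_gt0//.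
rewrite leNgt => /negP; apply.
by rewrite ltr_pdivrMr// mul1r (le_lt_trans (ler_norm c))// ltrDl.
Qed.

End assembly.

Theorem theorem3p4 (R : realType) (H : hilbertSpace R)
    (sepH : separable H) (dimH : exists x : H, x != 0)
    (a1 a2 b2 a3 : R) (a12 : a1 < a2) (ab2 : a2 < b2) (ba23 : b2 < a3)
    (A1 A2 A3 : selfadjoint_operator H)
    (W1 W2 : {linear H -> H}) (uW1 : unitary W1) (uW2 : unitary W2) :
  spectrum (L2sum_dot a1 a2 b2 a3) (L_W1W2 a1 a2 b2 a3 A1 A2 A3 W1 W2) =
  [set x%:C | x in [set: R]].
Proof.
apply/seteqP; split=> [[x k] lS|_ [x _ <-]]; last exact: real_spectrum.
have [->|k0] := eqVneq k 0; first by exists x.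
by exfalso; apply: lS; exact: nonreal_resolvent.
Qed.
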